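(* Let $x^*\in\mathbb{R}^d$ and let $f:\mathbb{R}^d\to\mathbb{R}^d$ be $C^1$ in a neighborhood of $x^*$. Let $(X_n)_{n\in\mathbb{N}}$ be a random sequence in $\mathbb{R}^d$, adapted to a filtration $(\mathcal{F}_n)_{n\in\mathbb{N}}$, such that for all $n\ge0$ $$X_{n+1}-X_n=\gamma_{n+1}f(X_n)+c_{n+1}(\varepsilon_{n+1}+r_{n+1}),$$ with $\gamma,c,\varepsilon,r$ as in the context. Let $\Gamma$ be an event, set $\alpha(t)=\sqrt{\sum_{n>t}c_n^2}$ and suppose that: \begin{enumerate} \item[(i)] $x^*$ is a hyperbolic unstable equilibrium of $f$ and, with $\psi,\mathcal{N}^*,k^+$ as in the context, there are $\nu>0$ and $C_\nu<\infty$ such that for all $x\in\mathcal{N}^*$, setting $(u^+,u^-)=\psi(x)$, $\ \|k^+(u^+,u^-)-k^+(u^+,0)\|\le C_\nu\|u^-\|^{1+\nu}$; \item[(ii)] $\sum_{n>t}\gamma_n^2=O(\alpha(t))$ as $t\to\infty$; $\ \sum_n\gamma_n=\infty$; $\ \lambda:=\limsup_{t\to\infty}\frac{\log(\alpha(t))}{\sum_{k\le t}\gamma_k}<0$; $\ \liminf_{t\to\infty}\frac{\log(\alpha(t))}{\sum_{k\le t}\gamma_k}>\beta(1+\nu)$, where $\beta=\sup\{\lambda,\mu\}$ and $\mu$ is the largest real part of the eigenvalues of $H^-$; \item[(iii)] for some $a>2$, almost surely on $\Gamma$, $$0<\liminf_{n\to\infty}\mathbb{E}[\|\varepsilon^+_n\|^2|\mathcal{F}_{n-1}],\qquad\limsup_{n\to\infty}\mathbb{E}[\|\varepsilon_n\|^a|\mathcal{F}_{n-1}]<\infty,\qquad\sum_n\|r_n\|^2<\infty.$$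 \end{enumerate} Then $\mathbb{P}\big[\Gamma\cap\{\lim_{n\to\infty}X_n=x^*\}\big]=0$.
   Context: $\|\cdot\|$ is the norm of an inner product on the Euclidean space considered. $(\gamma_n)_{n\ge0}$ and $(c_n)_{n\ge0}$ are non-negative deterministic sequences with $c_n\ne0$ infinitely often and $\sum_nc_n^2<\infty$. $(\varepsilon_n)_{n\ge0}$ and $(r_n)_{n\ge0}$ are $\mathbb{R}^d$-valued sequences adapted to $(\mathcal{F}_n)$ such that for all $n\ge0$, $\mathbb{E}[\varepsilon_{n+1}|\mathcal{F}_n]=0$ and $\mathbb{E}[\|\varepsilon_{n+1}\|^2|\mathcal{F}_n]<\infty$. $x^*$ is an equilibrium of $f$ if $f(x^* )=0$; it is unstable if some eigenvalue of $Df(x^* )$ has positive real part, and hyperbolic if no eigenvalue of $Df(x^* )$ has zero real part. For a hyperbolic unstable $x^*$, fix integers $\delta^+\ge1$, $\delta^-=d-\delta^+$ (with $\delta^-\ge1$, so that $\mu$ is defined), an invertible real $d\times d$ matrix $P$ and real square matrices $H^\pm$ of size $\delta^\pm$ with $P^{-1}Df(x^* )P=\mathrm{diag}[H^+,H^-]$, all eigenvalues of $H^+$ having positive real part and all eigenvalues of $H^-$ having negative real part. For $y\in\mathbb{R}^d$ write $y=(y^+,y^-)\in\mathbb{R}^{\delta^+}\times\mathbb{R}^{\delta^-}$ and set $\varepsilon_n^\pm=(P^{-1}\varepsilon_n)^\pm$. Set $h(y)=P^{-1}f(x^*+Py)=(h^+(y),h^-(y))$. There are convex neighborhoods $\mathcal{N}^\pm$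 of $0$ in $\mathbb{R}^{\delta^\pm}$ and a $C^1$ function $g:\mathcal{N}^+\to\mathcal{N}^-$ with $g(0)=0$, $Dg(0)=0$, such that $h^-(y)=Dg(y^+)h^+(y)$ whenever $y\in\mathcal{N}:=\mathcal{N}^+\times\mathcal{N}^-$ and $y^-=g(y^+)$; the set of $x$ with $P^{-1}(x-x^* )\in\mathcal{N}$ lying on the graph of $g$ is the local unstable manifold of $f$ at $x^*$. Set $\mathcal{N}^*=\{x:P^{-1}(x-x^* )\in\mathcal{N}\}$ and, for $x\in\mathcal{N}^*$ with $y=P^{-1}(x-x^* )$, $\psi(x)=(u^+,u^-)=(y^+,\,y^--g(y^+))$. On $\psi(\mathcal{N}^* )$ define $k^+(u^+,u^-)=h^+(u^+,u^-+g(u^+))$. *)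

(* Defs.v *)
From HB Require Import structures.
From mathcomp Require Export all_boot all_order all_algebra.
From mathcomp Require Export sesquilinear complex.
From mathcomp Require Export all_classical all_reals all_analysis measurable_realfun.
Export Order.TTheory GRing.Theory Num.Theory.
Export numFieldNormedType.Exports.

#[export] Set Implicit Arguments.
#[export] Unset Strict Implicit.
#[export] Unset Printing Implicit Defensive.

#[global] Open Scope classical_set_scope.
#[global] Open Scope ring_scope.

(* Points of R^n are column vectors; their topology is the usual one. *)

Definition ipnorm (R : realType) (n : nat) (s : {dot 'cV[R]_n for idfun})
  (x : 'cV[R]_n) : R := Num.sqrt (s x x).

(* The library's [jacobian] is for row vectors; here
   [differential of f at x] v = jacmx f x *m v. *)
Definition jacmx (R : realType) (n m : nat) (f : 'cV[R]_n -> 'cV[R]_m)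
  (x : 'cV[R]_n) : 'M[R]_(m, n) :=
  \matrix_(i, j) ('d f x (delta_mx j 0)) i 0.

(* Functions on A are given by total functions; for A open the values outside
   of A do not matter, for other A this asks for an extension which is
   differentiable at the points of A. *)
Definition C1_on (R : realType) (n m : nat) (A : set 'cV[R]_n)
  (f : 'cV[R]_n -> 'cV[R]_m) : Prop :=
  (forall x, A x -> differentiable f x) /\ {within A, continuous (jacmx f)}.

Definition spectrum (R : realType) (n : nat) (A : 'M[R]_n) : set R[i] :=
  [set z | eigenvalue (map_mx (real_complex R) A) z].

Definition equilibrium (R : realType) (n : nat) (f : 'cV[R]_n -> 'cV[R]_n)
  (x : 'cV[R]_n) : Prop := f x = 0.

Definition unstable (R : realType) (n : nat) (f : 'cV[R]_n -> 'cV[R]_n)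
  (x : 'cV[R]_n) : Prop :=
  exists2 z, spectrum (jacmx f x) z & 0 < complex.Re z.

Definition hyperbolic (R : realType) (n : nat) (f : 'cV[R]_n -> 'cV[R]_n)
  (x : 'cV[R]_n) : Prop :=
  forall z, spectrum (jacmx f x) z -> complex.Re z != 0.

(* When 0 < n this is the maximum of a nonempty finite set. *)
Definition max_Re_spectrum (R : realType) (n : nat) (A : 'M[R]_n) : R :=
  sup [set complex.Re z | z in spectrum A].

(* R^(dp + dm) is R^dp x R^dm: y^+ = usubmx y and y^- = dsubmx y. *)

Definition hyperbolic_splitting (R : realType) (dp dm : nat)
  (A P : 'M[R]_(dp + dm)) (Hp : 'M[R]_dp) (Hm : 'M[R]_dm) : Prop :=
  [/\ P \in unitmx,
      invmx P *m A *m P = block_mx Hp 0 0 Hm,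
      forall z, spectrum Hp z -> 0 < complex.Re z &
      forall z, spectrum Hm z -> complex.Re z < 0].

Definition hmap (R : realType) (d : nat) (f : 'cV[R]_d -> 'cV[R]_d)
  (xstar : 'cV[R]_d) (P : 'M[R]_d) (y : 'cV[R]_d) : 'cV[R]_d :=
  invmx P *m f (xstar + P *m y).

Definition unstable_graph (R : realType) (dp dm : nat)
  (f : 'cV[R]_(dp + dm) -> 'cV[R]_(dp + dm)) (xstar : 'cV[R]_(dp + dm))
  (P : 'M[R]_(dp + dm)) (Np : set 'cV[R]_dp) (Nm : set 'cV[R]_dm)
  (g : 'cV[R]_dp -> 'cV[R]_dm) : Prop :=
  [/\ nbhs (0 : 'cV[R]_dp) Np /\ @convex_set R 'cV[R]_dp Np,
      nbhs (0 : 'cV[R]_dm) Nm /\ @convex_set R 'cV[R]_dm Nm,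
      (forall u, Np u -> Nm (g u)) /\ C1_on Np g,
      g 0 = 0 /\ jacmx g 0 = 0 &
      forall y, Np (usubmx y) -> Nm (dsubmx y) ->
        dsubmx y = g (usubmx y) ->
        dsubmx (hmap f xstar P y)
          = jacmx g (usubmx y) *m usubmx (hmap f xstar P y)].

Definition Nstar (R : realType) (dp dm : nat) (xstar : 'cV[R]_(dp + dm))
  (P : 'M[R]_(dp + dm)) (Np : set 'cV[R]_dp) (Nm : set 'cV[R]_dm) :
  set 'cV[R]_(dp + dm) :=
  [set x | let y := invmx P *m (x - xstar) in
           Np (usubmx y) /\ Nm (dsubmx y)].

Definition psi (R : realType) (dp dm : nat) (xstar : 'cV[R]_(dp + dm))
  (P : 'M[R]_(dp + dm)) (g : 'cV[R]_dp -> 'cV[R]_dm)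
  (x : 'cV[R]_(dp + dm)) : 'cV[R]_dp * 'cV[R]_dm :=
  let y := invmx P *m (x - xstar) in (usubmx y, dsubmx y - g (usubmx y)).

Definition kplus (R : realType) (dp dm : nat)
  (f : 'cV[R]_(dp + dm) -> 'cV[R]_(dp + dm)) (xstar : 'cV[R]_(dp + dm))
  (P : 'M[R]_(dp + dm)) (g : 'cV[R]_dp -> 'cV[R]_dm)
  (up : 'cV[R]_dp) (um : 'cV[R]_dm) : 'cV[R]_dp :=
  usubmx (hmap f xstar P (col_mx up (um + g up))).

(* Meaningful when the series of c_n^2 converges. *)
Definition alpha (R : realType) (c : nat -> R) (t : nat) : R :=
  Num.sqrt (fine (\sum_(t.+1 <= n <oo) (c n ^+ 2)%:E)%E).

Definition log_ratio (R : realType) (gamma c : nat -> R) (t : nat) : \bar R :=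
  (ln (alpha c t) / \sum_(k < t.+1) gamma k)%:E.

Definition filtration (disp : measure_display) (T : measurableType disp)
  (F : nat -> set (set T)) : Prop :=
  [/\ forall n, sigma_algebra setT (F n),
      forall n, F n `<=` measurable &
      forall m n, (m <= n)%N -> F m `<=` F n].

Definition measurable_wrt (disp dispU : measure_display)
  (T : measurableType disp) (U : measurableType dispU)
  (G : set (set T)) (Y : T -> U) : Prop :=
  measurable_fun [set: g_sigma_algebraType G] Y.

(* The target carries its Borel sigma-algebra. *)
Definition adapted (R : realType) (disp : measure_display)
  (T : measurableType disp) (d : nat) (F : nat -> set (set T))
  (X : nat -> T -> 'cV[R]_d) : Prop :=
  forall n, measurable_wrt (F n)
    (X n : T -> g_sigma_algebraType (@open 'cV[R]_d)).

(* Y is a version of E[X | G], for X nonnegative; no integrability of X is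
   required and Y may take the value +oo. *)
Definition is_condexp_ge0 (R : realType) (disp : measure_display)
  (T : measurableType disp) (Pr : probability T R) (G : set (set T))
  (X Y : T -> \bar R) : Prop :=
  [/\ forall w, (0 <= Y w)%E,
      measurable_wrt G Y &
      forall A, G A -> (\int[Pr]_(w in A) Y w = \int[Pr]_(w in A) X w)%E].

(* Z is a version of E[X | G] for real-valued X with E[|X| | G] < +oo almost
   surely: E[X | G] = E[X^+ | G] - E[X^- | G]. *)
Definition is_condexp (R : realType) (disp : measure_display)
  (T : measurableType disp) (Pr : probability T R) (G : set (set T))
  (X Z : T -> R) : Prop :=
  measurable_wrt G Z /\
  exists Yp Ym : T -> \bar R,
    [/\ is_condexp_ge0 Pr G (EFin \o X^\+) Yp,
        is_condexp_ge0 Pr G (EFin \o X^\-) Ym &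
        {ae Pr, forall w, [/\ (Yp w < +oo)%E, (Ym w < +oo)%E &
                              ((Z w)%:E = Yp w - Ym w)%E]}].

Definition is_condexp_vec (R : realType) (disp : measure_display)
  (T : measurableType disp) (Pr : probability T R) (G : set (set T))
  (d : nat) (X Z : T -> 'cV[R]_d) : Prop :=
  forall i, is_condexp Pr G (fun w => X w i 0) (fun w => Z w i 0).

(* Main.v *)
Require Import Defs.
From mathcomp Require Import ring lra.

(* In the coordinates y = P^-1 (x - xstar), put z = y^+.  The noise at time m
   has size c_m, so what is left of it after time n has size
   alpha(n) = sqrt (sum of c_k^2 over k > n).

   Repulsion.  Along the unstable directions one step is z -> p + c xi + rho
   with |p| >= |z|, for a norm adapted to H^+.  Whatever the position at time n,
   the bounded potential 1 / (1 + |z_m|^2 / D_m), with D_m of the order of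
   alpha(n)^2, decreases in mean by a definite amount before it can tend to 1,
   as long as the errors rho accumulated after time n sum to at most
   del * alpha(n).  So the event "z -> 0 with such small errors" never fills an
   event of F_n up to a fixed proportion, hence is null.

   Smallness of the errors.  The projected dynamics is that of
   k(z) = h^+(z, g z) up to |k^+(u^+, u^-) - k^+(u^+, 0)| <= C |u^-|^(1+nu).
   After subtracting the tails of the noise, which are O(alpha^th) for every
   th < 1, the distance u^- to the unstable manifold contracts like
   exp(mu' * sum of gamma), so the sum of gamma |u^-|^(1+nu) beyond n is
   o(alpha(n)) by hypothesis (ii); the terms c r contribute o(alpha(n)) by the
   Cauchy-Schwarz inequality. *)

(** * Inner products given by matrices *)

(** Hypothesis (iii) holds only eventually and with random constants. The argument is therefore
    localised on the events [moment_event V W j m] of F_m, where the bounds are 1/(j+1) and j+1;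
    countably many [j] and starting times exhaust almost all of Gamma. There, conditional
    inequalities are integral inequalities over sub-events ([cond_ge0]), which may be multiplied by
    bounded weights known at time m.

    The obstacle in the repulsion is that the second-order effect of the noise on the potential has
    the wrong sign once |z| is large compared with alpha(n). This is why the scale D_m decreases
    with m, by a multiple of c_{m+1}^2: the decrease of the scale lowers the potential by enough to
    pay for that term.

    The exponents come from the gaps in (ii). Let s be the partial sums of gamma. One takes mu < mu'
    < bet < 0 with bet (1 + nu) below the liminf, then lam' < bet with alpha <= exp(lam' s), and th
    = bet / lam' < 1, so that alpha^th <= exp(bet s). Replacing alpha by alpha^th in the noise tails
    thus still leaves a forcing that decays like exp(bet s), slower than the contraction at rate
    mu', and the distance to the manifold inherits the rate bet. *)

Definition ipm (R : realType) n (S : 'M[R]_n) (u v : 'cV[R]_n) : R :=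
  (u^T *m S *m v) 0 0.

Definition posdef (R : realType) n (S : 'M[R]_n) : Prop :=
  S^T = S /\ forall u : 'cV[R]_n, u != 0 -> 0 < ipm S u u.

Definition nrm (R : realType) n (S : 'M[R]_n) (u : 'cV[R]_n) : R :=
  Num.sqrt (ipm S u u).

Section InnerProduct.
Context (R : realType) (n : nat).
Implicit Types (S : 'M[R]_n) (u v w : 'cV[R]_n).

Lemma ipmE S u v : ipm S u v = \sum_i \sum_j u i 0 * S i j * v j 0.
Proof.
rewrite /ipm mxE exchange_big /=; apply: eq_bigr => j _.
rewrite mxE mulr_suml; apply: eq_bigr => i _; by rewrite !mxE.
Qed.

Lemma ipmDl S u v w : ipm S (u + v) w = ipm S u w + ipm S v w.
Proof. by rewrite /ipm linearD /= !mulmxDl mxE. Qed.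

Lemma ipmDr S u v w : ipm S u (v + w) = ipm S u v + ipm S u w.
Proof. by rewrite /ipm mulmxDr mxE. Qed.

Lemma ipmZl S k u v : ipm S (k *: u) v = k * ipm S u v.
Proof. by rewrite /ipm linearZ /= -!scalemxAl mxE. Qed.

Lemma ipmZr S k u v : ipm S u (k *: v) = k * ipm S u v.
Proof. by rewrite /ipm -scalemxAr mxE. Qed.

Lemma ipmC S u v : posdef S -> ipm S u v = ipm S v u.
Proof.
move=> [hS _]; rewrite /ipm.
have -> : u^T *m S *m v = (v^T *m S *m u)^T by rewrite !trmx_mul trmxK hS mulmxA.
by rewrite mxE.
Qed.

Lemma ipm_ge0 S u : posdef S -> 0 <= ipm S u u.
Proof.
move=> [_ hS]; have [->|/hS/ltW//] := eqVneq u 0.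
by rewrite /ipm mulmx0 mxE.
Qed.

Lemma ipmDD S u v : posdef S ->
  ipm S (u + v) (u + v) = ipm S u u + 2 * ipm S u v + ipm S v v.
Proof. by move=> hS; rewrite !ipmDl !ipmDr (ipmC v u hS); ring. Qed.

Lemma ipm_CS S u v : posdef S -> ipm S u v ^+ 2 <= ipm S u u * ipm S v v.
Proof.
move=> hS; have [v0|v0] := eqVneq v 0.
  by rewrite v0 /ipm !mulmx0 !mxE expr0n mulr0.
have vv : 0 < ipm S v v by exact: hS.2.
have := ipm_ge0 (ipm S v v *: u + (- ipm S u v) *: v) hS.
rewrite ipmDD // !ipmZl !ipmZr.
have -> : ipm S v v * (ipm S v v * ipm S u u) +
    2 * (ipm S v v * (- ipm S u v * ipm S u v)) +
    - ipm S u v * (- ipm S u v * ipm S v v) =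
    ipm S v v * (ipm S u u * ipm S v v - ipm S u v ^+ 2) by ring.
by rewrite pmulr_rge0 // subr_ge0.
Qed.

Lemma nrm_ge0 S u : 0 <= nrm S u.
Proof. exact: sqrtr_ge0. Qed.

Lemma nrm_sqr S u : posdef S -> nrm S u ^+ 2 = ipm S u u.
Proof. by move=> hS; rewrite sqr_sqrtr // ipm_ge0. Qed.

Lemma ipm_le_nrm S u v : posdef S -> `|ipm S u v| <= nrm S u * nrm S v.
Proof.
move=> hS; rewrite -ler_sqr ?nnegrE ?mulr_ge0 ?nrm_ge0 //.
by rewrite exprMn !nrm_sqr // real_normK ?num_real // ipm_CS.
Qed.

Lemma nrmD S u v : posdef S -> nrm S (u + v) <= nrm S u + nrm S v.
Proof.
move=> hS; rewrite -ler_sqr ?nnegrE ?addr_ge0 ?nrm_ge0 //.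
rewrite nrm_sqr // ipmDD // sqrrD !nrm_sqr //.
have := le_trans (ler_norm _) (ipm_le_nrm u v hS).
by rewrite mulr_natl; lra.
Qed.

Lemma nrmZ S k u : posdef S -> nrm S (k *: u) = `|k| * nrm S u.
Proof.
move=> hS; rewrite /nrm ipmZl ipmZr mulrA -expr2 sqrtrM ?sqr_ge0 //.
by rewrite sqrtr_sqr.
Qed.

Lemma nrmN S u : posdef S -> nrm S (- u) = nrm S u.
Proof. by move=> hS; rewrite -scaleN1r nrmZ // normrN1 mul1r. Qed.

Lemma nrm0 S : nrm S 0 = 0.
Proof. by rewrite /nrm /ipm mulmx0 mxE sqrtr0. Qed.

Lemma normv_entry u i : `|u i 0| <= `|u|.
Proof.
rewrite [leRHS]mx_normrE.
exact: (@le_bigmax _ _ _ (0 : R) (fun ij : 'I_n * 'I_1 => `|u ij.1 ij.2|) (i, 0)).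
Qed.

Lemma normv_le u k : 0 <= k -> (forall i, `|u i 0| <= k) -> `|u| <= k.
Proof.
move=> k0 h; rewrite [leLHS]mx_normrE.
by apply/bigmax_leP; split => // -[i j] _ /=; rewrite (ord1 j).
Qed.

Lemma nrm_le_norm S : posdef S -> exists2 k, 0 < k & forall u, nrm S u <= k * `|u|.
Proof.
move=> hS; pose k := \sum_i \sum_j `|S i j|.
have k0 : 0 <= k by apply: sumr_ge0 => i _; apply: sumr_ge0.
(* The [+ 1] keeps the constant positive also in dimension zero, where the sum is empty. *)
exists (Num.sqrt k + 1); first by rewrite ltr_wpDl // sqrtr_ge0.
move=> u; apply: (@le_trans _ _ (Num.sqrt k * `|u|)); last first.
  by rewrite ler_wpM2r // lerDl.
have -> : `|u| = Num.sqrt (`|u| ^+ 2) by rewrite sqrtr_sqr ger0_norm.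
rewrite -sqrtrM // ler_sqrt; last by rewrite mulr_ge0 // sqr_ge0.
rewrite ipmE mulr_suml; apply: ler_sum => i _.
rewrite mulr_suml; apply: ler_sum => j _.
apply: le_trans (ler_norm _) _; rewrite !normrM mulrAC mulrC.
by rewrite ler_wpM2l // expr2 ler_pM ?normv_entry //.
Qed.

(* The coordinate functionals are represented by the rows of S^-1. *)
Lemma norm_le_nrm S : posdef S -> exists2 k, 0 < k & forall u, `|u| <= k * nrm S u.
Proof.
move=> hS.
have Su : S \in unitmx.
  rewrite -row_free_unit -kermx_eq0; apply/negPn/negP => /rowV0Pn[v /sub_kermxP vS v0].
  have := hS.2 v^T; rewrite trmx_eq0 => /(_ v0).
  by rewrite /ipm trmxK vS mul0mx mxE ltxx.
pose w i : 'cV[R]_n := invmx S *m delta_mx i 0.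
have hw u i : u i 0 = ipm S u (w i).
  by rewrite /ipm /w mulmxA mulmxK // -colE !mxE.
exists (1 + \sum_i nrm S (w i)).
  by rewrite ltr_wpDr // sumr_ge0 // => i _; rewrite nrm_ge0.
move=> u; apply: normv_le.
  by rewrite mulr_ge0 ?nrm_ge0 // addr_ge0 // sumr_ge0 // => i _; rewrite nrm_ge0.
move=> i; rewrite hw; apply: le_trans (ipm_le_nrm _ _ hS) _.
rewrite mulrC ler_wpM2r ?nrm_ge0 // (bigD1 i) //= addrCA lerDl addr_ge0 //.
by rewrite sumr_ge0 // => j _; rewrite nrm_ge0.
Qed.

Lemma nrm_equiv S S' : posdef S -> posdef S' ->
  exists2 k, 0 < k & forall u, nrm S u <= k * nrm S' u.
Proof.
move=> /nrm_le_norm[k k0 hk] /norm_le_nrm[l l0 hl].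
exists (k * l) => [|u]; first exact: mulr_gt0.
by rewrite -mulrA; apply: le_trans (hk u) _; rewrite ler_pM2l.
Qed.

(** [S] is the Gram matrix of the canonical basis. The norms of the statement thus become norms
    [nrm S], which [nrm_equiv] compares with the adapted norms built below. *)
Lemma ipnorm_nrm (s : {dot 'cV[R]_n for idfun}) :
  exists2 S, posdef S & forall u, ipnorm s u = nrm S u.
Proof.
pose S : 'M[R]_n := \matrix_(i, j) s (delta_mx i 0) (delta_mx j 0).
have Es u v : s u v = ipm S u v.
  rewrite ipmE {1}[u]matrix_sum_delta {1}[v]matrix_sum_delta.
  under [X in s X _]eq_bigr do rewrite big_ord1.
  under [X in s _ X]eq_bigr do rewrite big_ord1.
  rewrite linear_sumlz /=; apply: eq_bigr => i _.
  rewrite linear_sum /=; apply: eq_bigr => j _.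
  by rewrite linearZl_LR linearZr_LR /= mxE mulrA mulrAC.
exists S; last by move=> u; rewrite /ipnorm Es.
split=> [|u u0]; last by rewrite -Es; exact: neq0_dnorm_gt0.
by apply/matrixP => i j; rewrite !mxE (hermC s) /= expr0 mul1r.
Qed.

End InnerProduct.

(** * Quadratic forms adapted to a bound on the spectrum *)

Section Lyapunov.
Context (R : realType).
Local Notation C := R[i].

Lemma Re_sum (I : Type) (r : seq I) (Q : pred I) (E : I -> C) :
  complex.Re (\sum_(i <- r | Q i) E i) = \sum_(i <- r | Q i) complex.Re (E i).
Proof.
apply: (big_morph (@complex.Re R) (id1 := 0) (op1 := +%R)) => //.
by move=> [? ?] [? ?].
Qed.

Lemma ReZ (k : R) (z : C) : complex.Re (real_complex R k * z) = k * complex.Re z.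
Proof. by case: z => a b /=; rewrite mul0r subr0. Qed.

Lemma Re_le_normc (z : C) : complex.Re z <= Normc.normc z.
Proof.
case: z => a b /=; apply: le_trans (ler_norm _) _.
by rewrite -sqrtr_sqr ler_sqrt ?lerDl ?sqr_ge0 // addr_ge0 // sqr_ge0.
Qed.

Lemma normcE2 (z : C) : conjc z * z = real_complex R (Normc.normc z ^+ 2).
Proof.
case: z => a b /=; rewrite sqr_sqrtr ?addr_ge0 ?sqr_ge0 //.
by apply/eqP; rewrite eq_complex /=; apply/andP; split; apply/eqP; ring.
Qed.

Lemma normc_conj (z : C) : Normc.normc (conjc z) = Normc.normc z.
Proof. by case: z => a b /=; rewrite sqrrN. Qed.

(** Schur triangularisation over the complex numbers, of which only the invertibility of [U] is
    kept. A left eigenvector of the lower triangular [L] for one of its diagonal entries becomes,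
    multiplied by [U], a left eigenvector of [H]. *)
Lemma trig_conj_spectrum n (H : 'M[R]_n) : (0 < n)%N ->
  exists U L : 'M[C]_n, [/\ U \in unitmx, is_trig_mx L,
    U *m map_mx (real_complex R) H = L *m U &
    forall i, spectrum H (L i i)].
Proof.
move=> n0; set A := map_mx _ H.
have [U /spectral.unitarymx_unit Uu] := spectral.Schur A n0.
rewrite /mxred.similar_to /= (conjumx _ Uu) => Lt.
have UA : U *m A = U *m A *m invmx U *m U by rewrite mulmxKV.
exists U, (U *m A *m invmx U); split=> // i.
set L := _ *m invmx U in UA Lt *.
have /eigenvalueP[v vL v0] : eigenvalue L (L i i).
  rewrite eigenvalue_root_char char_poly_trig // rootE horner_prod.
  by rewrite (bigD1 i) //= !hornerE subrr mul0r.
apply/eigenvalueP; exists (v *m U).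
  by rewrite -mulmxA UA mulmxA vL scalemxAl.
by apply: contra_neq v0 => /(congr1 (mulmx^~ (invmx U))); rewrite mulmxK // mul0mx.
Qed.

(* H is made triangular over the complex numbers and the k-th coordinate is
   rescaled by del ^ k, which makes the off-diagonal terms negligible. *)
Lemma lyapunov n (H : 'M[R]_n) (b : R) :
  (forall z, spectrum H z -> complex.Re z < b) ->
  exists S e, [/\ 0 < e, posdef S & forall u, ipm S u (H *m u) <= (b - e) * ipm S u u].
Proof.
case: (posnP n) => [n0 _|n0 hb].
  subst n; exists 1%:M, 1; split=> //; last by move=> u; rewrite /ipm !mxE !big_ord0 mulr0.
  by split=> [|u]; [rewrite trmx1|rewrite (flatmx0 u) eqxx].
have [U [L [Uu /is_trig_mxP Lt UH Lspec]]] := trig_conj_spectrum H n0.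
pose M := 1 + \sum_i \sum_j Normc.normc (L i j).
have nc0 z : 0 <= Normc.normc z by case: z => x y /=; rewrite sqrtr_ge0.
have M1 : 1 <= M by rewrite lerDl; apply: sumr_ge0 => i _; exact: sumr_ge0.
have M0 : 0 <= M by exact: le_trans ler01 M1.
have LM i j : Normc.normc (L i j) <= M.
  apply: (@le_trans _ _ (\sum_j Normc.normc (L i j))).
    by rewrite (bigD1 j) //= lerDl; apply: sumr_ge0.
  rewrite /M [X in _ <= 1 + X](bigD1 i) //= addrCA lerDl addr_ge0 // sumr_ge0 // => k _.
  exact: sumr_ge0.
(* Half of the smallest gap between [b] and the diagonal, capped at 1: one [e] will be spent on the
   off-diagonal terms, the other is the margin of the conclusion. *)
have [e e0 he] : exists2 e : R, 0 < e & forall i, complex.Re (L i i) + e <= b - e.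
  exists (\big[Num.min/1]_i (b - complex.Re (L i i)) / 2).
    by rewrite divr_gt0 //; apply: lt_bigmin => // i _; rewrite subr_gt0; exact/hb/Lspec.
  by move=> i; have := bigmin_le 1 i (fun i => b - complex.Re (L i i)); lra.
have [del [del0 del1 hdel]] : exists del : R, [/\ 0 < del, del <= 1 &
    forall i, complex.Re (L i i) + del * M * n%:R <= b - e].
  exists (Num.min 1 (e / (M * n%:R))).
  have Mn : 0 < M * n%:R by rewrite mulr_gt0 ?ltr0n // (lt_le_trans ltr01).
  split; first by rewrite lt_min ltr01 divr_gt0.
    by rewrite ge_min lexx.
  move=> i; apply: le_trans (he i); rewrite lerD2l -mulrA -ler_pdivlMr //.
  by rewrite ge_min lexx orbT.
pose dd (i : 'I_n) : R := del ^+ i.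
have dd0 i : 0 < dd i by exact: exprn_gt0.
(* [S] is the real part of U^* diag(dd_k^2) U, so that on real vectors [ipm S u u] is the squared
   Hermitian norm of the rescaled coordinates [dd k * V u k]. *)
pose S : 'M[R]_n := \matrix_(i, j) \sum_k dd k ^+ 2 * complex.Re (conjc (U k i) * U k j).
pose V (u : 'cV[R]_n) : 'cV[C]_n := U *m map_mx (real_complex R) u.
have SE u v : ipm S u v = \sum_k dd k ^+ 2 * complex.Re (conjc (V u k 0) * V v k 0).
  have Vk k : complex.Re (conjc (V u k 0) * V v k 0) =
      \sum_i \sum_j u i 0 * complex.Re (conjc (U k i) * U k j) * v j 0.
    rewrite !mxE rmorph_sum /= mulr_suml Re_sum; apply: eq_bigr => i _.
    rewrite mulr_sumr Re_sum; apply: eq_bigr => j _; rewrite !mxE.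
    by case: (U k i) => x y; case: (U k j) => z t /=; ring.
  rewrite ipmE (eq_bigr _ (fun k _ => congr1 (fun x => dd k ^+ 2 * x) (Vk k))).
  under [RHS]eq_bigr do rewrite mulr_sumr.
  rewrite [RHS]exchange_big /=; apply: eq_bigr => i _.
  under [RHS]eq_bigr do rewrite mulr_sumr.
  rewrite [RHS]exchange_big /=; apply: eq_bigr => j _.
  rewrite mxE mulr_sumr mulr_suml; apply: eq_bigr => k _; ring.
have SEu u : ipm S u u = \sum_k (dd k * Normc.normc (V u k 0)) ^+ 2.
  rewrite SE; apply: eq_bigr => k _; rewrite normcE2 exprMn; by [].
exists S, e; split=> //.
  split.
    apply/matrixP => i j; rewrite !mxE; apply: eq_bigr => k _; congr (_ * _).
    by case: (U k i) => x y; case: (U k j) => z t /=; ring.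
  move=> u u0; rewrite SEu lt_neqAle sumr_ge0 ?andbT => [|k _]; last exact: sqr_ge0.
  apply/negP => /eqP/esym/eqP; rewrite psumr_eq0 => [/allP hV|k _]; last exact: sqr_ge0.
  case/negP: u0; apply/eqP.
  have V0 : V u = 0.
    apply/colP => k; rewrite [RHS]mxE; have := hV k (mem_index_enum _).
    rewrite /= expf_eq0 /= mulf_eq0 gt_eqF //= => /eqP h; exact: (Normc.eq0_normc h).
  have := congr1 (mulmx (invmx U)) V0; rewrite /V mulKmx // mulmx0 => /matrixP h.
  by apply/colP => k; have := h k 0; rewrite !mxE => -[].
move=> u; rewrite SE.
have VH k : V (H *m u) k 0 = \sum_j L k j * V u j 0.
  by rewrite /V map_mxM mulmxA UH -mulmxA mxE.
pose a k := dd k * Normc.normc (V u k 0).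
(* Below the diagonal [dd k <= del * dd j], and 2 a_k a_j <= a_k^2 + a_j^2 spreads each off-diagonal
   entry over two diagonal ones. *)
have key k j : dd k ^+ 2 * complex.Re (conjc (V u k 0) * (L k j * V u j 0)) <=
   (if k == j then complex.Re (L k k) * a k ^+ 2 else 0)
   + del * M / 2 * (a k ^+ 2 + a j ^+ 2).
  have a2 : 0 <= del * M / 2 * (a k ^+ 2 + a j ^+ 2).
    apply: mulr_ge0; last by rewrite addr_ge0 ?sqr_ge0.
    by apply: divr_ge0 => //; exact: mulr_ge0 (ltW del0) M0.
  move: a2; case: eqP => [<- a2|/eqP kj a2].
    rewrite mulrCA normcE2 [L k k * _]mulrC ReZ.
    have -> : complex.Re (L k k) * a k ^+ 2 =
      dd k ^+ 2 * (Normc.normc (V u k 0) ^+ 2 * complex.Re (L k k)) by rewrite /a; ring.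
    by rewrite lerDl.
  rewrite add0r; have [kj'|jk|/val_inj/eqP] := ltngtP k j; last by rewrite (negPf kj).
    by rewrite Lt // mul0r mulr0 /= mulr0.
  apply: (@le_trans _ _ (dd k ^+ 2 * (Normc.normc (V u k 0) * (M * Normc.normc (V u j 0))))).
    rewrite ler_wpM2l ?sqr_ge0 //; apply: le_trans (Re_le_normc _) _.
    rewrite !Normc.normcM normc_conj; apply: ler_wpM2l; first exact: nc0.
    by apply: ler_wpM2r; first exact: nc0.
  apply: (@le_trans _ _ (del * M * (a k * a j))).
    have -> : dd k ^+ 2 * (Normc.normc (V u k 0) * (M * Normc.normc (V u j 0))) =
       dd k * (M * (a k * Normc.normc (V u j 0))) by rewrite /a; ring.
    have -> : del * M * (a k * a j) = del * dd j * (M * (a k * Normc.normc (V u j 0))).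
      by rewrite /a; ring.
    apply: ler_wpM2r; last by rewrite /dd -exprS ler_wiXn2l // ltW.
    rewrite mulr_ge0 // mulr_ge0 ?nc0 // /a mulr_ge0 ?nc0 //; exact: ltW.
  have -> : del * M / 2 * (a k ^+ 2 + a j ^+ 2) = del * M * ((a k ^+ 2 + a j ^+ 2) / 2) by ring.
  rewrite ler_wpM2l ?mulr_ge0 //; first exact: ltW.
  have := sqr_ge0 (a k - a j); nra.
have -> : (b - e) * ipm S u u = \sum_k (b - e) * a k ^+ 2 by rewrite SEu mulr_sumr.
apply: (@le_trans _ _ (\sum_k \sum_j ((if k == j then complex.Re (L k k) * a k ^+ 2 else 0)
   + del * M / 2 * (a k ^+ 2 + a j ^+ 2)))).
  apply: ler_sum => k _; rewrite VH mulr_sumr Re_sum mulr_sumr.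
  by apply: ler_sum => j _; exact: key.
have -> : \sum_k \sum_j ((if k == j then complex.Re (L k k) * a k ^+ 2 else 0)
   + del * M / 2 * (a k ^+ 2 + a j ^+ 2)) = 
   \sum_k (complex.Re (L k k) + del * M * n%:R) * a k ^+ 2.
  transitivity (\sum_k complex.Re (L k k) * a k ^+ 2 +
     del * M / 2 * (\sum_k \sum_(j < n) a k ^+ 2 + \sum_(k < n) \sum_j a j ^+ 2)).
    rewrite -big_split /= mulr_sumr -big_split /=; apply: eq_bigr => k _.
    rewrite big_split /=; congr (_ + _).
      by rewrite -big_mkcond /= (eq_bigl (pred1 k)) ?big_pred1_eq // => j; rewrite eq_sym.
    by rewrite -mulr_sumr big_split.
  have -> : \sum_(k < n) \sum_(j < n) a j ^+ 2 = \sum_(k < n) \sum_(j < n) a k ^+ 2.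
    exact: exchange_big.
  rewrite -big_split /= mulr_sumr -big_split /=.
  apply: eq_bigr => k _; rewrite sumr_const card_ord -[in LHS]mulr_natr; by field.
by apply: ler_sum => k _; rewrite ler_wpM2r ?sqr_ge0.
Qed.

End Lyapunov.

(** * Conditional expectations *)

Section SubSigmaAlgebra.
Context (R : realType) (disp : measure_display) (T : measurableType disp)
  (G : set (set T)).
Hypotheses (hG : sigma_algebra setT G) (GT : G `<=` measurable).

Lemma measurable_wrt_preimage dU (U : measurableType dU) (Y : T -> U) B :
  measurable_wrt G Y -> measurable B -> G (Y @^-1` B).
Proof.
move=> hY mB; rewrite -(sigma_algebra_id hG) -[X in _ X]setTI.
exact: hY.
Qed.

Lemma preimage_measurable_wrt dU (U : measurableType dU) (Y : T -> U) :
  (forall B, measurable B -> G (Y @^-1` B)) -> measurable_wrt G Y.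
Proof. by move=> h _ B mB; rewrite setTI; apply: sub_sigma_algebra; exact: h. Qed.

Lemma measurable_wrt_fun dU (U : measurableType dU) (Y : T -> U) (D : set T) :
  measurable_wrt G Y -> measurable_fun D Y.
Proof.
move=> hY; apply: (measurable_funS measurableT) => // _ B mB.
by rewrite setTI; apply: GT; exact: measurable_wrt_preimage.
Qed.

Lemma sigma_setC A : G A -> G (~` A).
Proof. by case: hG => _ h _; rewrite -setTD; exact: h. Qed.

Lemma sigma_bigcup (A : nat -> set T) : (forall n, G (A n)) -> G (\bigcup_n A n).
Proof. by case: hG => _ _; exact. Qed.

Lemma sigma_bigcap (A : nat -> set T) : (forall n, G (A n)) -> G (\bigcap_n A n).
Proof.
move=> hA; rewrite -[X in G X]setCK setC_bigcap; apply: sigma_setC.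
by apply: sigma_bigcup => n; exact: sigma_setC.
Qed.

Lemma sigma_setI A B : G A -> G B -> G (A `&` B).
Proof.
move=> hA hB; rewrite -bigcap2E; apply: sigma_bigcap => -[|[|n]] //=.
by rewrite -setC0; apply: sigma_setC; case: hG.
Qed.

Lemma sigma_setT : G setT.
Proof. by rewrite -setC0; apply: sigma_setC; case: hG. Qed.

Lemma sigma_imply (b : bool) A : (b -> G A) -> G [set w | b -> A w].
Proof.
case: b => [/(_ isT)|_].
  by rewrite (_ : [set w | _] = A) //; apply/seteqP; split=> w /=; [by apply|by []].
by rewrite (_ : [set w | _] = setT) ?predeqE //; exact: sigma_setT.
Qed.

End SubSigmaAlgebra.

Lemma measurable_ipm (R : realType) d (T : measurableType d) n (S : 'M[R]_n)
    (x y : T -> 'cV[R]_n) (D : set T) :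
  (forall i, measurable_fun D (fun w => x w i 0)) ->
  (forall i, measurable_fun D (fun w => y w i 0)) ->
  measurable_fun D (fun w => ipm S (x w) (y w)).
Proof.
move=> hx hy; under eq_fun do rewrite ipmE.
apply: measurable_sum => i; apply: measurable_sum => j.
by apply: measurable_funM => //; apply: measurable_funM.
Qed.

Lemma measurable_nrm (R : realType) d (T : measurableType d) n (S : 'M[R]_n)
    (x : T -> 'cV[R]_n) (D : set T) :
  (forall i, measurable_fun D (fun w => x w i 0)) ->
  measurable_fun D (fun w => nrm S (x w)).
Proof.
move=> hx; apply: (@measurableT_comp _ _ _ _ _ _ (@Num.sqrt R)) => //.
  apply: continuous_measurable_fun; exact: sqrt_continuous.
exact: measurable_ipm.
Qed.

(* floor (N t) counted as the number of j in 1..J below t *)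
Lemma staircase (R : realType) (J : nat) (t : R) : 0 <= t <= J%:R ->
  t - 1 <= \sum_(j < J) ((j.+1%:R <= t)%R : nat)%:R <= t.
Proof.
elim: J => [|J IH] /andP[t0 tJ].
  by rewrite big_ord0 t0 andbT subr_le0 (le_trans tJ).
rewrite big_ord_recr /=.
have [tJ'|tJ'] := leP t J%:R.
  have /andP[h1 h2] := IH (introT andP (conj t0 tJ')).
  rewrite (_ : (J.+1%:R <= t) = false) ?addr0 ?h1 //.
  by apply/negbTE; rewrite -ltNge; apply: le_lt_trans tJ' _; rewrite ltr_nat.
have -> : \sum_(i < J) ((i.+1%:R <= t)%R : nat)%:R = J%:R :> R.
  rewrite (eq_bigr (fun _ => 1)); last first.
    by move=> i _; rewrite (le_trans _ (ltW tJ')) // ler_nat.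
  by rewrite sumr_const card_ord.
rewrite -natr1 in tJ; rewrite -natr1.
by have [h|h] := leP (J%:R + 1) t; apply/andP; split=> /=; lra.
Qed.

Section Conditional.
Context (R : realType) (disp : measure_display) (T : measurableType disp)
  (Pr : probability T R).

(* E[X | G] >= 0 on K *)
Definition cond_ge0 (G : set (set T)) (K : set T) (X : T -> R) : Prop :=
  Pr.-integrable K (EFin \o X) /\
  forall A, G A -> A `<=` K -> 0 <= \int[Pr]_(w in A) X w.

Definition mean_ge0 (K : set T) (X : T -> R) : Prop :=
  Pr.-integrable K (EFin \o X) /\ 0 <= \int[Pr]_(w in K) X w.

Implicit Types K : set T.

Lemma mean_ge0D K X Y : measurable K -> mean_ge0 K X -> mean_ge0 K Y ->
  mean_ge0 K (fun w => X w + Y w).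
Proof.
move=> mK [iX hX] [iY hY]; split; first exact: (integrableD mK iX iY).
by rewrite RintegralD // addr_ge0.
Qed.

Lemma mean_ge0Z K X k : measurable K -> 0 <= k -> mean_ge0 K X ->
  mean_ge0 K (fun w => k * X w).
Proof.
move=> mK k0 [iX hX]; split; first exact: (integrableZl mK k iX).
by rewrite RintegralZl // mulr_ge0.
Qed.

Lemma mean_ge0_sum K (I : finType) (X : I -> T -> R) : measurable K ->
  (forall i, mean_ge0 K (X i)) -> mean_ge0 K (fun w => \sum_i X i w).
Proof.
move=> mK hX; rewrite (_ : (fun w => _) = (\sum_i X i)); last first.
  by apply/funext => w; rewrite fct_sumE.
apply: (big_ind (mean_ge0 K)) => // [|f g]; last exact: mean_ge0D.
split; first exact: (integrable0 Pr K).
by rewrite Rintegral_ge0.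
Qed.

Lemma mean_ge0_ext K X Y : (forall w, X w = Y w) -> mean_ge0 K X -> mean_ge0 K Y.
Proof. by move=> /funext ->. Qed.

Lemma bounded_integrable K (X : T -> R) M : measurable K -> measurable_fun K X ->
  (forall w, K w -> `|X w| <= M) -> Pr.-integrable K (EFin \o X).
Proof.
move=> mK mX hX; apply: measurable_bounded_integrable => //.
  by apply: le_lt_trans (probability_le1 Pr mK) _; rewrite ltry.
exists M; split; first exact: num_real.
by move=> x Mx w /= Kw; apply: le_trans (hX w Kw) (ltW Mx).
Qed.

Lemma mul_bounded_integrable K (X Y : T -> R) M : measurable K ->
  measurable_fun K Y -> (forall w, K w -> `|Y w| <= M) ->
  Pr.-integrable K (EFin \o X) -> Pr.-integrable K (EFin \o (fun w => Y w * X w)).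
Proof.
move=> mK mY hY iX.
have mX : measurable_fun K X by apply/measurable_EFinP; case/integrableP: iX.
apply: (le_integrable mK _ _ (integrableZl mK M iX)).
  by apply/measurable_EFinP; exact: measurable_funM.
move=> w Kw /=; rewrite lee_fin !normrM ler_wpM2r //.
exact: le_trans (hY w Kw) (ler_norm _).
Qed.

(** Taking out a known factor. [Y] is within 1/N of floor(N Y) / N, that is of 1/N times a sum of
    indicators of the events [D j] of [G], for which the claim is the hypothesis on [X]. With N
    larger than the integral of |X| over [K] divided by [e], this replacement costs at most [e]. *)
Lemma cond_ge0_mul (G : set (set T)) K (X Y : T -> R) M :
  sigma_algebra setT G -> G `<=` measurable -> G K ->
  cond_ge0 G K X -> measurable_wrt G Y ->
  (forall w, K w -> 0 <= Y w <= M) -> mean_ge0 K (fun w => Y w * X w).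
Proof.
move=> hG GT GK [iX hX] mY hY; have mK := GT _ GK.
have mYK : measurable_fun K Y by exact: (measurable_wrt_fun hG GT).
have iYX : Pr.-integrable K (EFin \o (fun w => Y w * X w)).
  apply: (mul_bounded_integrable (M := M)) => // w Kw.
  by case/andP: (hY w Kw) => ? ?; rewrite ger0_norm.
split=> //; apply/ler_addgt0Pr => e e0; rewrite addrC -lerBlDl sub0r.
pose I := \int[Pr]_(w in K) `|X w|.
have I0 : 0 <= I by apply: Rintegral_ge0.
pose N := (Num.truncn (I / e)).+1.
have hN : I / e < N%:R by rewrite /N; apply: truncnS_gt.
pose m := (Num.truncn M).+1.
have hm : M <= m%:R by apply: ltW; apply: truncnS_gt.
pose D j := [set w | j.+1%:R <= N%:R * Y w].
have GD j : G (D j).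
  rewrite (_ : D j = (fun w => N%:R * Y w) @^-1` `[j.+1%:R, +oo[); last first.
    by apply/seteqP; split => w; rewrite /D /= in_itv /= andbT.
  apply: (measurable_wrt_preimage hG) => //.
  exact: (@measurable_funM _ (g_sigma_algebraType G)).
pose Z w := N%:R^-1 * \sum_(j < N * m) (\1_(D j) w : R).
have NR0 : 0 < N%:R :> R by rewrite ltr0n.
have hZ w : K w -> `|Y w - Z w| <= N%:R^-1.
  move=> Kw; have /andP[Y0 YM] := hY w Kw.
  have /staircase : 0 <= N%:R * Y w <= (N * m)%:R.
    rewrite mulr_ge0 // natrM ler_wpM2l //; exact: le_trans YM hm.
  have -> : \sum_(j < N * m) ((j.+1%:R <= N%:R * Y w)%R : nat)%:R = N%:R * Z w :> R.
    rewrite /Z mulrA mulfV ?gt_eqF // mul1r; apply: eq_bigr => j _.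
    rewrite indicE /D; congr (_ %:R); congr nat_of_bool.
    by apply/idP/idP => [h|/set_mem//]; apply/mem_set.
  move=> /andP[h1 h2]; rewrite ler_norml; apply/andP; split.
    rewrite -(ler_pM2l NR0) mulrN mulfV ?gt_eqF // mulrBr; lra.
  by rewrite -(ler_pM2l NR0) mulfV ?gt_eqF // mulrBr; lra.
have mD j : measurable (D j) by exact: GT.
have mZ : measurable_fun K Z.
  apply: measurable_funM => //; apply: measurable_sum => j.
  exact: measurable_indic.
have [iZX hZX] : mean_ge0 K (fun w => Z w * X w).
  apply: (@mean_ge0_ext _ (fun w => N%:R^-1 * \sum_(j < N * m) (\1_(D j) w * X w))).
    by move=> w; rewrite /Z -mulrA mulr_suml.
  apply: mean_ge0Z => //; apply: mean_ge0_sum => // j; split.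
    apply: (mul_bounded_integrable (M := 1)) => //.
    by move=> w _; rewrite indicE; case: (_ \in _); rewrite ?normr1 ?normr0.
  rewrite (_ : (fun w => _) = X \_ (D j)); last first.
    apply/funext => w; rewrite indicE patchE; case: (_ \in _); by rewrite ?mul1r ?mul0r.
  rewrite -Rintegral_mkcondr; apply: hX; first exact: (sigma_setI hG).
  exact: subIsetl.
have iYZ : Pr.-integrable K (EFin \o (fun w => (Y w - Z w) * X w)).
  apply: (mul_bounded_integrable (M := N%:R^-1)) => //; exact: measurable_funB.
have -> : \int[Pr]_(w in K) (Y w * X w) =
    \int[Pr]_(w in K) (Z w * X w) + \int[Pr]_(w in K) ((Y w - Z w) * X w).
  rewrite -RintegralD //; apply: eq_Rintegral => w _; ring.
apply: (@le_trans _ _ (\int[Pr]_(w in K) ((Y w - Z w) * X w))); last by rewrite lerDr.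
rewrite lerNl; apply: le_trans (ler_norm _) _; rewrite normrN.
apply: le_trans (le_normr_Rintegral mK iYZ) _.
have iaX : Pr.-integrable K (EFin \o (fun w => `|X w|)).
  by move: (integrable_norm iX).
apply: (@le_trans _ _ (\int[Pr]_(w in K) (N%:R^-1 * `|X w|))).
  apply: le_Rintegral => //; first by move: (integrable_norm iYZ).
    exact: (integrableZl mK _ iaX).
  by move=> w Kw; rewrite normrM ler_wpM2r // hZ.
rewrite RintegralZl // -/I mulrC ler_pdivrMr // mulrC -ler_pdivrMr //; exact: ltW.
Qed.

End Conditional.

(** * One step of the potential *)

Section PointwiseBounds.
Context (R : realType).

(** This is |x + xi|^2 >= 0, deduced from the Cauchy-Schwarz inequality between the three
    numbers. *)
Lemma quad_pos (v p e : R) : 0 <= v -> 0 <= e -> p ^+ 2 <= v * e ->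
  0 <= v + 2 * p + e.
Proof.
move=> v0 e0 pve; have h : (2 * p) ^+ 2 <= (v + e) ^+ 2.
  by have := sqr_ge0 (v - e); nra.
rewrite leNgt; apply/negP => neg.
have : (v + e) ^+ 2 < (2 * p) ^+ 2 by nra.
by rewrite ltNge h.
Qed.

(* v, p and e stand for |x|^2, <x, xi> and |xi|^2, so that v + 2 p + e is
   |x + xi|^2. *)
Lemma inv_step_le (v p e : R) : 0 <= v -> 0 <= e -> p ^+ 2 <= v * e ->
  (1 + (v + 2 * p + e))^-1 <=
    (1 + v)^-1 - 2 * p / (1 + v) ^+ 2 - e / (1 + e) / 4 / (1 + v) ^+ 2
    + 8 * v * e / (1 + v) ^+ 2.
Proof.
move=> v0 e0 pve; have B0 := quad_pos v0 e0 pve.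
set Bq := 1 + (v + 2 * p + e); have Bp : 0 < Bq by rewrite /Bq; lra.
set A := 1 + v; have Ap : 0 < A by rewrite /A; lra.
(* An exact expansion: the last fraction is all that remains after the term linear in [p], so only
   its numerator has to be estimated. *)
have -> : Bq^-1 = A^-1 - 2 * p / A ^+ 2 + (4 * p ^+ 2 + 2 * p * e - A * e) / (Bq * A ^+ 2).
  by rewrite /Bq /A; field; rewrite !gt_eqF.
suff h : (4 * p ^+ 2 + 2 * p * e - A * e) / Bq <= - (e / (1 + e) / 4) + 8 * v * e.
  rewrite -subr_ge0; set X := 4 * _ + _ - _ in h *; set Y := e / (1 + e) / 4 in h *.
  have -> : A^-1 - 2 * p / A ^+ 2 - Y / A ^+ 2 + 8 * v * e / A ^+ 2 -
      (A^-1 - 2 * p / A ^+ 2 + X / (Bq * A ^+ 2)) = (- Y + 8 * v * e - X / Bq) / A ^+ 2.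
    by field; rewrite !gt_eqF.
  by rewrite divr_ge0 ?sqr_ge0 // subr_ge0.
have e1 : 0 < 1 + e by lra.
rewrite ler_pdivrMr //.
have eE : e = e / (1 + e) * (1 + e) by rewrite divfK // gt_eqF.
set t := e / (1 + e) in eE *.
have t0 : 0 <= t by apply: divr_ge0 => //; exact: ltW.
have Bge1 : 1 <= Bq by rewrite /Bq; lra.
have BA : Bq <= 2 * A * (1 + e).
  have : 0 <= v + 2 * - p + e by apply: quad_pos; rewrite ?sqrrN.
  have := mulr_ge0 v0 e0; rewrite /Bq /A; lra.
have tA : t * Bq <= 2 * A * e 
  by move: (ler_wpM2l t0 BA); rewrite mulrCA -eE.
(* The sign of [p] decides the cross term [2 * p * e]. It is harmless for p <= 0; otherwise Bq >= 1
   + e, and completing the square in [pq] bounds [2 * p] by a constant plus a multiple of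
   [v * e]. *)
have [p0|p0] := leP p 0.
  have : p * e <= 0 by rewrite mulr_le0_ge0.
  have : v * e <= v * e * Bq by rewrite ler_peMr // mulr_ge0.
  nra.
have Be : 1 + e <= Bq by rewrite /Bq; lra.
have pq : 2 * p <= 1 / 4 + 4 * (v * e) by have := sqr_ge0 (2 * p - 1 / 2); nra.
have ve : v * e * Bq >= v * e * (1 + e) by rewrite ler_wpM2l // mulr_ge0.
have ve0 : 0 <= v * e by exact: mulr_ge0.
have h1 : 2 * p * e <= (1 / 4 + 4 * (v * e)) * e by rewrite ler_wpM2r.
have h2 : e <= t * Bq by rewrite {1}eE; apply: ler_wpM2l.
nra.
Qed.

(** Convexity of the inverse: the tangent at 1 + v lies below the curve. *)
Lemma inv_step_ge (v p e : R) : 0 <= v -> 0 <= e -> p ^+ 2 <= v * e ->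
  (1 + v)^-1 - 2 * p / (1 + v) ^+ 2 - e / (1 + v) ^+ 2 <= (1 + (v + 2 * p + e))^-1.
Proof.
move=> v0 e0 pve; have B0 := quad_pos v0 e0 pve.
set Bq := 1 + (v + 2 * p + e); have Bp : 0 < Bq by rewrite /Bq; lra.
set A := 1 + v; have Ap : 0 < A by rewrite /A; lra.
have -> : Bq^-1 = A^-1 - 2 * p / A ^+ 2 - e / A ^+ 2 + (2 * p + e) ^+ 2 / (Bq * A ^+ 2).
  by rewrite /Bq /A; field; rewrite !gt_eqF.
by rewrite lerDl divr_ge0 ?sqr_ge0 // mulr_ge0 ?sqr_ge0 // ltW.
Qed.

(* The saturated square y / (1 + y) keeps a fixed part of the second moment of
   the noise, thanks to the bound on its moment of order a > 2. *)
Lemma saturated_ge (q s a L : R) : 0 <= q <= 1 -> 0 <= s -> 1 <= L -> 2 < a ->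
  q * (s ^+ 2 - (L `^ (a - 2))^-1 * s `^ a) / (1 + L ^+ 2) <=
  q * s ^+ 2 / (1 + q * s ^+ 2).
Proof.
move=> /andP[q0 q1] s0 L1 a2; set l := L `^ (a - 2).
have L0 : 0 < L by lra.
have l0 : 0 < l by rewrite powR_gt0.
have s2 : 0 <= s ^+ 2 by exact: sqr_ge0.
have qs0 : 0 <= q * s ^+ 2 by exact: mulr_ge0.
have LL : 0 < 1 + L ^+ 2 by have := sqr_ge0 L; lra.
have ss : 0 < 1 + q * s ^+ 2 by lra.
(* Up to level [L] the denominator is at most 1 + L^2. Beyond it s^2 <= s^a / L^(a-2), and the
   left-hand side is not positive. *)
have [sL|sL] := leP s L.
  apply: (@le_trans _ _ (q * s ^+ 2 / (1 + L ^+ 2))).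
    rewrite ler_pM2r ?invr_gt0 // ler_wpM2l // lerBlDr lerDl mulr_ge0 ?powR_ge0 //.
    by rewrite invr_ge0 ltW.
  rewrite ler_wpM2l // lef_pV2 ?posrE // lerD2l.
  have : s ^+ 2 <= L ^+ 2 by rewrite ler_sqr ?nnegrE // ltW.
  by nra.
apply: (@le_trans _ _ 0); last by apply: divr_ge0 => //; exact: ltW.
rewrite mulr_le0_ge0 ?invr_ge0 ?(ltW LL) // mulr_ge0_le0 // subr_le0.
rewrite mulrC ler_pdivlMr //.
have -> : s `^ a = s ^+ 2 * s `^ (a - 2).
  rewrite -powR_mulrn // -powRD ?(gt_eqF (lt_trans L0 sL)) ?implybT //.
  by congr (_ `^ _); ring.
rewrite ler_wpM2l //; apply: ge0_ler_powR; rewrite ?nnegrE ?(ltW L0) //; last exact: ltW.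
by rewrite subr_ge0 ltW.
Qed.

(** Passing from scale [D'] to the larger [D] raises the potential of [pp] by Lam cc pp / ((D + pp)
    (D' + pp)). As 16 B2 <= Lam, this is at least the wrong-signed term with factor [8 * B2]. The
    [kap] term then survives as a drop proportional to the square of the potential; the 8 in its
    coefficient comes from D' <= 2 Lam an and D <= 2 D'. *)
Lemma potential_drop (D D' cc an Lam kap B2 zz pp : R) :
  0 <= kap <= 1 -> 0 < an -> 0 <= cc <= an -> 1 <= Lam -> 0 <= B2 ->
  16 * B2 <= Lam -> D = D' + Lam * cc -> Lam * an <= D' -> D' <= 2 * Lam * an ->
  0 <= zz <= pp ->
  (1 + pp / D')^-1 - kap * (cc / D') / (1 + pp / D') ^+ 2
    + 8 * B2 * (cc / D') * (pp / D') / (1 + pp / D') ^+ 2 <=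
  D / (D + zz) - kap * cc / (8 * Lam * an) * (D / (D + zz)) ^+ 2.
Proof.
move=> /andP[k0 k1] an0 /andP[c0 ca] L1 B0 BL DE D'1 D'2 /andP[z0 zp].
have L0 : 0 < Lam by lra.
have La0 : 0 < Lam * an by exact: mulr_gt0.
have Lca : Lam * cc <= Lam * an by rewrite ler_wpM2l // ltW.
have Lc0 : 0 <= Lam * cc by rewrite mulr_ge0 // ltW.
have D'0 : 0 < D' by lra.
have D0 : 0 < D by lra.
have DD' : D <= 2 * D' by lra.
have p0 : 0 <= pp by lra.
have D'p : 0 < D' + pp by lra.
have Dp : 0 < D + pp by lra.
have Dz : 0 < D + zz by lra.
set eta := kap * cc / (8 * Lam * an).
have eta0 : 0 <= eta.
  by apply: divr_ge0; [exact: mulr_ge0|rewrite -mulrA mulr_ge0 // ltW].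
have eta1 : eta <= 1 / 2.
  rewrite /eta ler_pdivrMr; last by lra.
  have : kap * cc <= an by nra.
  by nra.
set Up := D / (D + pp); set Uz := D / (D + zz).
have Up0 : 0 <= Up by apply: divr_ge0; exact: ltW.
have UpUz : Up <= Uz by rewrite /Up /Uz ler_wpM2l ?(ltW D0) // lef_pV2 ?posrE // lerD2l.
have Uz1 : Uz <= 1 by rewrite ler_pdivrMr // mul1r lerDl.
(* For eta <= 1/2 the map x - eta x^2 is nondecreasing on [0, 1]: this is where |p| >= |z| is
   used. *)
apply: (@le_trans _ _ (Up - eta * Up ^+ 2)); last first.
  rewrite -subr_ge0.
  have -> : Uz - eta * Uz ^+ 2 - (Up - eta * Up ^+ 2) = (Uz - Up) * (1 - eta * (Uz + Up)) by ring.
  rewrite mulr_ge0 ?subr_ge0 //; nra.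
have -> : (1 + pp / D')^-1 = D' / (D' + pp) by field; rewrite !gt_eqF //; lra.
set V := D' / (D' + pp).
have -> : kap * (cc / D') / (1 + pp / D') ^+ 2 = kap * cc / D' * V ^+ 2.
  by rewrite /V; field; rewrite !gt_eqF //; lra.
have -> : 8 * B2 * (cc / D') * (pp / D') / (1 + pp / D') ^+ 2 =
    8 * B2 * (cc * pp) / (D' + pp) ^+ 2.
  by field; rewrite !gt_eqF //; lra.
have UV : Up - V = Lam * (cc * pp) / ((D + pp) * (D' + pp)).
  by rewrite /Up /V DE; field; rewrite !gt_eqF //; lra.
have cp0 : 0 <= cc * pp by exact: mulr_ge0.
have h1 : 8 * B2 * (cc * pp) / (D' + pp) ^+ 2 <= Up - V.
  rewrite UV; have -> : Lam * (cc * pp) / ((D + pp) * (D' + pp)) =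
     (Lam / (D + pp)) * ((cc * pp) / (D' + pp)) by field; rewrite !gt_eqF.
  have -> : 8 * B2 * (cc * pp) / (D' + pp) ^+ 2 =
     (8 * B2 / (D' + pp)) * ((cc * pp) / (D' + pp)) by field; rewrite !gt_eqF.
  rewrite ler_wpM2r ?divr_ge0 ?(ltW D'p) // ler_pdivrMr // mulrAC ler_pdivlMr //.
  have h : D + pp <= 2 * (D' + pp) by lra.
  have : 8 * B2 * (D + pp) <= 8 * B2 * (2 * (D' + pp)) by rewrite ler_wpM2l // mulr_ge0.
  by nra.
have VU : Up <= 2 * V.
  rewrite /Up /V mulrA ler_pdivrMr // mulrAC ler_pdivlMr //; nra.
have h2 : eta * Up ^+ 2 <= kap * cc / D' * V ^+ 2.
  apply: (@le_trans _ _ (eta * (4 * V ^+ 2))).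
    rewrite ler_wpM2l //; have -> : 4 * V ^+ 2 = (2 * V) ^+ 2 by ring.
    by rewrite ler_sqr ?nnegrE //; exact: le_trans VU.
  rewrite mulrA ler_wpM2r ?sqr_ge0 // /eta.
  have -> : kap * cc / (8 * Lam * an) * 4 = kap * cc / (2 * Lam * an).
    by field; rewrite !gt_eqF.
  by rewrite ler_wpM2l ?mulr_ge0 // lef_pV2 ?posrE //; lra.
by lra.
Qed.

End PointwiseBounds.

Section OneStep.
Context (R : realType) (disp : measure_display) (T : measurableType disp)
  (Pr : probability T R) (n : nat) (S : 'M[R]_n) (hS : posdef S)
  (G : set (set T)) (hG : sigma_algebra setT G) (GT : G `<=` measurable).
Implicit Types (K : set T) (x xi : T -> 'cV[R]_n).

(** Zero conditional mean on [K], split into two one-sided conditions so that [cond_ge0_mul] can be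
    applied with either sign. *)
Definition centered K xi : Prop := forall i,
  cond_ge0 Pr G K (fun w => xi w i 0) /\ cond_ge0 Pr G K (fun w => - xi w i 0).

Lemma mean_ge0_le K (f g : T -> R) : measurable K -> mean_ge0 Pr K g ->
  Pr.-integrable K (EFin \o f) -> (forall w, K w -> g w <= f w) -> mean_ge0 Pr K f.
Proof.
move=> mK [ig g0] f0 gf; split=> //; apply: le_trans g0 _.
exact: le_Rintegral.
Qed.

Lemma integrable_subR K (f g : T -> R) : measurable K ->
  Pr.-integrable K (EFin \o f) -> Pr.-integrable K (EFin \o g) ->
  Pr.-integrable K (EFin \o (fun w => f w - g w)).
Proof. by move=> mK i1 i2; exact: (integrableB mK i1 i2). Qed.

Lemma cond_ge0_sub K K' X : G K' -> K' `<=` K -> measurable K ->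
  cond_ge0 Pr G K X -> cond_ge0 Pr G K' X.
Proof.
move=> GK' K'K mK [iX hX]; split.
  by apply: (integrableS mK) => //; exact: GT.
by move=> A GA AK'; apply: hX => //; exact: subset_trans K'K.
Qed.

Lemma centered_sub K K' xi : G K' -> K' `<=` K -> measurable K ->
  centered K xi -> centered K' xi.
Proof. by move=> ? ? ? h i; split; apply: (@cond_ge0_sub K) => //; case: (h i). Qed.

Lemma centered_mul K xi (i : 'I_n) (Y : T -> R) M : G K -> centered K xi ->
  measurable_wrt G Y -> (forall w, K w -> `|Y w| <= M) ->
  mean_ge0 Pr K (fun w => Y w * xi w i 0).
Proof.
move=> GK /(_ i)[h1 h2] mY hY; have mK := GT GK.
(* [Y] may change sign: it is shifted by [|M|] to become non-negative, and the shift is compensated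
   with [- xi]. *)
apply: (@mean_ge0_ext _ _ _ _ _ (fun w => (Y w + `|M|) * xi w i 0 + `|M| * - xi w i 0)).
  by move=> w; ring.
apply: mean_ge0D => //.
  apply: (cond_ge0_mul (M := 2 * `|M|) hG GT GK h1) => [|w Kw].
    exact: (@measurable_funD _ (g_sigma_algebraType G)).
  have := le_trans (hY w Kw) (ler_norm M); rewrite ler_norml => /andP[? ?].
  by apply/andP; split; lra.
apply: mean_ge0Z => //; split; first by case: h2.
by apply: h2.2.
Qed.

(** The bound is asked of the product [k * |x|] because positions are unbounded, whereas the
    gradient of the potential is bounded ([pot_grad_bounded]). *)
Lemma centered_ip K x xi (k : T -> R) M : G K -> centered K xi ->
  (forall i, measurable_wrt G (fun w => x w i 0)) -> measurable_wrt G k ->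
  (forall w, K w -> `|k w| * nrm S (x w) <= M) ->
  mean_ge0 Pr K (fun w => k w * ipm S (x w) (xi w)).
Proof.
move=> GK hxi mx mk hM; have mK := GT GK.
have [l l0 hl] := norm_le_nrm hS.
apply: (@mean_ge0_ext _ _ _ _ _ (fun w => \sum_i \sum_j (k w * x w i 0 * S i j) * xi w j 0)).
  move=> w; rewrite ipmE mulr_sumr; apply: eq_bigr => i _.
  by rewrite mulr_sumr; apply: eq_bigr => j _; ring.
apply: mean_ge0_sum => // i; apply: mean_ge0_sum => // j.
apply: (@centered_mul _ _ _ _ (l * M * `|S i j|)) => //.
  apply: (@measurable_funM _ (g_sigma_algebraType G)) => //.
  exact: (@measurable_funM _ (g_sigma_algebraType G) _ _ _ _ mk (mx i)).
move=> w Kw; rewrite !normrM ler_wpM2r //.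
apply: (@le_trans _ _ (`|k w| * (l * nrm S (x w)))).
  rewrite ler_wpM2l //; apply: le_trans (normv_entry _ _) (hl _).
by rewrite mulrCA; apply: ler_wpM2l; [exact: ltW|exact: hM].
Qed.

Lemma pot_gt0 (k : R) u : 0 <= k -> 0 < 1 + k * ipm S u u.
Proof. by move=> k0; rewrite ltr_pwDl // mulr_ge0 // ipm_ge0. Qed.

Lemma measurable_pot d' (T' : measurableType d') (k : R) (x : T' -> 'cV[R]_n) D :
  (forall i, measurable_fun D (fun w => x w i 0)) -> 0 <= k ->
  measurable_fun D (fun w => (1 + k * ipm S (x w) (x w))^-1).
Proof.
move=> mx k0.
(* The argument of the inverse is at least 1, so truncation from below by 1 changes nothing and
   makes the inverse continuous on the whole line. *)
have cinv : measurable_fun [set: R] (fun t : R => (Num.max t 1)^-1).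
  apply: continuous_measurable_fun => t.
  apply: (@cvgV _ _ _ _ (fun t : R => Num.max t 1)).
    by rewrite gt_eqF // lt_max ltr01 orbT.
  by apply: (@continuous_max R R id (cst 1) t); [exact: cvg_id|exact: cvg_cst].
rewrite (_ : (fun w => _) = (fun t : R => (Num.max t 1)^-1) \o
    (fun w => 1 + k * ipm S (x w) (x w))); last first.
  by apply/funext => w /=; rewrite max_l // lerDl mulr_ge0 // ipm_ge0.
apply: measurableT_comp => //; apply: measurable_funD => //.
by apply: measurable_funM => //; exact: measurable_ipm.
Qed.

Lemma pot_bounded (k : R) u : 0 <= k -> `|(1 + k * ipm S u u)^-1| <= 1.
Proof.
move=> k0; have h := pot_gt0 u k0; rewrite ger0_norm ?invr_ge0 ?(ltW h) //.
by rewrite invf_le1 // lerDl mulr_ge0 // ipm_ge0.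
Qed.

(** Up to the factor 2 k this is the norm of the gradient of 1 / (1 + k |u|^2). *)
Lemma pot_grad_bounded (k : R) u : 0 < k ->
  (1 + k * ipm S u u)^-1 ^+ 2 * nrm S u <= 1 + k^-1.
Proof.
move=> k0; have h := pot_gt0 u (ltW k0).
rewrite -(nrm_sqr _ hS) in h *; set r := nrm S u in h *.
rewrite exprVn mulrC ler_pdivrMr ?exprn_gt0 //.
have k1 : 0 < k^-1 by rewrite invr_gt0.
have kk : k^-1 * k = 1 by rewrite mulVf // gt_eqF.
have r0 : 0 <= r by exact: nrm_ge0.
apply: (@le_trans _ _ ((1 + k^-1) * (1 + k * r ^+ 2))).
  have -> : (1 + k^-1) * (1 + k * r ^+ 2) = 1 + k * r ^+ 2 + k^-1 + k^-1 * k * r ^+ 2 by ring.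
  rewrite kk mul1r; have := sqr_ge0 (r - 1); have := mulr_ge0 (ltW k0) (sqr_ge0 r); nra.
rewrite ler_pM2l ?addr_gt0 // expr2 ler_peMr //; first exact: ltW.
by rewrite lerDl mulr_ge0 ?sqr_ge0 // ltW.
Qed.

Lemma pot_expand (k c : R) u v :
  1 + k * ipm S (u + c *: v) (u + c *: v) =
  1 + (k * ipm S u u + 2 * (k * c * ipm S u v) + k * c ^+ 2 * ipm S v v).
Proof. by rewrite ipmDD // ipmZl !ipmZr; ring. Qed.

Lemma pot_CS (k c : R) u v : 0 <= k ->
  (k * c * ipm S u v) ^+ 2 <= k * ipm S u u * (k * c ^+ 2 * ipm S v v).
Proof.
move=> k0; have := ipm_CS u v hS => h.
have -> : (k * c * ipm S u v) ^+ 2 = (k * c) ^+ 2 * ipm S u v ^+ 2 by ring.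
have -> : k * ipm S u u * (k * c ^+ 2 * ipm S v v) =
  (k * c) ^+ 2 * (ipm S u u * ipm S v v) by ring.
by rewrite ler_wpM2l ?sqr_ge0.
Qed.

Section Step.
Context (K : set T) (x xi : T -> 'cV[R]_n) (k c B2 : R).
Hypotheses (GK : G K) (mx : forall i, measurable_wrt G (fun w => x w i 0))
  (mxi : forall i, measurable_fun setT (fun w => xi w i 0))
  (hxi : centered K xi) (k0 : 0 < k) (c0 : 0 <= c) (B20 : 0 <= B2)
  (hB2 : cond_ge0 Pr G K (fun w => B2 - nrm S (xi w) ^+ 2)).

Let A w := 1 + k * ipm S (x w) (x w).
Let mK : measurable K := GT GK.
Let mxT i : measurable_fun setT (fun w => x w i 0) :=
  measurable_wrt_fun hG GT (mx i).

Lemma measurable_pot_next :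
  measurable_fun K (fun w => (1 + k * ipm S (x w + c *: xi w) (x w + c *: xi w))^-1).
Proof.
apply: (measurable_funS measurableT) => //.
apply: measurable_pot; last exact: ltW.
move=> i; under eq_fun do rewrite !mxE.
by apply: measurable_funD => //; exact: measurable_funM.
Qed.

Lemma integrable_pot_next : Pr.-integrable K
  (EFin \o (fun w => (1 + k * ipm S (x w + c *: xi w) (x w + c *: xi w))^-1)).
Proof.
apply: (@bounded_integrable _ _ _ _ _ _ 1) => //; first exact: measurable_pot_next.
by move=> w _; exact: pot_bounded (ltW k0).
Qed.

Lemma measurable_wrt_pot : measurable_wrt G (fun w => (A w)^-1).
Proof. by apply: (@measurable_pot _ (g_sigma_algebraType G)) => //; exact: ltW. Qed.

Lemma measurable_wrt_pot2 : measurable_wrt G (fun w => (A w)^-1 ^+ 2).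
Proof. exact: (@measurable_funX _ (g_sigma_algebraType G) _ _ _ 2 measurable_wrt_pot). Qed.

Lemma A1 w : 1 <= A w.
Proof. by rewrite lerDl mulr_ge0 ?ipm_ge0 // ltW. Qed.

Lemma AV01 w : 0 <= (A w)^-1 <= 1.
Proof. by rewrite invr_ge0 (le_trans ler01 (A1 w)) /= invf_le1 ?A1 // (lt_le_trans ltr01 (A1 w)). Qed.

Lemma AV201 w : 0 <= (A w)^-1 ^+ 2 <= 1.
Proof. by rewrite sqr_ge0 /= expr_le1 //; case/andP: (AV01 w). Qed.

Lemma mean_grad l : mean_ge0 Pr K (fun w => l * (A w)^-1 ^+ 2 * ipm S (x w) (xi w)).
Proof.
apply: (@centered_ip _ _ _ _ (`|l| * (1 + k^-1))) => //.
  apply: (@measurable_funM _ (g_sigma_algebraType G)) => //.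
  exact: measurable_wrt_pot2.
move=> w Kw; rewrite normrM -mulrA ler_wpM2l //.
by rewrite ger0_norm ?sqr_ge0 //; exact: pot_grad_bounded.
Qed.

(** The potential dominates its tangent, whose first-order term has mean zero, so its mean loses at
    most [k * c ^+ 2 * B2] in one step. This controls the weighted noise sums. *)
Lemma step_down : mean_ge0 Pr K (fun w =>
  (1 + k * ipm S (x w + c *: xi w) (x w + c *: xi w))^-1 - ((A w)^-1 - k * c ^+ 2 * B2)).
Proof.
apply: (@mean_ge0_le _ _ (fun w => - (2 * k * c) * (A w)^-1 ^+ 2 * ipm S (x w) (xi w) +
   k * c ^+ 2 * ((A w)^-1 ^+ 2 * (B2 - nrm S (xi w) ^+ 2)))) => //.
- apply: mean_ge0D => //; first exact: mean_grad.
  apply: mean_ge0Z => //; first by rewrite mulr_ge0 ?sqr_ge0 // ltW.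
  apply: (cond_ge0_mul (M := 1) hG GT GK hB2) => [|w _]; last exact: AV201.
  exact: measurable_wrt_pot2.
- apply: (integrable_subR mK integrable_pot_next).
  apply: (@bounded_integrable _ _ _ _ _ _ (1 + `|k * c ^+ 2 * B2|)) => //.
    apply: measurable_funB => //; exact: (measurable_wrt_fun hG GT measurable_wrt_pot).
  move=> w _; apply: le_trans (ler_normB _ _) _; rewrite lerD2r.
  exact: pot_bounded (ltW k0).
move=> w _; rewrite pot_expand.
set v := k * ipm S (x w) (x w); set p := k * c * _; set e := _ * ipm S (xi w) (xi w).
have v0 : 0 <= v by rewrite mulr_ge0 ?ipm_ge0 // ltW.
have kc0 : 0 <= k * c ^+ 2 by rewrite mulr_ge0 ?sqr_ge0 // ltW.
have e0 : 0 <= e by rewrite mulr_ge0 ?ipm_ge0.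
have := inv_step_ge v0 e0 (pot_CS c (x w) (xi w) (ltW k0)).
rewrite -!/v -!/p -!/e -/(A w) nrm_sqr // => h.
have /andP[a0 a1] := AV201 w.
have : k * c ^+ 2 * B2 * (A w)^-1 ^+ 2 <= k * c ^+ 2 * B2 by rewrite ler_piMr // mulr_ge0.
have -> : - (2 * k * c) * (A w)^-1 ^+ 2 * ipm S (x w) (xi w) = - (2 * p / A w ^+ 2).
  by rewrite /p exprVn; ring.
have -> : k * c ^+ 2 * ((A w)^-1 ^+ 2 * (B2 - ipm S (xi w) (xi w))) =
   k * c ^+ 2 * B2 * (A w)^-1 ^+ 2 - e / A w ^+ 2 by rewrite /e exprVn; ring.
by move: h; set X := (1 + (v + _ + e))^-1; set Y := (A w)^-1; lra.
Qed.

Context (a b B L : R).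
Hypotheses (a2 : 2 < a) (b0 : 0 <= b) (L1 : 1 <= L) (q1 : k * c ^+ 2 <= 1)
  (hL : (L `^ (a - 2))^-1 * B <= b / 2)
  (hb : cond_ge0 Pr G K (fun w => nrm S (xi w) ^+ 2 - b))
  (hB : cond_ge0 Pr G K (fun w => B - nrm S (xi w) `^ a)).

(** The gain comes from the saturated square of the noise: [saturated_ge] bounds it below by a
    multiple of |xi|^2 minus L^(2-a) |xi|^a, whose conditional mean is at least b - b/2 by [hL].
    This drives the repulsion. *)
Lemma step_up (kap := b / (8 * (1 + L ^+ 2))) : mean_ge0 Pr K (fun w =>
  ((A w)^-1 - kap * (k * c ^+ 2) / A w ^+ 2
    + 8 * B2 * (k * c ^+ 2) * (k * ipm S (x w) (x w)) / A w ^+ 2)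
  - (1 + k * ipm S (x w + c *: xi w) (x w + c *: xi w))^-1).
Proof.
set q := k * c ^+ 2; set l := (L `^ (a - 2))^-1; have hlB : l * B <= b / 2 by [].
(* The 1/4 of [inv_step_le] times the 1 / (1 + L^2) of [saturated_ge]; [kap] is [k1] times the
   surviving [b / 2]. *)
pose k1 := (4 * (1 + L ^+ 2))^-1.
have k10 : 0 < k1 by rewrite invr_gt0 mulr_gt0 // ltr_wpDr ?sqr_ge0.
have q0 : 0 <= q by rewrite mulr_ge0 ?sqr_ge0 // ltW.
have l0 : 0 <= l by rewrite invr_ge0 powR_ge0.
pose V w := k * ipm S (x w) (x w).
have V0 w : 0 <= V w by rewrite mulr_ge0 ?ipm_ge0 // ltW.
pose W w := (A w)^-1 ^+ 2.
have mW : measurable_wrt G W by exact: measurable_wrt_pot2.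
have VW w : 0 <= V w * W w <= 1.
  rewrite mulr_ge0 ?sqr_ge0 //= /W exprVn ler_pdivrMr ?mul1r ?exprn_gt0 //; last first.
    exact: lt_le_trans ltr01 (A1 w).
  rewrite -/(V w) /A -/(V w) expr2; have := V0 w; nra.
apply: (@mean_ge0_le _ _ (fun w => (2 * k * c) * W w * ipm S (x w) (xi w) +
   (k1 * q * (W w * (nrm S (xi w) ^+ 2 - b)) +
    k1 * q * l * (W w * (B - nrm S (xi w) `^ a)) +
    8 * q * (V w * W w * (B2 - nrm S (xi w) ^+ 2))))) => //.
- apply: mean_ge0D => //; first exact: mean_grad.
  apply: mean_ge0D => //; first apply: mean_ge0D => //.
  + apply: mean_ge0Z => //; first by rewrite mulr_ge0 // ltW.
    apply: (cond_ge0_mul (M := 1) hG GT GK hb) => // w _; exact: AV201.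
  + apply: mean_ge0Z => //; first by rewrite !mulr_ge0 // ltW.
    apply: (cond_ge0_mul (M := 1) hG GT GK hB) => // w _; exact: AV201.
  + apply: mean_ge0Z => //; first by rewrite mulr_ge0.
    apply: (cond_ge0_mul (M := 1) hG GT GK hB2) => //.
    apply: (@measurable_funM _ (g_sigma_algebraType G)) => //.
    apply: (@measurable_funM _ (g_sigma_algebraType G)) => //.
    exact: (@measurable_ipm _ _ (g_sigma_algebraType G)).
- apply: (integrable_subR mK _ integrable_pot_next).
  apply: (@bounded_integrable _ _ _ _ _ _ (1 + `|kap * q| + `|8 * B2 * q|)) => //.
    have mA : measurable_fun K (fun w => (A w)^-1).
      exact: (measurable_wrt_fun hG GT measurable_wrt_pot).
    have mA2 : measurable_fun K W by exact: (measurable_wrt_fun hG GT mW).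
    have -> : (fun w => (A w)^-1 - kap * q / A w ^+ 2 + 8 * B2 * q * (k * ipm S (x w) (x w)) / A w ^+ 2)
     = (fun w => (A w)^-1 - kap * q * W w + 8 * B2 * q * (k * ipm S (x w) (x w)) * W w).
      by apply/funext => w; rewrite /W exprVn.
    apply: measurable_funD.
      by apply: measurable_funB => //; exact: measurable_funM.
    apply: measurable_funM => //; apply: measurable_funM => //.
    apply: measurable_funM => //; apply: measurable_ipm => i;
      exact: (measurable_funS measurableT).
  move=> w _; rewrite -!/(V w).
  apply: le_trans (ler_normD _ _) _; apply: lerD.
    apply: le_trans (ler_normB _ _) _; apply: lerD; first exact: pot_bounded (ltW k0).
    rewrite -exprVn -/(W w) normrM ler_piMr //.
    by have /andP[? ?] := AV201 w; rewrite ger0_norm.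
  rewrite -exprVn -/(W w) -mulrA normrM ler_piMr //.
  by have /andP[? ?] := VW w; rewrite ger0_norm.
move=> w _; rewrite pot_expand -/(V w).
set p := k * c * _; set s := nrm S (xi w).
have -> : k * c ^+ 2 * ipm S (xi w) (xi w) = q * s ^+ 2 by rewrite nrm_sqr.
have e0 : 0 <= q * s ^+ 2 by rewrite mulr_ge0 ?sqr_ge0.
have CS : p ^+ 2 <= V w * (q * s ^+ 2).
  have := pot_CS c (x w) (xi w) (ltW k0); by rewrite -/(V w) -/q -/p nrm_sqr.
have := inv_step_le (V0 w) e0 CS.
have q01 : 0 <= q <= 1 by rewrite q0.
have := saturated_ge q01 (nrm_ge0 S (xi w)) L1 a2.
rewrite -/s -/l; have -> : 1 + V w = A w by [].
rewrite -!exprVn -!/(W w).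
have W0 : 0 <= W w by case/andP: (AV201 w).
set Y := q * s ^+ 2 / (1 + q * s ^+ 2); set Z := (1 + (V w + _ + _))^-1.
have -> : q * (s ^+ 2 - l * s `^ a) / (1 + L ^+ 2) = 4 * (k1 * (q * (s ^+ 2 - l * s `^ a))).
  by rewrite /k1; field; rewrite gt_eqF // ltr_wpDr ?sqr_ge0.
have -> : kap = k1 * (b / 2).
  by rewrite /k1 /kap; field; rewrite gt_eqF // ltr_wpDr ?sqr_ge0.
have -> : 2 * k * c * W w * ipm S (x w) (xi w) = 2 * p * W w by rewrite /p; ring.
move=> hY hZ.
have hY' : k1 * (q * (s ^+ 2 - l * s `^ a)) * W w <= Y / 4 * W w by rewrite ler_wpM2r //; lra.
have hl : k1 * q * W w * (l * B) <= k1 * q * W w * (b / 2).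
  apply: ler_wpM2l => //; apply: mulr_ge0 => //; apply: mulr_ge0 => //; exact: ltW.
by lra.
Qed.

End Step.
End OneStep.

(** * Repulsion along the unstable directions *)

Section Approximation.
Context (R : realType) (disp : measure_display) (T : measurableType disp)
  (Pr : probability T R).
Implicit Types A B E : set T.

Definition prob A : R := fine (Pr A).

Lemma probE A : measurable A -> Pr A = (prob A)%:E.
Proof. by move=> mA; rewrite /prob fineK // fin_num_measure. Qed.

Lemma prob_ge0 A : 0 <= prob A.
Proof. exact: fine_ge0. Qed.

Lemma le_prob A B : measurable A -> measurable B -> A `<=` B -> prob A <= prob B.
Proof. by move=> mA mB AB; rewrite -lee_fin -!probE // le_measure // inE. Qed.

Lemma probU_le A B : measurable A -> measurable B -> prob (A `|` B) <= prob A + prob B.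
Proof.
move=> mA mB; rewrite -lee_fin EFinD -!probE //; last exact: measurableU.
exact: measureU2.
Qed.

Lemma prob_tail_le (E : nat -> set T) (e : R) : (forall i, measurable (E i)) -> 0 < e ->
  exists k, prob (\bigcup_i E i `\` \big[setU/set0]_(i < k) E i) <= e.
Proof.
move=> mE e0; pose D k := \bigcup_i E i `\` \big[setU/set0]_(i < k) E i.
have mU : measurable (\bigcup_i E i) by exact: bigcupT_measurable.
have mD k : measurable (D k) by apply: measurableD => //; exact: bigsetU_measurable.
have D0 : \bigcap_k D k = set0.
  rewrite -subset0 => w hw; have [[i _ Ei] _] := hw 0%N I.
  have [_] := hw i.+1 I; apply; rewrite -bigcup_mkord; exists i => //=.
have := @nonincreasing_cvg_mu _ _ _ Pr D.
rewrite D0 measure0 => h.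
have {}h : Pr (D k) @[k --> \oo] --> 0%E.
  apply: h => //.
    by apply: le_lt_trans (probability_le1 Pr (mD 0%N)) _; rewrite ltry.
  move=> i j ij; apply/subsetPset => w [hw nw]; split=> //.
  apply: contra_not nw; rewrite -!bigcup_mkord => -[l /= li El]; exists l => //=.
  exact: leq_trans ij.
have /fine_cvgP[_ /cvgrPdist_le/(_ _ e0)[k _ hk]] := h.
exists k; have := hk k (leqnn k); rewrite /= sub0r normrN.
exact: le_trans (ler_norm _).
Qed.

Context (F : nat -> set (set T)) (hF : filtration F).

(** Up to small probability, [E] is decided at a finite time. That time is required to be at least
    [N] because density estimates are available only at late times. *)
Definition approximable E : Prop := measurable E /\
  forall N (e : R), 0 < e -> exists n A, [/\ (N <= n)%N, F n A,
    prob (E `\` A) <= e & prob (A `\` E) <= e].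

Let hsig n : sigma_algebra setT (F n) := let: And3 h _ _ := hF in h n.
Let hsub n : F n `<=` measurable := let: And3 _ h _ := hF in h n.
Let hmono m n : (m <= n)%N -> F m `<=` F n := let: And3 _ _ h := hF in h m n.

Lemma approximableC E : approximable E -> approximable (~` E).
Proof.
move=> [mE hE]; split=> [|N e e0]; first exact: measurableC.
have [n [A [Nn FA h1 h2]]] := hE N e e0; exists n, (~` A); split=> //.
- exact: sigma_setC.
- by rewrite setDE setCK setIC -setDE.
- by rewrite setDE setCK setIC -setDE.
Qed.

Lemma approximable0 : approximable set0.
Proof.
split=> // N e e0; exists N, set0; split=> //; first by case: (hsig N).
  by rewrite set0D /prob measure0 ltW.
by rewrite set0D /prob measure0 ltW.
Qed.

Lemma approximableU E1 E2 : approximable E1 -> approximable E2 -> approximable (E1 `|` E2).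
Proof.
move=> [m1 h1] [m2 h2]; split=> [|N e e0]; first exact: measurableU.
have e2 : 0 < e / 2 by rewrite divr_gt0.
have [n1 [A1 [N1 F1 h11 h12]]] := h1 N _ e2.
have [n2 [A2 [N2 F2 h21 h22]]] := h2 N _ e2.
have F1' : F (maxn n1 n2) A1 by apply: hmono F1; exact: leq_maxl.
have F2' : F (maxn n1 n2) A2 by apply: hmono F2; exact: leq_maxr.
have mA1 := hsub F1; have mA2 := hsub F2.
exists (maxn n1 n2), (A1 `|` A2); split.
- by rewrite leq_max N1.
- rewrite -[X in F _ X]setCK setCU; apply: (sigma_setC (hsig _)).
  by apply: (sigma_setI (hsig _)); exact: (sigma_setC (hsig _)).
- apply: (@le_trans _ _ (prob ((E1 `\` A1) `|` (E2 `\` A2)))).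
    apply: le_prob; [apply: measurableD; exact: measurableU|
      by apply: measurableU; exact: measurableD|].
    by move=> w [[E1w|E2w] /not_orP[? ?]]; [left|right].
  apply: le_trans (probU_le _ _) _; [exact: measurableD|exact: measurableD|lra].
- apply: (@le_trans _ _ (prob ((A1 `\` E1) `|` (A2 `\` E2)))).
    apply: le_prob; [apply: measurableD; exact: measurableU|
      by apply: measurableU; exact: measurableD|].
    by move=> w [[E1w|E2w] /not_orP[? ?]]; [left|right].
  apply: le_trans (probU_le _ _) _; [exact: measurableD|exact: measurableD|lra].
Qed.

Lemma approximable_bigcup (E : nat -> set T) :
  (forall n, approximable (E n)) -> approximable (\bigcup_n E n).
Proof.
move=> hE; have mE i : measurable (E i) by case: (hE i).
have mU : measurable (\bigcup_i E i) by exact: bigcupT_measurable.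
split=> // N e e0; have e2 : 0 < e / 2 by rewrite divr_gt0.
have [k hk] := prob_tail_le mE e2.
have : approximable (\big[setU/set0]_(i < k) E i).
  by apply: big_ind => //; [exact: approximable0|exact: approximableU].
set Ek := \big[setU/set0]_(i < k) E i in hk *.
have EkU : Ek `<=` \bigcup_i E i.
  by rewrite /Ek -bigcup_mkord => w [i _ Ei]; exists i.
move=> [mEk /(_ N _ e2)[n [A [Nn FA h1 h2]]]]; exists n, A.
have mA := hsub FA; split=> //.
  apply: (@le_trans _ _ (prob ((\bigcup_i E i `\` Ek) `|` (Ek `\` A)))).
    apply: le_prob; [exact: measurableD|by apply: measurableU; exact: measurableD|].
    by move=> w [Uw Aw]; have [Ew|Ew] := pselect (Ek w); [right|left].
  apply: le_trans (probU_le _ _) _; [exact: measurableD|exact: measurableD|lra].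
apply: (@le_trans _ _ (prob (A `\` Ek))).
  apply: le_prob; [exact: measurableD|exact: measurableD|].
  by move=> w [Aw Uw]; split=> // /EkU.
lra.
Qed.

(** The approximable events form a sigma-algebra, and an event of [F n] is its own approximation at
    time max(N, n). *)
Lemma approximable_tail E : <<s \bigcup_n F n >> E -> approximable E.
Proof.
apply; split; last first.
  move=> A [n _ FA]; split=> [|N e e0]; first exact: hsub FA.
  exists (maxn N n), A; split; [exact: leq_maxl|apply: hmono FA; exact: leq_maxr| |];
    by rewrite setDv /prob measure0 ltW.
split; [exact: approximable0| |exact: approximable_bigcup].
by move=> A; rewrite setTD; exact: approximableC.
Qed.

(* An event of the limit sigma-algebra which never fills an event of F n up to
   a fixed proportion is null. *)
Lemma prob_eq0_by_density E (N : nat) (c : R) : <<s \bigcup_n F n >> E -> 0 < c <= 1 ->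
  (forall n A, (N <= n)%N -> F n A -> prob (E `&` A) <= (1 - c) * prob A) ->
  Pr E = 0%E.
Proof.
move=> /approximable_tail[mE hE] /andP[c0 c1] h; rewrite probE //; congr EFin.
apply/eqP; rewrite eq_le prob_ge0 andbT.
apply/ler_addgt0Pr => e e0; rewrite add0r.
(* With both approximation errors at most c e / 2, P(E) <= (1 - c) (P(E) + c e / 2) + c e / 2, hence
   c P(E) <= c e. *)
have ce : 0 < c * e / 2 by rewrite divr_gt0 // mulr_gt0.
have [n [A [Nn FA h1 h2]]] := hE N _ ce.
have mA := hsub FA; have := h n A Nn FA => h3.
have h4 : prob E <= prob (E `&` A) + prob (E `\` A).
  apply: le_trans (probU_le _ _); [|exact: measurableI|exact: measurableD].
  by rewrite setUIDK.
have h5 : prob A <= prob E + prob (A `\` E).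
  apply: le_trans (probU_le _ _); [|by []|exact: measurableD].
  apply: le_prob => //; first by apply: measurableU => //; exact: measurableD.
  by move=> w Aw; have [?|?] := pselect (E w); [left|right].
have h6 : (1 - c) * prob A <= (1 - c) * (prob E + c * e / 2).
  by rewrite ler_wpM2l ?subr_ge0 //; lra.
have h7 : (1 - c) * (c * e / 2) <= c * e / 2 by apply: ler_piMl; lra.
have : c * prob E <= c * e by lra.
by rewrite ler_pM2l.
Qed.

End Approximation.

(** * The bounded potential and the trapped event *)

Section Repulsion.
Context (R : realType) (disp : measure_display) (T : measurableType disp)
  (Pr : probability T R) (F : nat -> set (set T)) (hF : filtration F)
  (n : nat) (S : 'M[R]_n) (hS : posdef S) (a b B B2 : R)
  (a2 : 2 < a) (b0 : 0 < b) (B0 : 0 <= B) (B20 : 0 <= B2)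
  (c al : nat -> R) (c0 : forall m, 0 <= c m) (al0 : forall m, 0 < al m)
  (alE : forall m, al m ^+ 2 = c m.+1 ^+ 2 + al m.+1 ^+ 2)
  (al_cvg : al m @[m --> \oo] --> 0)
  (z p xi : nat -> T -> 'cV[R]_n) (Q : nat -> set T)
  (hz : forall m i, measurable_wrt (F m) (fun w => z m w i 0))
  (hp : forall m i, measurable_wrt (F m) (fun w => p m w i 0))
  (hxi : forall m i, measurable_wrt (F m) (fun w => xi m w i 0))
  (FQ : forall m, F m (Q m))
  (xi_mean : forall m, centered Pr (F m) (Q m) (xi m.+1))
  (xi_B2 : forall m, cond_ge0 Pr (F m) (Q m) (fun w => B2 - nrm S (xi m.+1 w) ^+ 2))
  (xi_b : forall m, cond_ge0 Pr (F m) (Q m) (fun w => nrm S (xi m.+1 w) ^+ 2 - b))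
  (xi_B : forall m, cond_ge0 Pr (F m) (Q m) (fun w => B - nrm S (xi m.+1 w) `^ a)).

Let hsig m : sigma_algebra setT (F m) := let: And3 h _ _ := hF in h m.
Let hsub m : F m `<=` measurable := let: And3 _ h _ := hF in h m.
Let hmono k m : (k <= m)%N -> F k `<=` F m := let: And3 _ _ h := hF in h k m.

(** Whatever is neither predictable motion nor centred noise. Its size is not assumed here:
    smallness is one of the clauses of [trapped]. *)
Definition rho m w : R := nrm S (z m.+1 w - p m w - c m.+1 *: xi m.+1 w).

(** The errors are compared with [al k] from every time k >= N on, since the density estimate has to
    be run from each late time. *)
Definition trapped (N : nat) (del : R) : set T :=
  [set w | [/\ forall m, (N <= m)%N -> Q m w /\ nrm S (z m w) <= nrm S (p m w),
     forall k m, (N <= k)%N -> (k <= m)%N -> \sum_(k <= j < m) rho j w <= del * al k &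
     nrm S (z m w) @[m --> \oo] --> 0]].

(** The last term of [L] gives L^(2-a) B <= b / 2, and b <= L gives kap <= 1. [Lam] is at least 16
    B2, as [potential_drop] demands. [H] is the fraction of the squared potential lost over the
    whole future. *)
Let L : R := 1 + b + (2 * B / b + 1) `^ (a - 2)^-1.
Let kap : R := b / (8 * (1 + L ^+ 2)).
Let Lam : R := 1 + 16 * B2.
Let H : R := kap / (8 * Lam).

Let a20 : 0 < a - 2. Proof. by rewrite subr_gt0. Qed.
Let Bb0 : 0 <= 2 * B / b. Proof. by rewrite divr_ge0 ?mulr_ge0 // ltW. Qed.
Let L1 : 1 <= L.
Proof. by rewrite /L -addrA lerDl addr_ge0 ?powR_ge0 // ltW. Qed.
Let Lb : b <= L.
Proof. by rewrite /L addrAC lerDr addr_ge0 ?powR_ge0. Qed.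

Let hLB : (L `^ (a - 2))^-1 * B <= b / 2.
Proof.
have h : 2 * B / b + 1 <= L `^ (a - 2).
  have -> : 2 * B / b + 1 = ((2 * B / b + 1) `^ (a - 2)^-1) `^ (a - 2).
    by rewrite -powRrM mulVf ?(gt_eqF a20) // powRr1 // addr_ge0 // Bb0.
  apply: ge0_ler_powR; rewrite ?nnegrE ?powR_ge0 //; first exact: ltW.
    exact: le_trans ler01 L1.
  by rewrite /L lerDr; have := b0; lra.
have h0 : 0 < L `^ (a - 2) by apply: lt_le_trans h; rewrite ltr_wpDl // Bb0.
rewrite mulrC ler_pdivrMr //; apply: (@le_trans _ _ (b / 2 * (2 * B / b + 1))).
  have -> : b / 2 * (2 * B / b + 1) = B + b / 2 by field; rewrite gt_eqF.
  by have := b0; lra.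
by rewrite ler_pM2l ?divr_gt0.
Qed.

Let kap0 : 0 < kap.
Proof. by rewrite divr_gt0 // mulr_gt0 // ltr_wpDr ?sqr_ge0. Qed.
Let kap1 : kap <= 1.
Proof.
rewrite ler_pdivrMr ?mul1r; last by rewrite mulr_gt0 // ltr_wpDr ?sqr_ge0.
have := sqr_ge0 (L - 1); have := Lb; have := L1; lra.
Qed.
Let Lam1 : 1 <= Lam. Proof. by rewrite /Lam; have := B20; lra. Qed.
Let H0 : 0 < H. Proof. by rewrite divr_gt0 // mulr_gt0 //; have := Lam1; lra. Qed.
Let H1 : H <= 1 / 8.
Proof. have h1 := kap1; have h2 := Lam1. by rewrite ler_pdivrMr; lra. Qed.

Let mz m i : measurable_fun setT (fun w => z m w i 0) :=
  measurable_wrt_fun (hsig m) (@hsub m) (@hz m i).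
Let mp m i : measurable_fun setT (fun w => p m w i 0) :=
  measurable_wrt_fun (hsig m) (@hsub m) (@hp m i).
Let mxi m i : measurable_fun setT (fun w => xi m w i 0) :=
  measurable_wrt_fun (hsig m) (@hsub m) (@hxi m i).

Let widen dU (U : measurableType dU) k m (Y : T -> U) : (k <= m)%N ->
  measurable_wrt (F k) Y -> measurable_wrt (F m) Y.
Proof.
move=> km hY; apply: preimage_measurable_wrt => D mD.
apply: (hmono km); exact: (measurable_wrt_preimage (hsig k) hY).
Qed.

Let rho_wrt m : measurable_wrt (F m.+1) (rho m).
Proof.
apply: (@measurable_nrm _ _ (g_sigma_algebraType (F m.+1))) => i.
rewrite (_ : (fun w => _) = (fun w => z m.+1 w i 0 - p m w i 0 - c m.+1 * xi m.+1 w i 0)).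
  apply: (@measurable_funB _ (g_sigma_algebraType (F m.+1))).
    apply: (@measurable_funB _ (g_sigma_algebraType (F m.+1))); first exact: hz.
    exact: widen (@hp m i).
  apply: (@measurable_funM _ (g_sigma_algebraType (F m.+1))) => //; exact: hxi.
by apply/funext => w; rewrite !mxE.
Qed.

Let F_repelled m : F m [set w | Q m w /\ nrm S (z m w) <= nrm S (p m w)].
Proof.
rewrite (_ : [set w | _] = Q m `&` (fun w => nrm S (p m w) - nrm S (z m w)) @^-1` `[0, +oo[).
  apply: (sigma_setI (hsig m)) => //; apply: (measurable_wrt_preimage (hsig m)) => //.
  by apply: (@measurable_funB _ (g_sigma_algebraType (F m)));
    apply: (@measurable_nrm _ _ (g_sigma_algebraType (F m))) => i; [exact: hp|exact: hz].
by apply/seteqP; split=> w /=; rewrite in_itv /= andbT subr_ge0.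
Qed.

Let F_rho_sum k m (x : R) : F m [set w | \sum_(k <= j < m) rho j w <= x].
Proof.
(* The test [j < m] is void on the range of summation; it makes every term F_m-measurable, [rho j]
   being known at time j + 1. *)
rewrite (_ : [set w | _] = (fun w => \sum_(j <- index_iota k m)
    (if (j < m)%N then rho j w else 0)) @^-1` `]-oo, x]); last first.
  apply/seteqP; split=> w; rewrite /= in_itv /= big_nat [in X in _ -> X]big_nat;
    by under [X in _ -> is_true (X <= _)]eq_bigr => j /andP[_ h] do rewrite ?h;
       under eq_bigr => j /andP[_ h] do rewrite ?h.
apply: (measurable_wrt_preimage (hsig m)) => //.
apply: (@measurable_sum _ (g_sigma_algebraType (F m))) => j.
case: (ltnP j m) => jm; last exact: measurable_cst.
exact: (widen jm (@rho_wrt j)).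
Qed.

Let rho0 m w : 0 <= rho m w. Proof. exact: nrm_ge0. Qed.

(** The function 1 / (1 + y^2) is 1-Lipschitz for y = sqrt(k) |u|. At a scale of at least al(k0)^2,
    an error [rho] therefore costs at most rho / al(k0). *)
Lemma pot_lipschitz (k : R) (u v : 'cV[R]_n) : 0 <= k ->
  (1 + k * ipm S (u + v) (u + v))^-1 <=
  (1 + k * ipm S u u)^-1 + Num.sqrt k * nrm S v.
Proof.
move=> k0; rewrite -!(nrm_sqr _ hS); set r := nrm S (u + v); set t := nrm S u.
have tr : t <= r + nrm S v.
  by have := nrmD (u + v) (- v) hS; rewrite addrK nrmN.
set s := Num.sqrt k; have ks : k = s ^+ 2 by rewrite sqr_sqrtr.
have s0 : 0 <= s by exact: sqrtr_ge0.
have r0 : 0 <= r by exact: nrm_ge0. have t0 : 0 <= t by exact: nrm_ge0.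
have v0 : 0 <= nrm S v by exact: nrm_ge0.
rewrite ks -!exprMn; set x := s * r; set y := s * t.
have x0 : 0 <= x by exact: mulr_ge0. have y0 : 0 <= y by exact: mulr_ge0.
have yx : y - x <= s * nrm S v.
  by rewrite /x /y -mulrBr ler_wpM2l // lerBlDl.
have X1 : 0 < 1 + x ^+ 2 by rewrite ltr_pwDl // sqr_ge0.
have Y1 : 0 < 1 + y ^+ 2 by rewrite ltr_pwDl // sqr_ge0.
have [yx0|yx0] := leP y x.
  apply: (@le_trans _ _ (1 + y ^+ 2)^-1); last by rewrite lerDl mulr_ge0.
  by rewrite lef_pV2 ?posrE // lerD2l ler_sqr.
rewrite -lerBlDl; apply: le_trans yx.
have -> : (1 + x ^+ 2)^-1 - (1 + y ^+ 2)^-1 =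
   (y - x) * ((y + x) / ((1 + x ^+ 2) * (1 + y ^+ 2))).
  by field; rewrite !gt_eqF.
rewrite ler_piMr //; first by rewrite subr_ge0 ltW.
rewrite ler_pdivrMr ?mul1r ?mulr_gt0 //.
have := sqr_ge0 (x - 1 / 2); have := sqr_ge0 (y - 1 / 2).
have := mulr_ge0 (sqr_ge0 x) (sqr_ge0 y); nra.
Qed.

Section Density.
Variables (k0 : nat) (A : set T) (FA : F k0 A) (del : R) (del0 : 0 <= del).

(** The part of [A] on which no clause of [trapped] seen from time k0 has failed by time m. It is an
    event of F_m, decreases with m and contains all trapped points of [A]. *)
Let G m := A `&` [set w | (forall j, (k0 <= j <= m)%N ->
    Q j w /\ nrm S (z j w) <= nrm S (p j w)) /\
    \sum_(k0 <= j < m) rho j w <= del * al k0].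

Let FG m : (k0 <= m)%N -> F m (G m).
Proof.
move=> km; apply: (sigma_setI (hsig m)); first exact: hmono FA.
rewrite (_ : [set w | _] =
   (\bigcap_j [set w | (k0 <= j <= m)%N -> Q j w /\ nrm S (z j w) <= nrm S (p j w)]) `&`
   [set w | \sum_(k0 <= j < m) rho j w <= del * al k0]); last first.
  by apply/seteqP; split=> w [h1 h2]; split=> // j; [move=> _; exact: h1|exact: (h1 j I)].
apply: (sigma_setI (hsig m)) => //; apply: (sigma_bigcap (hsig m)) => j.
apply: (sigma_imply (hsig m)) => /andP[_ jm]; exact: (hmono jm).
Qed.

Let mA : measurable A. Proof. exact: hsub FA. Qed.
Let mG m : (k0 <= m)%N -> measurable (G m). Proof. by move=> /FG; exact: hsub. Qed.

Let GS m : (k0 <= m)%N -> G m.+1 `<=` G m.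
Proof.
move=> km w [Aw [h1 h2]]; split=> //; split.
  by move=> j /andP[kj jm]; apply: h1; rewrite kj leqW.
by apply: le_trans h2; rewrite big_nat_recr //= lerDl.
Qed.

(* U m is the potential of the position at time m on the scale D m; it tends
   to 1 on the trapped event. *)
Let D m := Lam * (al k0 ^+ 2 + al m ^+ 2).
Let U m w := (1 + (D m)^-1 * ipm S (z m w) (z m w))^-1.
Let u m := \int[Pr]_(w in G m) U m w.
Let PA : R := prob Pr A.

Let alS2 : 0 < al k0 ^+ 2. Proof. by rewrite exprn_gt0. Qed.
Let D0 m : 0 < D m.
Proof.
apply: mulr_gt0; first by have := Lam1; lra.
by rewrite ltr_wpDr ?sqr_ge0 // alS2.
Qed.
Let DV0 m : 0 <= (D m)^-1. Proof. by rewrite invr_ge0 ltW. Qed.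

Let U01 m w : 0 <= U m w <= 1.
Proof.
have h := pot_gt0 hS (z m w) (DV0 m).
rewrite invr_ge0 ltW //= invf_le1 // lerDl mulr_ge0 ?DV0 //; exact: ipm_ge0.
Qed.

Let mU m X : measurable X -> measurable_fun X (U m).
Proof.
move=> mX; apply: (measurable_funS measurableT) => //.
by apply: measurable_pot => // i; exact: mz.
Qed.

Let iU m X : measurable X -> Pr.-integrable X (EFin \o U m).
Proof.
move=> mX; apply: (@bounded_integrable _ _ _ _ _ _ 1) => //; first exact: mU.
by move=> w _; have /andP[? ?] := U01 m w; rewrite ger0_norm.
Qed.

Let iU2 m X : measurable X -> Pr.-integrable X (EFin \o (fun w => U m w ^+ 2)).
Proof.
move=> mX; apply: (@bounded_integrable _ _ _ _ _ _ 1) => //.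
  by apply: measurable_funX; exact: mU.
by move=> w _; have /andP[? ?] := U01 m w; rewrite ger0_norm ?sqr_ge0 // expr_le1.
Qed.

Let al_le m : (k0 <= m)%N -> al m <= al k0.
Proof.
move=> /subnK <-; elim: (m - k0)%N => // i IH; apply: le_trans IH.
have h : al (i.+1 + k0) ^+ 2 <= al (i + k0) ^+ 2 by rewrite addSn (alE (i + k0)) lerDr sqr_ge0.
by rewrite -ler_sqr // nnegrE ltW.
Qed.

Let Rint_subset X Y (f : T -> R) : measurable X -> measurable Y -> X `<=` Y ->
  (forall w, Y w -> 0 <= f w) -> Pr.-integrable Y (EFin \o f) ->
  \int[Pr]_(w in X) f w <= \int[Pr]_(w in Y) f w.
Proof.
move=> mX mY XY f0 iY; have iX := integrableS mY mX XY iY.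
apply: fine_le; [exact: integrable_fin_num iX|exact: integrable_fin_num iY|].
apply: ge0_subset_integral => //; first by case/integrableP: iY.
Qed.

(** As c_{m+1}^2 = al_m^2 - al_{m+1}^2, these weights telescope and add up to [H] over all m >=
    k0. *)
Let eta m := H * (c m.+1 ^+ 2 / al k0 ^+ 2).
Let r m := \int[Pr]_(w in G m.+1) rho m w.

Let rho_le m w : (k0 <= m)%N -> G m.+1 w -> rho m w <= del * al k0.
Proof.
move=> km [_ [_]]; apply: le_trans; rewrite big_nat_recr //= lerDr.
exact: sumr_ge0.
Qed.

Let irho m : (k0 <= m)%N -> Pr.-integrable (G m.+1) (EFin \o rho m).
Proof.
move=> km; apply: (@bounded_integrable _ _ _ _ _ _ (del * al k0)) => //.
- by apply: mG; exact: leqW.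
- exact: (measurable_wrt_fun (hsig m.+1) (@hsub m.+1) (@rho_wrt m)).
- by move=> w Gw; rewrite ger0_norm // rho_le.
Qed.

(** The error is removed by the Lipschitz bound ([s1]), the domain is enlarged from [G m.+1] to
    [G m], the potential being non-negative ([s2]), and on this event of F_m the mean drop applies
    ([s3]). *)
Let step m : (k0 <= m)%N ->
  u m.+1 <= u m - eta m * \int[Pr]_(w in G m) U m w ^+ 2 + r m / al k0.
Proof.
move=> km; have mGm := mG km; have mGm1 : measurable (G m.+1) by apply: mG; exact: leqW.
have cm : c m.+1 ^+ 2 <= al k0 ^+ 2.
  apply: (@le_trans _ _ (al m ^+ 2)); first by rewrite (alE m) lerDl sqr_ge0.
  by rewrite ler_sqr ?nnegrE; [exact: al_le|exact: ltW|exact: ltW].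
have La : 0 < Lam by have := Lam1; lra.
have D'1 : Lam * al k0 ^+ 2 <= D m.+1 by rewrite ler_pM2l // lerDl sqr_ge0.
have D'2 : D m.+1 <= 2 * Lam * al k0 ^+ 2.
  have : al m.+1 ^+ 2 <= al k0 ^+ 2 by rewrite ler_sqr ?nnegrE; [exact: al_le (leqW km)|exact: ltW|exact: ltW].
  by rewrite /D; nra.
have DE : D m = D m.+1 + Lam * c m.+1 ^+ 2 by rewrite /D (alE m); ring.
have a1D : al k0 ^+ 2 <= D m.+1.
  by apply: le_trans D'1; rewrite ler_peMl // ltW.
have q1 : (D m.+1)^-1 * c m.+1 ^+ 2 <= 1.
  by rewrite mulrC ler_pdivrMr // mul1r; exact: le_trans a1D.
have QG : G m `<=` Q m.
  by move=> w [_ [h _]]; have [] := h m; rewrite // km leqnn.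
have mQ : measurable (Q m) by exact: hsub (FQ m).
have kD : 0 < (D m.+1)^-1 by rewrite invr_gt0.
pose nx w := (1 + (D m.+1)^-1 * ipm S (p m w + c m.+1 *: xi m.+1 w) (p m w + c m.+1 *: xi m.+1 w))^-1.
have [iup up] := step_up hS (hsig m) (@hsub m) (FG km) (@hp m) (@mxi m.+1)
   (centered_sub (@hsub m) (FG km) QG mQ (xi_mean m)) kD (c0 m.+1)
   (cond_ge0_sub (@hsub m) (FG km) QG mQ (xi_B2 m)) a2 L1 q1 hLB
   (cond_ge0_sub (@hsub m) (FG km) QG mQ (xi_b m))
   (cond_ge0_sub (@hsub m) (FG km) QG mQ (xi_B m)).
set kk := (D m.+1)^-1 in iup up nx q1 kD *.
have inx X : measurable X -> Pr.-integrable X (EFin \o nx).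
  move=> mX; apply: (@bounded_integrable _ _ _ _ _ _ 1) => //.
    apply: (measurable_funS measurableT) => //.
    apply: (@measurable_pot _ _ S hS _ _ kk (fun w => p m w + c m.+1 *: xi m.+1 w)); last exact: ltW.
    move=> i; under eq_fun do rewrite !mxE.
    by apply: measurable_funD; [exact: mp|apply: measurable_funM => //; exact: mxi].
  by move=> w _; rewrite /nx; apply: (pot_bounded hS); exact: ltW.
have nx0 w : 0 <= nx w by rewrite invr_ge0 ltW // pot_gt0 // ltW.
have s1 : u m.+1 <= \int[Pr]_(w in G m.+1) nx w + r m / al k0.
  rewrite mulrC -RintegralZl //; last exact: irho.
  rewrite -RintegralD //; [|exact: inx|exact: (integrableZl mGm1 _ (irho km))].
  apply: le_Rintegral => //; first exact: iU.
    exact: (integrableD mGm1 (inx _ mGm1) (integrableZl mGm1 _ (irho km))).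
  move=> w Gw.
  have := pot_lipschitz (p m w + c m.+1 *: xi m.+1 w)
     (z m.+1 w - p m w - c m.+1 *: xi m.+1 w) (ltW kD).
  have -> : p m w + c m.+1 *: xi m.+1 w + (z m.+1 w - p m w - c m.+1 *: xi m.+1 w) = z m.+1 w.
    by rewrite -[z m.+1 w - _ - _]addrA -opprD subrKC.
  rewrite -/(nx w) -/(rho m w) => h; apply: le_trans h _.
  rewrite lerD2l ler_wpM2r //.
  rewrite -[X in _ <= X]ger0_norm ?invr_ge0 ?(ltW (al0 k0)) // -sqrtr_sqr ler_sqrt ?sqr_ge0 //.
  by rewrite exprVn lef_pV2 ?posrE.
have s2 : \int[Pr]_(w in G m.+1) nx w <= \int[Pr]_(w in G m) nx w.
  by apply: Rint_subset => //; [exact: GS|exact: inx].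
have s3 : \int[Pr]_(w in G m) nx w <= u m - eta m * \int[Pr]_(w in G m) U m w ^+ 2.
  rewrite -RintegralZl //; last exact: iU2.
  rewrite -RintegralB //; [|exact: iU|exact: (integrableZl mGm _ (iU2 m mGm))].
  rewrite -subr_ge0 -RintegralB //; last 2 first.
    exact: (integrable_subR mGm (iU m mGm) (integrableZl mGm _ (iU2 m mGm))).
    exact: inx.
  apply: le_trans up _; apply: le_Rintegral => //.
    apply: (integrable_subR mGm _ (inx _ mGm)).
    exact: (integrable_subR mGm (iU m mGm) (integrableZl mGm _ (iU2 m mGm))).
  move=> w Gw; rewrite lerD2r.
  have zp : nrm S (z m w) <= nrm S (p m w).
    by case: Gw => _ [h _]; have [] := h m; rewrite // km leqnn.
  have zp2 : 0 <= ipm S (z m w) (z m w) <= ipm S (p m w) (p m w).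
    by rewrite ipm_ge0 // -!(nrm_sqr _ hS) ler_sqr ?nnegrE ?nrm_ge0.
  have k01 : 0 <= kap <= 1 by rewrite (ltW kap0) kap1.
  have ca : 0 <= c m.+1 ^+ 2 <= al k0 ^+ 2 by rewrite sqr_ge0.
  have BL : 16 * B2 <= Lam by rewrite /Lam lerDr.
  have := potential_drop k01 alS2 ca Lam1 B20 BL DE D'1 D'2 zp2.
  have -> : D m / (D m + ipm S (z m w) (z m w)) = U m w.
    rewrite /U; field; rewrite !gt_eqF // ?D0 //.
    by rewrite ltr_wpDr ?D0 // ipm_ge0.
  have -> : kap * c m.+1 ^+ 2 / (8 * Lam * al k0 ^+ 2) = eta m.
    rewrite /eta /H; field; rewrite !gt_eqF ?La //; exact: al0.
  rewrite -/kk ![_ / D m.+1]mulrC -/kk; exact.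
lra.
Qed.

(** Pointwise on [A]: only the errors made before the point leaves the decreasing events [G] are
    counted, and as long as it is in [G] their sum is at most [del * al k0]. *)
Let rsum M : (k0 <= M)%N -> \sum_(k0 <= m < M) r m <= del * al k0 * PA.
Proof.
move=> kM; pose rr m w := rho m w * \1_(G m.+1) w.
have irr m : (k0 <= m)%N -> Pr.-integrable A (EFin \o rr m).
  move=> km; apply: (@bounded_integrable _ _ _ _ _ _ (del * al k0)) => //.
    apply: measurable_funM; first exact: (measurable_wrt_fun (hsig m.+1) (@hsub m.+1) (@rho_wrt m)).
    by apply: measurable_indic; apply: mG; exact: leqW.
  move=> w _; rewrite /rr indicE; case: (boolP (w \in G m.+1)) => [/set_mem Gw|_].
    by rewrite mulr1 ger0_norm // rho_le.
  by rewrite mulr0 normr0 mulr_ge0 // ltW.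
have rE m : (k0 <= m)%N -> r m = \int[Pr]_(w in A) rr m w.
  move=> km; have -> : rr m = rho m \_ (G m.+1).
    by apply/funext => w; rewrite /rr indicE patchE; case: (_ \in _); rewrite ?mulr1 ?mulr0.
  rewrite -Rintegral_mkcondr; congr Rintegral.
  by apply/seteqP; split => w; [move=> Gw; split=> //; case: Gw|case].
have [iS hS'] : Pr.-integrable A (EFin \o (fun w => \sum_(k0 <= m < M) rr m w)) /\
   \sum_(k0 <= m < M) r m = \int[Pr]_(w in A) \sum_(k0 <= m < M) rr m w.
  have : forall j, Pr.-integrable A (EFin \o (fun w => \sum_(k0 <= m < k0 + j) rr m w)) /\
    \sum_(k0 <= m < k0 + j) r m = \int[Pr]_(w in A) \sum_(k0 <= m < k0 + j) rr m w.
    elim=> [|j [IH1 IH2]].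
      have -> : (fun w => \sum_(k0 <= m < k0 + 0) rr m w) = (fun=> 0).
        by apply/funext => w; rewrite addn0 big_geq.
      rewrite addn0 big_geq //; split; first exact: (integrable0 Pr A).
      by rewrite Rintegral_cst // mul0r.
    have ij := irr _ (leq_addr j k0).
    have -> : (fun w => \sum_(k0 <= m < k0 + j.+1) rr m w) =
        (fun w => \sum_(k0 <= m < k0 + j) rr m w + rr (k0 + j)%N w).
      by apply/funext => w; rewrite addnS big_nat_recr ?leq_addr.
    rewrite addnS big_nat_recr ?leq_addr //=.
    split; first exact: (integrableD mA IH1 ij).
    by rewrite RintegralD // IH2 rE // leq_addr.
  by move=> /(_ (M - k0)%N); rewrite subnKC.
rewrite hS' -(Rintegral_cst Pr mA); apply: le_Rintegral => //.
  apply: (@bounded_integrable _ _ _ _ _ _ `|del * al k0|) => //.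
move=> w Aw; rewrite -(subnKC kM); elim: (M - k0)%N => [|j IH].
  by rewrite addn0 big_geq // mulr_ge0 // ltW.
have [Gw|Gw] := pselect (G (k0 + j).+1 w); last first.
  rewrite addnS big_nat_recr ?leq_addr //= /rr indicE memNset // mulr0 addr0.
  exact: IH.
case: (Gw) => _ [_ h]; rewrite addnS; apply: le_trans h.
apply: ler_sum_nat => m _; rewrite /rr indicE.
by case: (_ \in _); rewrite ?mulr1 ?mulr0.
Qed.

Let uPA m : (k0 <= m)%N -> u m <= PA.
Proof.
move=> km; rewrite -[PA]mul1r -(Rintegral_cst Pr mA).
have iA : Pr.-integrable A (EFin \o (fun=> 1 : R)).
  by apply: (@bounded_integrable _ _ _ _ _ _ `|1|).
apply: (@le_trans _ _ (\int[Pr]_(w in G m) 1)).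
  apply: le_Rintegral; [exact: mG|by apply: iU; exact: mG|
    apply: (integrableS mA _ _ iA); [exact: mG|by move=> w []]|].
  by move=> w _; case/andP: (U01 m w).
by apply: Rint_subset => //; [exact: mG|move=> w []].
Qed.

(** From U - 1/4 <= U^2, which makes the quadratic drop linear in [u m]. *)
Let qge m : (k0 <= m)%N -> u m - PA / 4 <= \int[Pr]_(w in G m) U m w ^+ 2.
Proof.
move=> km; have mGm := mG km.
have i4 : Pr.-integrable (G m) (EFin \o (fun=> 1 / 4 : R)).
  by apply: (@bounded_integrable _ _ _ _ _ _ `|1 / 4|).
apply: (@le_trans _ _ (\int[Pr]_(w in G m) (U m w - 1 / 4))).
  rewrite RintegralB //; last exact: iU.
  rewrite lerD2l lerNr opprK Rintegral_cst // -/(prob Pr (G m)).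
  have : prob Pr (G m) <= PA by apply: le_prob => // w [].
  lra.
apply: le_Rintegral => //; [apply: integrable_subR => //; exact: iU|exact: iU2|].
by move=> w _; have := sqr_ge0 (U m w - 1 / 2); nra.
Qed.

Let eta0 m : 0 <= eta m.
Proof. by apply: mulr_ge0; [exact: ltW H0|rewrite divr_ge0 ?sqr_ge0]. Qed.

Let r0 m : 0 <= r m. Proof. by apply: Rintegral_ge0. Qed.

Let u_decr m M : (k0 <= m)%N -> (m <= M)%N -> u M <= u m + del * PA.
Proof.
move=> km mM; have : u M <= u m + (\sum_(m <= j < M) r j) / al k0.
  rewrite -(subnKC mM); elim: (M - m)%N => [|j IH]; first by rewrite addn0 big_geq // mul0r addr0.
  rewrite addnS big_nat_recr ?leq_addr //= mulrDl addrA.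
  have kmj : (k0 <= m + j)%N by exact: leq_trans (leq_addr _ _).
  apply: le_trans (step kmj) _; rewrite lerD2r; apply: le_trans IH.
  rewrite gerBl mulr_ge0 // Rintegral_ge0 // => w _; exact: sqr_ge0.
move=> h; apply: le_trans h _; rewrite lerD2l ler_pdivrMr // mulrAC.
apply: le_trans (rsum (leq_trans km mM)).
by rewrite (big_cat_nat km mM) /= lerDr sumr_ge0.
Qed.

Variables (E : set T) (N : nat) (Nk : (N <= k0)%N) (mE : measurable E)
  (ET : E `<=` trapped N del).

Let e : R := prob Pr (E `&` A).

Let EG m : E `&` A `<=` G m.
Proof.
move=> w [Ew Aw]; have [h1 h2 _] := ET Ew; split=> //; split.
  by move=> j /andP[kj _]; apply: h1; exact: leq_trans kj.
have [km|mk] := leqP k0 m; first exact: h2.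
by rewrite big_geq; [apply: mulr_ge0 => //; exact: ltW|exact: ltnW].
Qed.

Let U_cvg w : E w -> U m w @[m --> \oo] --> (1 : R).
Proof.
move=> /ET[_ _ hz0].
have h0 : (D m)^-1 * ipm S (z m w) (z m w) @[m --> \oo] --> (0 : R).
  pose k : R := (Lam * al k0 ^+ 2)^-1.
  have kk0 : k * (nrm S (z m w) ^+ 2) @[m --> \oo] --> (0 : R).
    rewrite -[X in _ --> X](mulr0 k); apply: cvgMr.
    rewrite -[X in _ --> X](mulr0 (0 : R)); under eq_fun do rewrite expr2.
    exact: cvgM.
  apply: (squeeze_cvgr _ (cvg_cst 0) kk0); apply: nearW => m.
  rewrite mulr_ge0 ?DV0 ?ipm_ge0 //= nrm_sqr // ler_wpM2r ?ipm_ge0 //.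
  have La : 0 < Lam by have := Lam1; lra.
  rewrite lef_pV2 ?posrE ?D0 ?mulr_gt0 //.
  by rewrite /D ler_pM2l // lerDl sqr_ge0.
rewrite -[X in _ --> X]invr1; apply: cvgV; first exact: oner_neq0.
by rewrite -[X in _ --> X]addr0; apply: cvgD => //; exact: cvg_cst.
Qed.

Let e_cvg : \int[Pr]_(w in E `&` A) U m w @[m --> \oo] --> e.
Proof.
have mEA : measurable (E `&` A) by exact: measurableI.
have : (\int[Pr]_(w in E `&` A) (U m w)%:E)%E @[m --> \oo] --> (\int[Pr]_(w in E `&` A) 1)%E.
  apply: (@dominated_cvg _ _ _ _ _ mEA _ _ (cst 1%E)) => //.
  - by move=> m; apply/measurable_EFinP; exact: mU.
  - by move=> w [Ew _]; apply: cvg_EFin; [exact: nearW|exact: U_cvg].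
  - by apply: (@bounded_integrable _ _ _ _ _ _ `|1|).
  - by move=> m w _ /=; rewrite lee_fin; have /andP[? ?] := U01 m w; rewrite ger0_norm.
rewrite integral_cst // mul1e [X in _ --> X](probE Pr mEA) => /fine_cvg; exact.
Qed.

Let e_le m (X : R) : (k0 <= m)%N -> (forall M, (m <= M)%N -> u M <= X) -> e <= X.
Proof.
move=> km h; have cX : (fun=> X) @ \oo --> X by exact: cvg_cst.
apply: (ler_cvg_to e_cvg cX).
exists m => // M /= mM; apply: le_trans (h M mM).
have mEA : measurable (E `&` A) by exact: measurableI.
have mGM := mG (leq_trans km mM).
apply: Rint_subset => //; first by move=> w _; case/andP: (U01 M w).
exact: iU.
Qed.

Let e_le_u m : (k0 <= m)%N -> e <= u m + del * PA.
Proof. by move=> km; apply: (e_le km) => M mM; exact: u_decr. Qed.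

(** The mean potential starts at most at [PA] and must end at least at [e], since the potential
    tends to 1 on the trapped event. Up to the errors it never increases, so it stays above e - del
    PA and each step costs at least [eta] times e - (del + 1/4) PA. If [e] were close to [PA], the
    total drop of about 3/4 H PA would be too large. *)
Lemma density : e <= (1 + del) * PA - H * (e - (del + 1 / 4) * PA).
Proof.
set X := e - (del + 1 / 4) * PA.
have key M : (k0 <= M)%N ->
   u M <= PA - H * (1 - al M ^+ 2 / al k0 ^+ 2) * X + (\sum_(k0 <= j < M) r j) / al k0.
  move=> kM; rewrite -(subnKC kM); elim: (M - k0)%N => [|j IH].
    rewrite addn0 big_geq // mul0r addr0 divff ?gt_eqF // subrr mulr0 mul0r subr0.
    exact: uPA.
  have kj := leq_addr j k0.
  rewrite addnS big_nat_recr //= mulrDl addrA.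
  apply: le_trans (step kj) _; rewrite lerD2r.
  have h1 : eta (k0 + j) * X <= eta (k0 + j) * \int[Pr]_(w in G (k0 + j)) U (k0 + j) w ^+ 2.
    rewrite ler_wpM2l //; apply: le_trans (qge kj).
    have := e_le_u kj; rewrite /X; lra.
  have -> : PA - H * (1 - al (k0 + j).+1 ^+ 2 / al k0 ^+ 2) * X =
     PA - H * (1 - al (k0 + j) ^+ 2 / al k0 ^+ 2) * X - eta (k0 + j) * X.
    by rewrite (alE (k0 + j)) /eta; ring.
  lra.
have cX : (1 + del) * PA - H * (1 - al M ^+ 2 / al k0 ^+ 2) * X @[M --> \oo] -->
    (1 + del) * PA - H * (1 - 0 ^+ 2 / al k0 ^+ 2) * X.
  apply: cvgB; first exact: cvg_cst.
  apply: cvgMl; apply: cvgMr; apply: cvgB; first exact: cvg_cst.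
  by apply: cvgMl; rewrite !expr2; under eq_fun do rewrite expr2; apply: cvgM.
rewrite expr0n /= mul0r subr0 mulr1 in cX.
apply: (ler_cvg_to e_cvg cX).
exists k0 => // M /= kM.
have mEA : measurable (E `&` A) by exact: measurableI.
have mGM := mG kM.
apply: (@le_trans _ _ (u M)).
  by apply: Rint_subset => //; [move=> w _; case/andP: (U01 M w)|exact: iU].
apply: le_trans (key M kM) _.
have : (\sum_(k0 <= j < M) r j) / al k0 <= del * PA.
  by rewrite ler_pdivrMr // mulrAC; exact: rsum.
lra.
Qed.

End Density.

Lemma trapped_tail N del : <<s \bigcup_n F n >> (trapped N del).
Proof.
set TT := <<s _ >>; have hT : sigma_algebra setT TT by exact: smallest_sigma_algebra.
have FT m X : F m X -> TT X by move=> FX; apply: sub_sigma_algebra; exists m.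
have -> : trapped N del =
  (\bigcap_m [set w | (N <= m)%N -> Q m w /\ nrm S (z m w) <= nrm S (p m w)]) `&`
  ((\bigcap_k \bigcap_m [set w | (N <= k)%N -> (k <= m)%N -> \sum_(k <= j < m) rho j w <= del * al k]) `&`
   (\bigcap_k \bigcup_M \bigcap_m [set w | (M <= m)%N -> nrm S (z m w) <= k.+1%:R^-1])).
  apply/seteqP; split=> w.
    move=> [h1 h2 /cvgrPdist_le h3]; split; first by move=> m _; exact: h1.
    split; first by move=> k _ m _; exact: h2.
    move=> k _; have [|M _ hM] := h3 k.+1%:R^-1; first by rewrite invr_gt0.
    exists M => // m _ /= Mm; have := hM m Mm.
    by rewrite /= sub0r normrN ger0_norm ?nrm_ge0.
  move=> [h1 [h2 h3]]; split; [by move=> m; exact: h1|by move=> k m; exact: h2|].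
  apply/cvgrPdist_le => e0 e00; have [M _ hM] := h3 (Num.truncn e0^-1) I.
  exists M => // m /= Mm; rewrite sub0r normrN ger0_norm ?nrm_ge0 //.
  apply: le_trans (hM m I Mm) _; rewrite -[leRHS]invrK lef_pV2 ?posrE ?invr_gt0 //.
  by apply: ltW; exact: truncnS_gt.
apply: (sigma_setI hT); last apply: (sigma_setI hT).
- apply: (sigma_bigcap hT) => m; apply: (sigma_imply hT) => _.
  exact: FT (F_repelled m).
- apply: (sigma_bigcap hT) => k; apply: (sigma_bigcap hT) => m.
  apply: (sigma_imply hT) => _; apply: (sigma_imply hT) => _.
  exact: FT (F_rho_sum k m _).
- apply: (sigma_bigcap hT) => k; apply: (sigma_bigcup hT) => M; apply: (sigma_bigcap hT) => m.
  apply: (sigma_imply hT) => _.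
  rewrite [X in TT X](_ : _ = (fun w => nrm S (z m w)) @^-1` `]-oo, k.+1%:R^-1]); last first.
    by apply/seteqP; split=> w /=; rewrite in_itv.
  apply: (FT m); apply: (measurable_wrt_preimage (hsig m)) => //.
  by apply: (@measurable_nrm _ _ (g_sigma_algebraType (F m))) => i; exact: hz.
Qed.

Lemma trapped_null : exists2 del : R, 0 < del & forall N, Pr (trapped N del) = 0%E.
Proof.
have h0 := H0; have h1 := H1.
(* With del = H / 8 and H <= 1/8, [density] gives (1 + H) e <= (1 + H/2) PA, a proportion of at most
   1 - (H/2) / (1 + H). *)
exists (H / 8) => [|N]; first by rewrite divr_gt0.
have tT := trapped_tail N (H / 8).
apply: (prob_eq0_by_density (N := N) (c := H / 2 / (1 + H)) hF tT).
  apply/andP; split; first by apply: divr_gt0; lra.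
  by rewrite ler_pdivrMr ?mul1r; lra.
move=> k A Nk FA.
have mT : measurable (trapped N (H / 8)).
  have [] := approximable_tail Pr hF tT; exact.
have := density FA (ltW (divr_gt0 h0 (ltr0n R 8))) Nk mT (@subset_refl _ _).
set e := prob Pr _; have P0 : 0 <= prob Pr A by exact: prob_ge0.
move=> h; have H1' : 0 < 1 + H by lra.
have -> : 1 - H / 2 / (1 + H) = (1 + H / 2) / (1 + H) by field; rewrite gt_eqF.
rewrite mulrAC ler_pdivlMr //.
have : H * H <= H / 8 by have := ler_wpM2l (ltW h0) h1; lra.
set PA := prob Pr A in h P0 *; move=> HH.
have : H * H * PA <= H / 8 * PA by rewrite ler_wpM2r.
have : 0 <= H * PA by rewrite mulr_ge0 // ltW.
lra.
Qed.

End Repulsion.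

(** * Weighted noise sums *)

Section BoundedMartingale.
Context (R : realType) (disp : measure_display) (T : measurableType disp)
  (Pr : probability T R) (F : nat -> set (set T)) (hF : filtration F)
  (n : nat) (S : 'M[R]_n) (hS : posdef S) (B2 : R) (B20 : 0 <= B2)
  (d : nat -> R) (Dtot : R)
  (d_sum : forall k m, \sum_(k <= j < m) d j.+1 ^+ 2 <= Dtot)
  (xi : nat -> T -> 'cV[R]_n) (Q : nat -> set T)
  (hxi : forall m i, measurable_wrt (F m) (fun w => xi m w i 0))
  (FQ : forall m, F m (Q m))
  (xi_mean : forall m, centered Pr (F m) (Q m) (xi m.+1))
  (xi_B2 : forall m, cond_ge0 Pr (F m) (Q m) (fun w => B2 - nrm S (xi m.+1 w) ^+ 2))
  (N : nat).

Let hsig m : sigma_algebra setT (F m) := let: And3 h _ _ := hF in h m.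
Let hsub m : F m `<=` measurable := let: And3 _ h _ := hF in h m.
Let hmono k m : (k <= m)%N -> F k `<=` F m := let: And3 _ _ h := hF in h k m.

Definition wsum m w : 'cV[R]_n := \sum_(N <= j < m) d j.+1 *: xi j.+1 w.

Let wsumS m w : (N <= m)%N -> wsum m.+1 w = wsum m w + d m.+1 *: xi m.+1 w.
Proof. by move=> Nm; rewrite /wsum big_nat_recr. Qed.

Let wsum_wrt m i : measurable_wrt (F m) (fun w => wsum m w i 0).
Proof.
rewrite (_ : (fun w => _) = (fun w => \sum_(j <- index_iota N m)
    (if (j < m)%N then d j.+1 * xi j.+1 w i 0 else 0))); last first.
  apply/funext => w; rewrite /wsum summxE big_nat [RHS]big_nat.
  by apply: eq_bigr => j /andP[_ ->]; rewrite !mxE.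
apply: (@measurable_sum _ (g_sigma_algebraType (F m))) => j.
case: (ltnP j m) => jm; last exact: measurable_cst.
apply: (@measurable_funM _ (g_sigma_algebraType (F m))) => //.
apply: preimage_measurable_wrt => D mD; apply: (hmono jm).
exact: (measurable_wrt_preimage (hsig j.+1) (@hxi j.+1 i)).
Qed.

Let mxi m i : measurable_fun setT (fun w => xi m w i 0) :=
  measurable_wrt_fun (hsig m) (@hsub m) (@hxi m i).
Let mws m i : measurable_fun setT (fun w => wsum m w i 0) :=
  measurable_wrt_fun (hsig m) (@hsub m) (@wsum_wrt m i).

Section Level.
Variables (K : R) (K0 : 0 < K).

(* The sum is stopped when its norm exceeds K: exit m is the event that this
   happens at time m + 1. *)
Let stay m : set T := [set w | forall j, (N <= j <= m)%N ->
  Q j w /\ nrm S (wsum j w) <= K].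

Let Fstay m : F m (stay m).
Proof.
rewrite (_ : stay m = \bigcap_j [set w | (N <= j <= m)%N -> Q j w /\ nrm S (wsum j w) <= K]); last first.
  by apply/seteqP; split=> w h j; [move=> _|]; exact: h.
apply: (sigma_bigcap (hsig m)) => j; apply: (sigma_imply (hsig m)) => /andP[Nj jm].
apply: (hmono jm).
rewrite (_ : (fun w => _ /\ _) = Q j `&` (fun w => nrm S (wsum j w)) @^-1` `]-oo, K]); last first.
  by apply/seteqP; split=> w /=; rewrite in_itv.
apply: (sigma_setI (hsig j)) => //; apply: (measurable_wrt_preimage (hsig j)) => //.
by apply: (@measurable_nrm _ _ (g_sigma_algebraType (F j))) => i; exact: wsum_wrt.
Qed.

Definition exit m : set T := stay m `&` [set w | K < nrm S (wsum m.+1 w)].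

Lemma measurable_exit m : measurable (exit m).
Proof.
apply: measurableI; first exact: hsub (Fstay m).
rewrite -[X in measurable X]setTI (_ : [set w | _] = (fun w => nrm S (wsum m.+1 w)) @^-1` `]K, +oo[); last first.
  by apply/seteqP; split=> w /=; rewrite in_itv /= andbT.
have : measurable_fun setT (fun w => nrm S (wsum m.+1 w)) by apply: measurable_nrm => i; exact: mws.
by apply.
Qed.

Let k : R := (K ^+ 2)^-1.
Let k0 : 0 < k. Proof. by rewrite invr_gt0 exprn_gt0. Qed.

Let U m w := (1 + k * ipm S (wsum m w) (wsum m w))^-1.
Let f m := \int[Pr]_(w in stay m) (1 - U m w).

Let U01 m w : 0 <= U m w <= 1.
Proof.
have h := pot_gt0 hS (wsum m w) (ltW k0).
by rewrite invr_ge0 ltW //= invf_le1 // lerDl mulr_ge0 ?(ltW k0) // ipm_ge0.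
Qed.

Let iU m X : measurable X -> Pr.-integrable X (EFin \o U m).
Proof.
move=> mX; apply: (@bounded_integrable _ _ _ _ _ _ 1) => //.
  apply: (measurable_funS measurableT) => //.
  by apply: (measurable_pot hS) => //; (exact: mws || exact: ltW).
by move=> w _; have /andP[? ?] := U01 m w; rewrite ger0_norm.
Qed.

Let i1 X (c : R) : measurable X -> Pr.-integrable X (EFin \o (fun=> c)).
Proof. by move=> mX; apply: (@bounded_integrable _ _ _ _ _ _ `|c|). Qed.

Let iV m X : measurable X -> Pr.-integrable X (EFin \o (fun w => 1 - U m w)).
Proof. by move=> mX; apply: integrable_subR => //; [exact: i1|exact: iU]. Qed.

Let step m : (N <= m)%N ->
  f m.+1 + prob Pr (exit m) / 2 <= f m + k * d m.+1 ^+ 2 * B2.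
Proof.
move=> Nm; have ms := hsub (Fstay m); have ms1 := hsub (Fstay m.+1).
have me := measurable_exit m.
have SQ : stay m `<=` Q m by move=> w h; have [] := h m; rewrite // Nm leqnn.
have mQ : measurable (Q m) by exact: hsub (FQ m).
have [id dn] := step_down hS (hsig m) (@hsub m) (d m.+1) (Fstay m)
   (@wsum_wrt m) (@mxi m.+1) (centered_sub (@hsub m) (Fstay m) SQ mQ (xi_mean m)) k0 B20
   (cond_ge0_sub (@hsub m) (Fstay m) SQ mQ (xi_B2 m)).
have s1 : \int[Pr]_(w in stay m) (1 - U m.+1 w) <= f m + k * d m.+1 ^+ 2 * B2.
  have -> : \int[Pr]_(w in stay m) (1 - U m.+1 w) =
     \int[Pr]_(w in stay m) ((1 - U m w) + k * d m.+1 ^+ 2 * B2 -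
        (U m.+1 w - (U m w - k * d m.+1 ^+ 2 * B2))).
    by apply: eq_Rintegral => w _; ring.
  have iM : Pr.-integrable (stay m) (EFin \o (fun w => (1 - U m w) + k * d m.+1 ^+ 2 * B2)).
    exact: (integrableD ms (iV m ms) (i1 _ ms)).
  rewrite RintegralB //; last first.
    apply: integrable_subR => //; first exact: iU.
    by apply: integrable_subR => //; [exact: iU|exact: i1].
  rewrite RintegralD //; [|exact: iV|exact: i1].
  rewrite Rintegral_cst //.
  have : \int[Pr]_(w in stay m) (U m.+1 w - (U m w - k * d m.+1 ^+ 2 * B2)) >= 0.
    apply: le_trans dn _; rewrite le_eqVlt; apply/orP; left; apply/eqP.
    by apply: eq_Rintegral => w _; rewrite /U wsumS.
  have : k * d m.+1 ^+ 2 * B2 * fine (Pr (stay m)) <= k * d m.+1 ^+ 2 * B2.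
    rewrite ler_piMr //; first by apply: mulr_ge0 => //; apply: mulr_ge0; [exact: ltW|exact: sqr_ge0].
    by rewrite -lee_fin -(probE Pr ms) probability_le1.
  rewrite -/(f m); lra.
apply: le_trans s1.
(* [stay m.+1] and [exit m] are disjoint parts of [stay m]; the rest, where [Q] fails at time m + 1,
   is dropped because 1 - U is non-negative. *)
have disj : [disjoint (stay m.+1) & (exit m)].
  rewrite disj_set2E; apply/eqP; rewrite -subset0 => w [h [_ /= hK]].
  have [_] := h m.+1 (introT andP (conj (leqW Nm) (leqnn _))).
  by rewrite leNgt hK.
have sub : stay m.+1 `|` exit m `<=` stay m.
  by move=> w [h j /andP[Nj jm]|[]//]; apply: h; rewrite Nj leqW.
have mU : measurable (stay m.+1 `|` exit m) by exact: measurableU.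
apply: (@le_trans _ _ (\int[Pr]_(w in stay m.+1 `|` exit m) (1 - U m.+1 w))); last first.
  apply: fine_le; [exact: integrable_fin_num (iV _ mU)|exact: integrable_fin_num (iV _ ms)|].
  apply: ge0_subset_integral => //; first by case/integrableP: (iV m.+1 ms).
  by move=> w _; rewrite lee_fin subr_ge0; case/andP: (U01 m.+1 w).
rewrite Rintegral_setU //; last exact: iV.
rewrite lerD2l mulrC /prob -Rintegral_cst //.
apply: le_Rintegral => //; [exact: i1|exact: iV|].
move=> w [_ /= hK]; have KK : 0 < K ^+ 2 by rewrite exprn_gt0.
(* Outside the ball of radius [K], k |x|^2 >= 1 and so 1 - U >= 1/2: an exit consumes half of its
   probability. *)
have h2 : 1 <= k * ipm S (wsum m.+1 w) (wsum m.+1 w).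
  rewrite /k mulrC ler_pdivlMr // mul1r -(nrm_sqr _ hS).
  by rewrite ler_sqr ?nnegrE ?nrm_ge0 ?(ltW K0) // ltW.
have : U m.+1 w <= 2^-1.
  have pp := pot_gt0 hS (wsum m.+1 w) (ltW k0).
  by rewrite /U lef_pV2 ?posrE //; lra.
lra.
Qed.

Lemma exit_sum M : (N <= M)%N ->
  \sum_(N <= m < M) prob Pr (exit m) <= 2 * B2 * Dtot / K ^+ 2.
Proof.
move=> NM; have key : f M + (\sum_(N <= m < M) prob Pr (exit m)) / 2 <=
    k * B2 * \sum_(N <= m < M) d m.+1 ^+ 2.
  rewrite -(subnKC NM); elim: (M - N)%N => [|j IH].
    rewrite addn0 !big_geq // mul0r mulr0 addr0 /f.
    under eq_Rintegral do rewrite /U /wsum big_geq // /ipm mulmx0 mxE mulr0 addr0 invr1 subrr.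
    by rewrite Rintegral_cst ?mul0r //; exact: hsub (Fstay N).
  rewrite addnS !big_nat_recr ?leq_addr //=.
  have := step (leq_addr j N); lra.
have f0 : 0 <= f M.
  by apply: Rintegral_ge0 => w _; rewrite subr_ge0; case/andP: (U01 M w).
have : k * B2 * \sum_(N <= m < M) d m.+1 ^+ 2 <= k * B2 * Dtot.
  by apply: ler_wpM2l => //; apply: mulr_ge0 => //; exact: ltW.
rewrite -/k; lra.
Qed.

Lemma exit_prob : (Pr (\bigcup_m (exit (N + m))) <= (2 * B2 * Dtot / K ^+ 2)%:E)%E.
Proof.
apply: le_trans (measure_sigma_subadditive Pr (F := fun m => exit (N + m)) _ _ (@subset_refl _ _)) _.
- by move=> m; exact: measurable_exit.
- by apply: bigcupT_measurable => m; exact: measurable_exit.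
apply: lime_le; first exact: is_cvg_nneseries.
apply: nearW => m; rewrite (eq_bigr (fun j => (prob Pr (exit (N + j)))%:E)); last first.
  by move=> j _; exact: (probE Pr (@measurable_exit (N + j))).
rewrite sumEFin lee_fin; apply: le_trans (exit_sum (leq_addl m N)).
have -> : \sum_(N <= j < m + N) prob Pr (exit j) = \sum_(0 <= j < m) prob Pr (exit (j + N)).
  by rewrite -[X in \sum_(X <= _ < _) _](add0n N) big_addn addnK.
by rewrite le_eqVlt; apply/orP; left; apply/eqP; apply: eq_bigr => j _; rewrite addnC.
Qed.

Lemma exit_cover w : (forall m, (N <= m)%N -> Q m w) ->
  (exists2 m, (N <= m)%N & K < nrm S (wsum m w)) -> (\bigcup_m (exit (N + m))) w.
Proof.
move=> hQ [m Nm hm].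
have ex : exists m, (N <= m)%N && (K < nrm S (wsum m w)) by exists m; rewrite Nm.
(* The first time the norm exceeds [K]. It comes after [N], where the sum is empty, so the preceding
   index is an exit. *)
case: (ex_minnP ex) => -[|i] /andP[Ni hi] hmin.
  by move: hi; rewrite /wsum big_geq // nrm0 ltNge ltW.
move: Ni; rewrite leq_eqVlt => /predU1P[Ni|Ni].
  by move: hi; rewrite /wsum big_geq ?Ni // nrm0 ltNge ltW.
exists (i - N)%N => //; rewrite subnKC //; split=> // j /andP[Nj ji].
split; first exact: hQ.
rewrite leNgt; apply/negP => hj; have := hmin j; rewrite Nj hj => /(_ isT).
by rewrite leqNgt ltnS ji.
Qed.

End Level.

(* A step out of the ball of radius K costs a fixed amount of the potential
   1 / (1 + |x|^2 / K^2), whose total mean variation is O(1 / K^2). *)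
Lemma martingale_bounded : {ae Pr, forall w, (forall m, (N <= m)%N -> Q m w) ->
  exists K : R, forall m, (N <= m)%N -> nrm S (wsum m w) <= K}.
Proof.
pose Bad := \bigcap_i \bigcup_m (exit i.+1%:R (N + m)).
have mB : measurable Bad.
  apply: bigcapT_measurable => i; apply: bigcupT_measurable => m; exact: measurable_exit.
exists Bad; split=> //; last first.
  move=> w /= /not_implyP[hQ hb] i _; apply: exit_cover => //.
  apply: contra_notP hb => hb; exists i.+1%:R => m Nm.
  by rewrite leNgt; apply/negP => h; apply: hb; exists m.
rewrite (probE _ mB); congr EFin; apply/eqP; rewrite eq_le prob_ge0 andbT.
apply/ler_addgt0Pr => e e0; rewrite add0r.
(* With radius K = i + 1 larger than C / e and at least 1, the bound C / K^2 is at most C / K <=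
   e. *)
pose C := `|2 * B2 * Dtot|; pose i := Num.truncn (C / e).
have hi : C / e < i.+1%:R by exact: truncnS_gt.
have i1 : 1 <= i.+1%:R :> R by rewrite ler1n.
rewrite -lee_fin -(probE _ mB).
apply: (@le_trans _ _ (Pr (\bigcup_m (exit i.+1%:R (N + m))))).
  apply: le_measure; rewrite ?inE //.
    by apply: bigcupT_measurable => m; exact: measurable_exit.
  by move=> w h; exact: (h i I).
apply: le_trans (exit_prob (ltr0n R i.+1)) _; rewrite lee_fin.
apply: (@le_trans _ _ (C / i.+1%:R)).
  apply: (@le_trans _ _ (C / i.+1%:R ^+ 2)).
    by rewrite ler_wpM2r ?invr_ge0 ?sqr_ge0 // ler_norm.
  apply: ler_wpM2l; first exact: normr_ge0.
  by rewrite lef_pV2 ?posrE ?exprn_gt0 ?ltr0n // expr2 ler_peMl // ler0n.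
by rewrite ler_pdivrMr ?ltr0n // mulrC -ler_pdivrMr // ltW.
Qed.

End BoundedMartingale.

(** * From versions of conditional expectations to integral inequalities *)

Section ConditionalExpectation.
Context (R : realType) (disp : measure_display) (T : measurableType disp)
  (Pr : probability T R) (G : set (set T)) (hG : sigma_algebra setT G)
  (GT : G `<=` measurable).
Implicit Types (K : set T) (X : T -> R).

(** Integrability on [K] only: there the version is bounded, and it has the same integral as [X]. *)
Lemma condexp_integrable K X (Y : T -> \bar R) (B : R) : G K ->
  measurable_fun setT X -> (forall w, 0 <= X w) ->
  is_condexp_ge0 Pr G (EFin \o X) Y -> (forall w, K w -> (Y w <= B%:E)%E) ->
  Pr.-integrable K (EFin \o X).
Proof.
move=> GK mX X0 [Y0 mY hY] YB; have mK := GT GK.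
have mYT : measurable_fun K Y by exact: (measurable_wrt_fun hG GT mY).
apply/integrableP; split.
  by apply/measurable_EFinP; exact: (measurable_funS measurableT).
have -> : (\int[Pr]_(w in K) `|(EFin \o X) w|)%E = (\int[Pr]_(w in K) (EFin \o X) w)%E.
  by apply: eq_integral => w _ /=; rewrite ger0_norm.
rewrite -hY //; apply: (@le_lt_trans _ _ (\int[Pr]_(w in K) (`|B|%:E))%E).
  apply: ge0_le_integral => //.
  by move=> w Kw; apply: le_trans (YB w Kw) _; rewrite lee_fin ler_norm.
rewrite integral_cst // ltey_eq fin_numM //; exact: fin_num_measure.
Qed.

Lemma condexp_le K X (Y : T -> \bar R) (B : R) : G K ->
  measurable_fun setT X -> (forall w, 0 <= X w) ->
  is_condexp_ge0 Pr G (EFin \o X) Y -> (forall w, K w -> (Y w <= B%:E)%E) ->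
  cond_ge0 Pr G K (fun w => B - X w).
Proof.
move=> GK mX X0 cY YB; have mK := GT GK.
have iX := condexp_integrable GK mX X0 cY YB.
have iB K' : measurable K' -> Pr.-integrable K' (EFin \o (fun=> B)).
  by move=> mK'; apply: (@bounded_integrable _ _ _ _ _ _ `|B|).
split; first by apply: integrable_subR => //; exact: iB.
move=> A GA AK; have mA := GT GA.
have iXA : Pr.-integrable A (EFin \o X) by apply: (integrableS mK mA AK).
case: cY => [Y0 mY hY]; rewrite RintegralB //; last exact: iB.
rewrite subr_ge0; apply: fine_le.
- exact: integrable_fin_num iXA.
- exact: integrable_fin_num (iB _ mA).
rewrite -[leLHS]hY //; case: (leP 0 B) => B0.
  apply: ge0_le_integral => //; [exact: (measurable_wrt_fun hG GT mY)|].
  by move=> w Aw; exact: YB (AK w Aw).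
(* For B < 0 the bound contradicts Y >= 0 at every point of [A]. *)
have A0 : A = set0.
  rewrite -subset0 => w Aw; have := le_trans (Y0 w) (YB w (AK w Aw)).
  by rewrite lee_fin leNgt B0.
by rewrite A0 !integral_set0.
Qed.

Lemma condexp_ge K X (Y : T -> \bar R) (b : R) : G K -> 0 <= b ->
  Pr.-integrable K (EFin \o X) ->
  is_condexp_ge0 Pr G (EFin \o X) Y -> (forall w, K w -> (b%:E <= Y w)%E) ->
  cond_ge0 Pr G K (fun w => X w - b).
Proof.
move=> GK b0 iX [Y0 mY hY] bY; have mK := GT GK.
have ib K' : measurable K' -> Pr.-integrable K' (EFin \o (fun=> b)).
  by move=> mK'; apply: (@bounded_integrable _ _ _ _ _ _ `|b|).
split; first by apply: integrable_subR => //; exact: ib.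
move=> A GA AK; have mA := GT GA.
have iXA : Pr.-integrable A (EFin \o X) by apply: (integrableS mK mA AK).
rewrite RintegralB //; last exact: ib.
rewrite subr_ge0; apply: fine_le.
- exact: integrable_fin_num (ib _ mA).
- exact: integrable_fin_num iXA.
rewrite -[leRHS]hY //.
apply: ge0_le_integral => //; first exact: (measurable_wrt_fun hG GT mY).
by move=> w Aw; exact: bY (AK w Aw).
Qed.

(** As [X] is integrable on [K], its positive and negative parts may be integrated and subtracted
    there, and their versions [Yp] and [Ym] coincide almost surely. *)
Lemma condexp0 K X : G K -> Pr.-integrable K (EFin \o X) ->
  is_condexp Pr G X (cst 0) ->
  cond_ge0 Pr G K X /\ cond_ge0 Pr G K (fun w => - X w).
Proof.
move=> GK iX [_ [Yp [Ym [[Yp0 mYp hYp] [Ym0 mYm hYm] hae]]]].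
have mK := GT GK.
have h A : G A -> A `<=` K -> \int[Pr]_(w in A) X w = 0.
  move=> GA AK; have mA := GT GA.
  have iXA : Pr.-integrable A (EFin \o X) by apply: (integrableS mK mA AK).
  have [iP iM] : Pr.-integrable A (EFin \o X^\+) /\ Pr.-integrable A (EFin \o X^\-).
    have mXA : measurable_fun A X by apply/measurable_EFinP; case/integrableP: iXA.
    split; apply: (le_integrable mA _ _ iXA).
    - by apply/measurable_EFinP; exact: measurable_funrpos.
    - move=> w _ /=; rewrite lee_fin ger0_norm ?funrpos_ge0 // /funrpos.
      by rewrite ge_max ler_norm normr_ge0.
    - by apply/measurable_EFinP; exact: measurable_funrneg.
    - move=> w _ /=; rewrite lee_fin ger0_norm ?funrneg_ge0 // /funrneg.
      by rewrite ge_max -normrN ler_norm normr_ge0.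
  have -> : \int[Pr]_(w in A) X w = \int[Pr]_(w in A) (X^\+ w - X^\- w).
    by apply: eq_Rintegral => w _; rewrite -[in LHS](funrposBneg X).
  rewrite RintegralB // /Rintegral -hYp // -hYm //; apply/eqP; rewrite subr_eq0; apply/eqP.
  congr fine; apply: ae_eq_integral => //.
  - exact: (measurable_wrt_fun hG GT mYp).
  - exact: (measurable_wrt_fun hG GT mYm).
  apply: filterS hae => w [fp fm]; rewrite /cst => e0 _.
  have pf : Yp w \is a fin_num by rewrite ge0_fin_numE.
  have mf : Ym w \is a fin_num by rewrite ge0_fin_numE.
  move: e0; rewrite -(fineK pf) -(fineK mf) -EFinB => -[/eqP].
  by rewrite eq_sym subr_eq0 => /eqP ->.
split; split=> //.
- by move=> A GA AK; rewrite h.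
- rewrite (_ : EFin \o _ = (fun w => (-1)%:E * (EFin \o X) w)%E).
    exact: integrableZl.
  by apply/funext => w /=; rewrite mulN1e EFinN.
- move=> A GA AK; have mA := GT GA.
  have -> : \int[Pr]_(w in A) - X w = \int[Pr]_(w in A) (-1 * X w).
    by apply: eq_Rintegral => w _; rewrite mulN1r.
  by rewrite RintegralZl ?h ?mulr0 //; apply: (integrableS mK mA AK).
Qed.

Lemma cond_ge0_le K X X' : measurable K -> cond_ge0 Pr G K X ->
  Pr.-integrable K (EFin \o X') -> (forall w, K w -> X w <= X' w) ->
  cond_ge0 Pr G K X'.
Proof.
move=> mK [iX hX] iX' le; split=> // A GA AK; have mA := GT GA.
apply: le_trans (hX A GA AK) _; apply: le_Rintegral => //;
  by [apply: (integrableS mK mA AK)|move=> w Aw; exact: le (AK w Aw)].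
Qed.

Lemma cond_ge0Z K X k : measurable K -> 0 <= k -> cond_ge0 Pr G K X ->
  cond_ge0 Pr G K (fun w => k * X w).
Proof.
move=> mK k0 [iX hX]; split; first exact: (integrableZl mK k iX).
move=> A GA AK; have mA := GT GA; rewrite RintegralZl ?mulr_ge0 ?hX //.
by apply: (integrableS mK mA AK).
Qed.

Lemma cond_ge0D K X Y : measurable K -> cond_ge0 Pr G K X -> cond_ge0 Pr G K Y ->
  cond_ge0 Pr G K (fun w => X w + Y w).
Proof.
move=> mK [iX hX] [iY hY]; split; first exact: (integrableD mK iX iY).
move=> A GA AK; have mA := GT GA; rewrite RintegralD ?addr_ge0 ?hX ?hY //;
  by apply: (integrableS mK mA AK).
Qed.

Lemma centered_lin K n m (M : 'M[R]_(m, n)) (xi : T -> 'cV[R]_n) : measurable K ->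
  centered Pr G K xi -> centered Pr G K (fun w => M *m xi w).
Proof.
move=> mK hxi i.
pose ok X := cond_ge0 Pr G K X /\ cond_ge0 Pr G K (fun w => - X w).
suff : ok (fun w => \sum_j M i j * xi w j 0).
  by rewrite (_ : (fun w => \sum_j _) = (fun w => (M *m xi w) i 0)) //;
     apply/funext => w; rewrite mxE.
rewrite (_ : (fun w => _) = \sum_j (fun w => M i j * xi w j 0)); last first.
  by apply/funext => w; rewrite fct_sumE.
apply: (big_ind ok).
- have c0 : cond_ge0 Pr G K (fun=> 0).
    split; first exact: (integrable0 Pr K).
    by move=> A GA AK; rewrite Rintegral_cst ?mul0r //; exact: GT.
  split=> //; rewrite (_ : (fun w => _) = (fun=> 0)) //.
  by apply/funext => w; rewrite oppr0.
- move=> X Y [h1 h2] [h3 h4]; split; first exact: cond_ge0D.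
  rewrite (_ : (fun w => _) = (fun w => - X w + - Y w)); first exact: cond_ge0D.
  by apply/funext => w; rewrite -opprD.
- move=> j _; have [h1 h2] := hxi j.
  have [M0|M0] := leP 0 (M i j).
    split; first exact: cond_ge0Z.
    by under eq_fun do rewrite -mulrN; exact: cond_ge0Z.
  have M0' : 0 <= - M i j by rewrite oppr_ge0 ltW.
  split.
    by under eq_fun do rewrite -mulrNN; exact: cond_ge0Z.
  by under eq_fun do rewrite -mulNr; exact: cond_ge0Z.
Qed.

End ConditionalExpectation.

(** * Contraction towards the unstable manifold *)

Section Calculus.
Context (R : realType).

Lemma jacmxE n m (f : 'cV[R]_n -> 'cV[R]_m) (x v : 'cV[R]_n) :
  jacmx f x *m v = 'd f x v.
Proof.
rewrite {2}[v]matrix_sum_delta; under eq_bigr do rewrite big_ord1.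
rewrite linear_sum /=; apply/colP => i; rewrite mxE summxE.
by apply: eq_bigr => j _; rewrite linearZ /= !mxE mulrC.
Qed.

Lemma norm_mulmx_le n m (A : 'M[R]_(m, n)) (v : 'cV[R]_n) (k : R) : 0 <= k ->
  (forall i j, `|A i j| <= k) -> `|A *m v| <= n%:R * k * `|v|.
Proof.
move=> k0 hA; apply: normv_le => [|i]; first by rewrite !mulr_ge0.
rewrite mxE; apply: le_trans (ler_norm_sum _ _ _) _.
apply: (@le_trans _ _ (\sum_(j < n) k * `|v|)).
  by apply: ler_sum => j _; rewrite normrM ler_pM // normv_entry.
by rewrite sumr_const card_ord -mulrA mulr_natl.
Qed.

Lemma mx_entry_le n m (A : 'M[R]_(m, n)) i j : `|A i j| <= `|A|.
Proof.
rewrite [leRHS]mx_normrE.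
exact: (@le_bigmax _ _ _ (0 : R) (fun ij : 'I_m * 'I_n => `|A ij.1 ij.2|) (i, j)).
Qed.

Lemma norm_mulmx n m (A : 'M[R]_(m, n)) (v : 'cV[R]_n) :
  `|A *m v| <= n%:R * `|A| * `|v|.
Proof. by apply: norm_mulmx_le => // i j; exact: mx_entry_le. Qed.

(** The scalar mean value theorem for one coordinate on the segment; the intermediate [t] depends on
    [i]. *)
Lemma segment_mvt n m (f : 'cV[R]_n -> 'cV[R]_m) (x v : 'cV[R]_n) i :
  (forall t : R, 0 <= t <= 1 -> differentiable f (x + t *: v)) ->
  exists2 t : R, 0 <= t <= 1 &
    f (x + v) i 0 - f x i 0 = (jacmx f (x + t *: v) *m v) i 0.
Proof.
move=> df; pose g (t : R) : R := f (x + t *: v) i 0.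
have dg (t : R) : 0 <= t <= 1 -> is_derive t (1 : R) g ((jacmx f (x + t *: v) *m v) i 0).
  move=> t01; have dft := df t t01.
  pose fi y : R := f y i 0.
  have dv := diff_derivable (v := v) dft.
  have dfi : derivable fi (x + t *: v) v by have /derivable_mxP := dv; apply.
  have Dfi : 'D_v fi (x + t *: v) = (jacmx f (x + t *: v) *m v) i 0.
    by rewrite jacmxE -deriveE // derive_mx // mxE.
  have E : (fun h : R => h^-1 *: ((g \o shift t) (h *: 1) - g t)) =
      (fun h : R => h^-1 *: ((fi \o shift (x + t *: v)) (h *: v) - fi (x + t *: v))).
    apply/funext => h; congr (_ *: (_ - _)); rewrite /g /fi /= /shift /=.
    by rewrite scalerDl -[h *: 1]/(h * 1) mulr1 addrCA.
  apply: DeriveDef; first by rewrite /derivable E.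
  by rewrite /derive E.
have cg : {within `[0, 1], continuous g}.
  apply: derivable_within_continuous => t; rewrite in_itv /= => t01.
  by have [] := dg t t01.
have dg' : forall t : R, t \in `]0, 1[%R -> is_derive t (1 : R) g ((jacmx f (x + t *: v) *m v) i 0).
  by move=> t; rewrite in_itv /= => /andP[t0 t1]; apply: dg; rewrite !ltW.
have [t] := MVT ltr01 dg' cg.
rewrite in_itv /= subr0 mulr1 /g scale1r scale0r addr0 => /andP[t0 t1] h.
by exists t; rewrite ?h // !ltW.
Qed.

Lemma cvg_norm_ball (V W : normedModType R) (f : V -> W) (x : V) (e : R) :
  0 < e -> f @ x --> f x ->
  exists2 r : R, 0 < r & forall y, `|y - x| <= r -> `|f y - f x| <= e.
Proof.
move=> e0 /cvgrPdist_le/(_ _ e0)/nbhs_ballP[r /= r0 h].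
exists (r / 2) => [|y hy]; first by rewrite divr_gt0.
rewrite distrC; apply: h; rewrite -ball_normE /= distrC.
by apply: le_lt_trans hy _; rewrite ltr_pdivrMr // ltr_pMr // ltr1n.
Qed.

Lemma nbhs_norm_ball (V : normedModType R) (U : set V) (x : V) : nbhs x U ->
  exists2 r : R, 0 < r & forall y, `|y - x| <= r -> U y.
Proof.
move=> /nbhs_ballP[r /= r0 h]; exists (r / 2) => [|y hy]; first by rewrite divr_gt0.
apply: h; rewrite -ball_normE /= distrC.
by apply: le_lt_trans hy _; rewrite ltr_pdivrMr // ltr_pMr // ltr1n.
Qed.

(* Differentiability near x0 with a derivative continuous at x0 makes f
   strictly differentiable at x0. *)
Lemma strict_diff n m (f : 'cV[R]_n -> 'cV[R]_m) U (x0 : 'cV[R]_n) (e : R) :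
  nbhs x0 U -> C1_on U f -> 0 < e -> exists2 r : R, 0 < r &
  [/\ forall x, `|x - x0| <= r -> differentiable f x,
      forall x (v : 'cV[R]_n), `|x - x0| <= r -> `|jacmx f x *m v - jacmx f x0 *m v| <= e * `|v| &
      forall x x', `|x - x0| <= r -> `|x' - x0| <= r ->
        `|f x - f x' - jacmx f x0 *m (x - x')| <= e * `|x - x'|].
Proof.
move=> nU [dU cU] e0.
have cJ : jacmx f @ x0 --> jacmx f x0.
  by have := cU x0; rewrite /continuous_at -nbhs_subspace_interior.
have n0 : 0 < n%:R + 1 :> R by rewrite ltr_wpDl.
have en : 0 < e / (n%:R + 1) by rewrite divr_gt0.
have [r1 r10 h1] := cvg_norm_ball en cJ.
have [r2 r20 h2] := nbhs_norm_ball nU.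
have J x (v : 'cV[R]_n) : `|x - x0| <= Num.min r1 r2 -> `|jacmx f x *m v - jacmx f x0 *m v| <= e * `|v|.
  rewrite le_min => /andP[xr1 _]; rewrite -mulmxBl.
  apply: le_trans (norm_mulmx _ _) _; rewrite ler_wpM2r //.
  apply: (@le_trans _ _ (n%:R * (e / (n%:R + 1)))); first by rewrite ler_wpM2l ?h1.
  rewrite mulrA ler_pdivrMr // mulrC ler_pM2l // lerDl; exact: ler01.
exists (Num.min r1 r2); first by rewrite lt_min r10.
split=> [x|//|x x' hx hx'].
  by rewrite le_min => /andP[_ xr2]; apply: dU; exact: h2.
have hball (t : R) : 0 <= t <= 1 -> `|x' + t *: (x - x') - x0| <= Num.min r1 r2.
  move=> /andP[t0 t1].
  have -> : x' + t *: (x - x') - x0 = (1 - t) *: (x' - x0) + t *: (x - x0).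
    by apply/colP => l; rewrite !mxE; ring.
  apply: le_trans (ler_normD _ _) _; rewrite !normrZ (ger0_norm t0) ger0_norm ?subr_ge0 //.
  set r := Num.min r1 r2 in hx hx' *.
  have : (1 - t) * `|x' - x0| <= (1 - t) * r by rewrite ler_wpM2l ?subr_ge0.
  have : t * `|x - x0| <= t * r by rewrite ler_wpM2l.
  lra.
apply: normv_le => [|i]; first by rewrite mulr_ge0 // ltW.
have df (t : R) : 0 <= t <= 1 -> differentiable f (x' + t *: (x - x')).
  move=> t01; apply: dU; apply: h2; apply: le_trans (hball t t01) _.
  by rewrite ge_min lexx orbT.
have [t t01] := segment_mvt i df.
rewrite subrKC => h; rewrite !mxE h.
apply: le_trans (J _ (x - x') (hball t t01)).
by have := normv_entry (jacmx f (x' + t *: (x - x')) *m (x - x') - jacmx f x0 *m (x - x')) i; rewrite !mxE.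
Qed.

Lemma nrm_mulmx_le (n m : nat) (S : 'M[R]_n) (S' : 'M[R]_m) (M : 'M[R]_(m, n)) :
  posdef S -> posdef S' ->
  exists2 k, 0 < k & forall u, nrm S' (M *m u) <= k * nrm S u.
Proof.
move=> hS hS'; have [k1 k10 h1] := nrm_le_norm hS'; have [k2 k20 h2] := norm_le_nrm hS.
have n0 : 0 <= n%:R * `|M| * k2 by rewrite !mulr_ge0 // ltW.
exists (k1 * (n%:R * `|M| * k2 + 1)) => [|u]; first by rewrite mulr_gt0 // ltr_wpDl.
apply: le_trans (h1 _) _; rewrite -mulrA ler_pM2l // mulrDl mul1r.
apply: le_trans (_ : n%:R * `|M| * k2 * nrm S u <= _); last by rewrite lerDl nrm_ge0.
by apply: le_trans (norm_mulmx _ _) _; rewrite -[leRHS]mulrA ler_wpM2l.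
Qed.

End Calculus.

Section Contraction.
Context (R : realType) (dp dm : nat) (S : 'M[R]_dm) (hS : posdef S)
  (Hm : 'M[R]_dm) (mu2 mu' : R).
Hypothesis hH : forall u, ipm S u (Hm *m u) <= mu2 * ipm S u u.

(** Expanding the square gives the factor 1 + 2 x + y with x = t mu2 and y = C t^2. It is at most (1
    + x + y)^2 because t |mu2| <= 1/2 keeps 1 + 2 x non-negative. *)
Lemma nrm_euler_le : exists2 C, 0 <= C & forall (t : R) u, 0 <= t -> t * `|mu2| <= 1 / 2 ->
  nrm S (u + t *: (Hm *m u)) <= (1 + t * mu2 + t ^+ 2 * C) * nrm S u.
Proof.
have [CH CH00 hCH] := nrm_mulmx_le Hm hS hS; have CH0 := ltW CH00.
exists (CH ^+ 2); first exact: sqr_ge0.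
move=> t u t0 tmu; have n0 := nrm_ge0 S u.
have tm : - (1 / 2) <= t * mu2.
  have : t * - `|mu2| <= t * mu2 by rewrite ler_wpM2l // lerNl -normrN ler_norm.
  lra.
have y0 : 0 <= t ^+ 2 * CH ^+ 2 by rewrite mulr_ge0 ?sqr_ge0.
rewrite -ler_sqr ?nnegrE ?nrm_ge0 //; last by rewrite mulr_ge0 //; lra.
rewrite exprMn !nrm_sqr // ipmDD // !ipmZl !ipmZr.
have h1 : ipm S (Hm *m u) (Hm *m u) <= CH ^+ 2 * ipm S u u.
  rewrite -!(nrm_sqr _ hS) -exprMn ler_sqr ?nnegrE; first exact: hCH.
    exact: nrm_ge0.
  by rewrite mulr_ge0.
have i0 := ipm_ge0 u hS.
have h2 : t * ipm S u (Hm *m u) <= t * (mu2 * ipm S u u) by rewrite ler_wpM2l.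
have h3 : t * (t * ipm S (Hm *m u) (Hm *m u)) <= t * (t * (CH ^+ 2 * ipm S u u)).
  by rewrite ler_wpM2l // ler_wpM2l.
set y := t ^+ 2 * CH ^+ 2 in y0 *; set x := t * mu2 in tm *.
apply: (@le_trans _ _ ((1 + 2 * x + y) * ipm S u u)).
  have -> : (1 + 2 * x + y) * ipm S u u =
    ipm S u u + 2 * (t * (mu2 * ipm S u u)) + t * (t * (CH ^+ 2 * ipm S u u)).
    by rewrite /x /y; ring.
  lra.
rewrite ler_wpM2r //.
have -> : (1 + x + y) ^+ 2 = 1 + 2 * x + y + (x ^+ 2 + y ^+ 2 + y * (1 + 2 * x)) by ring.
by rewrite lerDl !addr_ge0 ?sqr_ge0 // mulr_ge0 //; lra.
Qed.

Context (a : 'cV[R]_dp -> 'cV[R]_dm -> 'cV[R]_dp)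
  (b : 'cV[R]_dp -> 'cV[R]_dm -> 'cV[R]_dm) (g : 'cV[R]_dp -> 'cV[R]_dm)
  (r L e Ks Kn : R) (r0 : 0 < r) (L0 : 0 <= L) (e0 : 0 <= e) (e1 : e <= 1)
  (Ks0 : 0 < Ks) (hKs : forall u, nrm S u <= Ks * `|u|)
  (Kn0 : 0 < Kn) (hKn : forall u, `|u| <= Kn * nrm S u)
  (he : Ks * Kn * (e * (1 + L)) <= mu' - mu2).
Hypothesis haL : forall u v u' v', `|u| <= r -> `|v| <= r -> `|u'| <= r -> `|v'| <= r ->
  `|a u v - a u' v'| <= L * (`|u - u'| + `|v - v'|).
Hypothesis hbL : forall u v u' v', `|u| <= r -> `|v| <= r -> `|u'| <= r -> `|v'| <= r ->
  `|b u v - b u' v'| <= L * (`|u - u'| + `|v - v'|).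
Hypothesis ha0 : a 0 0 = 0.
Hypothesis hb : forall u v v', `|u| <= r -> `|v| <= r -> `|v'| <= r ->
  `|b u v - b u v' - Hm *m (v - v')| <= e * `|v - v'|.
Hypothesis hgL : forall u u', `|u| <= r -> `|u'| <= r -> `|g u - g u'| <= e * `|u - u'|.
Hypothesis hg0 : g 0 = 0.
Hypothesis hgd : forall u, `|u| <= r -> differentiable g u /\
  forall v : 'cV[R]_dp, `|jacmx g u *m v| <= e * `|v|.
Hypothesis hgb : forall u, `|u| <= r -> jacmx g u *m a u (g u) = b u (g u).

Let g_le u : `|u| <= r -> `|g u| <= `|u|.
Proof.
move=> ur; have := hgL ur (_ : `|0| <= r); rewrite normr0 hg0 !subr0 => /(_ (ltW r0)) h.
by apply: le_trans h _; rewrite ler_piMl.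
Qed.

(* The graph of g is invariant under the flow, so along the straight segment
   from p in direction a(p, g p) the derivative of g is b(p, g p) up to the
   length of the segment: the Euler step leaves the graph only at second order. *)
Lemma graph_euler (p : 'cV[R]_dp) (t : R) : 0 <= t ->
  (forall s, 0 <= s <= 1 -> `|p + s *: (t *: a p (g p))| <= r) ->
  `|g (p + t *: a p (g p)) - g p - t *: b p (g p)| <=
    4 * L * t ^+ 2 * `|a p (g p)|.
Proof.
move=> t0 hseg; set k := a p (g p) in hseg *.
have pr : `|p| <= r by have := hseg 0; rewrite scale0r addr0 lexx ler01; exact.
apply: normv_le => [|i]; first by rewrite !mulr_ge0 ?sqr_ge0.
have df s : 0 <= s <= 1 -> differentiable g (p + s *: (t *: k)).
  by move=> s01; have [] := hgd (hseg s s01).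
have [s s01 hs] := segment_mvt i df; set q := p + s *: (t *: k) in hs.
have qr : `|q| <= r := hseg s s01.
have qp : `|q - p| <= t * `|k|.
  rewrite /q addrAC subrr add0r !normrZ (ger0_norm t0).
  case/andP: s01 => s0 s1; rewrite ger0_norm // ler_piMl // mulr_ge0 //.
have gq : `|g q - g p| <= `|q - p|.
  by apply: le_trans (hgL qr pr) _; rewrite ler_piMl.
have gpr : `|g p| <= r by exact: le_trans (g_le pr) pr.
have gqr : `|g q| <= r by exact: le_trans (g_le qr) qr.
have h1 : `|jacmx g q *m (k - a q (g q))| <= L * (2 * (t * `|k|)).
  have [_ /(_ (k - a q (g q))) h] := hgd qr; apply: le_trans h _.
  apply: (@le_trans _ _ `|k - a q (g q)|); first by rewrite ler_piMl.
  rewrite distrC; apply: le_trans (haL qr gqr pr gpr) _.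
  by rewrite ler_wpM2l //; lra.
have h2 : `|b q (g q) - b p (g p)| <= L * (2 * (t * `|k|)).
  by apply: le_trans (hbL qr gqr pr gpr) _; rewrite ler_wpM2l //; lra.
have E : (g (p + t *: k) - g p - t *: b p (g p)) i 0 =
   t * (jacmx g q *m (k - a q (g q)) + (b q (g q) - b p (g p))) i 0.
  have -> : jacmx g q *m (k - a q (g q)) = jacmx g q *m k - b q (g q).
    by rewrite mulmxBr hgb.
  rewrite addrA subrK.
  rewrite mxE [X in X + _]mxE [(- g p) i 0]mxE hs -scalemxAr !mxE; ring.
rewrite E normrM (ger0_norm t0).
have h3 := normv_entry (jacmx g q *m (k - a q (g q)) + (b q (g q) - b p (g p))) i.
have h4 := ler_normD (jacmx g q *m (k - a q (g q))) (b q (g q) - b p (g p)).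
apply: (@le_trans _ _ (t * (2 * (L * (2 * (t * `|k|)))))); first by rewrite ler_wpM2l //; lra.
by rewrite le_eqVlt; apply/orP; left; apply/eqP; ring.
Qed.

(** Here [p], [q] are positions corrected by the noise still to come, and [zp], [zm] are the
    corrections: the drift acts at the true position. Terms of size e t |q - g p| are absorbed by
    the gap mu' - mu2, those in [zp] and [zm] are of order t, and the Euler step along the graph
    errs by t^2. *)
Lemma contraction_step : exists r1 C, [/\ 0 < r1, 0 <= C &
  forall (t : R) p q zp zm, 0 <= t -> t <= r1 -> `|p| <= r1 -> `|q| <= r1 ->
    `|zp| <= r1 -> `|zm| <= r1 ->
    let p' := p + t *: a (p - zp) (q - zm) in
    let q' := q + t *: b (p - zp) (q - zm) in
    nrm S (q' - g p') <= (1 + t * mu') * nrm S (q - g p) +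
      C * (t * (`|zp| + `|zm|) + t ^+ 2)].
Proof.
have [CH CH0 hCH] := nrm_euler_le.
(* Small enough for every point met, the ends of the Euler steps included, to stay in the ball of
   radius [r], and for t |mu2| <= 1/2. *)
pose r1 := Num.min 1 (Num.min (r / (2 * (1 + 4 * L))) (1 / (2 * (1 + `|mu2|)))).
have L4 : 0 < 2 * (1 + 4 * L) by have := L0; lra.
have m4 : 0 < 2 * (1 + `|mu2|) by rewrite mulr_gt0 // ltr_wpDr.
have r10 : 0 < r1 by rewrite !lt_min ltr01 !divr_gt0.
have [r11 r1r r1m] : [/\ r1 <= 1, r1 * (2 * (1 + 4 * L)) <= r & r1 * (2 * (1 + `|mu2|)) <= 1].
  by rewrite -!ler_pdivlMr // /r1 !ge_min !lexx !orbT.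
pose C := Ks * (L + L + 16 * L * L + 2 * CH) + 2 * CH * Ks.
have Ks00 := ltW Ks0; have L00 := L0.
have KL : 0 <= Ks * L by exact: mulr_ge0.
have KLL : 0 <= Ks * L * L by exact: mulr_ge0.
have KC : 0 <= Ks * CH by exact: mulr_ge0.
have C1 : 2 * Ks * L <= C by rewrite /C; lra.
have C2 : Ks * (16 * L * L) + 2 * CH * Ks <= C by rewrite /C; lra.
exists r1, C; split=> //; first by apply: le_trans C1; lra.
move=> t p q zp zm t0 tr hp hq hzp hzm /=.
set p' := p + t *: a (p - zp) (q - zm); set q' := q + t *: b (p - zp) (q - zm).
have r1L : 0 <= r1 * L by rewrite mulr_ge0 // ltW.
have r2r : 2 * r1 <= r by lra.
set u := q - g p; set z := `|zp| + `|zm|.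
have z0 : 0 <= z by rewrite addr_ge0.
have pr : `|p| <= r by lra. have qr : `|q| <= r by lra.
have pzr : `|p - zp| <= r by apply: le_trans (ler_normB _ _) _; lra.
have qzr : `|q - zm| <= r by apply: le_trans (ler_normB _ _) _; lra.
have gpr1 : `|g p| <= r1 by exact: le_trans (g_le pr) hp.
have gpr : `|g p| <= r by lra.
have u2 : `|u| <= 2 * r1 by apply: le_trans (ler_normB _ _) _; lra.
have t1 : t <= 1 by lra.
have n0r : `|0 : 'cV[R]_dp| <= r by rewrite normr0 ltW.
have n0r' : `|0 : 'cV[R]_dm| <= r by rewrite normr0 ltW.
have ak : `|a p (g p)| <= 2 * L * r1.
  have := haL pr gpr n0r n0r'; rewrite ha0 !subr0 => h; apply: le_trans h _.
  have : L * (`|p| + `|g p|) <= L * (r1 + r1) by rewrite ler_wpM2l // lerD.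
  lra.
have ay : `|a (p - zp) (q - zm)| <= 4 * L * r1.
  have := haL pzr qzr n0r n0r'; rewrite ha0 !subr0 => h; apply: le_trans h _.
  have h1 := ler_normB p zp; have h2 := ler_normB q zm.
  have : L * (`|p - zp| + `|q - zm|) <= L * (4 * r1) by rewrite ler_wpM2l //; lra.
  lra.
have tL (x : R) : 0 <= x -> t * x <= x by move=> x0; rewrite ler_piMl.
have p'r : `|p'| <= r.
  apply: le_trans (ler_normD _ _) _; rewrite normrZ (ger0_norm t0).
  have := tL _ (normr_ge0 (a (p - zp) (q - zm))); lra.
have seg s : 0 <= s <= 1 -> `|p + s *: (t *: a p (g p))| <= r.
  move=> /andP[s0 s1]; apply: le_trans (ler_normD _ _) _.
  rewrite !normrZ (ger0_norm t0) (ger0_norm s0).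
  have h := tL _ (normr_ge0 (a p (g p))).
  have : s * (t * `|a p (g p)|) <= t * `|a p (g p)| by rewrite ler_piMl // mulr_ge0.
  lra.
have ser : `|p + t *: a p (g p)| <= r by have := seg 1; rewrite lexx ler01 scale1r; exact.
have E4 := graph_euler t0 seg.
have ekz : `|a (p - zp) (q - zm) - a p (g p)| <= L * (z + `|u|).
  apply: le_trans (haL pzr qzr pr gpr) _; rewrite ler_wpM2l //.
  have -> : p - zp - p = - zp by rewrite addrAC subrr add0r.
  have -> : q - zm - g p = u - zm by rewrite /u addrAC.
  rewrite normrN; have := ler_normB u zm; rewrite /z; lra.
have E3 : `|g p' - g (p + t *: a p (g p))| <= e * (t * (L * (z + `|u|))).
  apply: le_trans (hgL p'r ser) _; rewrite ler_wpM2l //.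
  rewrite /p' opprD addrACA subrr add0r -scalerBr normrZ (ger0_norm t0).
  by rewrite ler_wpM2l.
have E1 : `|b (p - zp) (q - zm) - b p q| <= L * z.
  apply: le_trans (hbL pzr qzr pr qr) _; rewrite ler_wpM2l //.
  by rewrite addrAC subrr add0r addrAC subrr add0r !normrN.
have E2 := hb pr qr gpr; rewrite -/u in E2.
(* The five parts: linear flow, effect of the corrections on [b], nonlinear part of [b],
   displacement of the base point seen through [g], and the defect estimated by [graph_euler]. *)
have D : q' - g p' = (u + t *: (Hm *m u)) + t *: (b (p - zp) (q - zm) - b p q) +
    t *: (b p q - b p (g p) - Hm *m u) - (g p' - g (p + t *: a p (g p))) -
    (g (p + t *: a p (g p)) - g p - t *: b p (g p)).
  apply/colP => i; rewrite /q' /u !mxE; ring.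
have N : nrm S (q' - g p') <= nrm S (u + t *: (Hm *m u)) + Ks * (t * (L * z)) +
    Ks * (t * (e * `|u|)) + Ks * (e * (t * (L * (z + `|u|)))) +
    Ks * (4 * L * t ^+ 2 * `|a p (g p)|).
  rewrite D; apply: le_trans (nrmD _ _ hS) _; apply: lerD; last first.
    by rewrite (nrmN _ hS); apply: le_trans (hKs _) _; rewrite ler_pM2l.
  apply: le_trans (nrmD _ _ hS) _; apply: lerD; last first.
    by rewrite (nrmN _ hS); apply: le_trans (hKs _) _; rewrite ler_pM2l.
  apply: le_trans (nrmD _ _ hS) _; apply: lerD; last first.
    apply: le_trans (hKs _) _; rewrite ler_pM2l // normrZ (ger0_norm t0).
    by rewrite ler_wpM2l.
  apply: le_trans (nrmD _ _ hS) _; apply: lerD => //.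
  apply: le_trans (hKs _) _; rewrite ler_pM2l // normrZ (ger0_norm t0).
  by rewrite ler_wpM2l.
clear ay p'r seg ser E4 ekz E3 E1 E2 D pr qr pzr qzr gpr1 gpr n0r n0r' tL hp hq hzp hzm.
have tm : t * `|mu2| <= 1 / 2.
  have : t * `|mu2| <= r1 * `|mu2| by rewrite ler_wpM2r.
  by move: r1m r10; lra.
have N1 := hCH t u t0 tm.
have nu0 := nrm_ge0 S u.
have nu2 : nrm S u <= 2 * Ks.
  apply: le_trans (hKs u) _; rewrite mulrC ler_pM2r //.
  by move: u2 r11; lra.
have un := hKn u.
have X1 : Ks * (t * (e * `|u|)) + Ks * (e * (t * (L * `|u|))) <= t * (mu' - mu2) * nrm S u.
  have -> : Ks * (t * (e * `|u|)) + Ks * (e * (t * (L * `|u|))) =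
    (t * (Ks * (e * (1 + L)))) * `|u| by ring.
  apply: (@le_trans _ _ (t * (Ks * (e * (1 + L))) * (Kn * nrm S u))).
    by rewrite ler_wpM2l // mulr_ge0 // mulr_ge0 ?(ltW Ks0) // mulr_ge0 // addr_ge0.
  have -> : t * (Ks * (e * (1 + L))) * (Kn * nrm S u) =
     t * nrm S u * (Ks * Kn * (e * (1 + L))) by ring.
  have -> : t * (mu' - mu2) * nrm S u = t * nrm S u * (mu' - mu2) by ring.
  by rewrite ler_wpM2l // mulr_ge0.
have X2 : Ks * (e * (t * (L * z))) <= Ks * (t * (L * z)).
  by rewrite ler_pM2l // ler_piMl // mulr_ge0 // mulr_ge0.
have t20 : 0 <= t ^+ 2 by exact: sqr_ge0.
have X3 : Ks * (4 * L * t ^+ 2 * `|a p (g p)|) <= Ks * (16 * L * L) * t ^+ 2.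
  have -> : Ks * (4 * L * t ^+ 2 * `|a p (g p)|) = Ks * (4 * L) * `|a p (g p)| * t ^+ 2 by ring.
  rewrite ler_wpM2r //; have -> : Ks * (16 * L * L) = Ks * (4 * L) * (4 * L) by ring.
  rewrite ler_wpM2l ?mulr_ge0 ?(ltW Ks0) //; apply: le_trans ak _.
  have : L * r1 <= L by rewrite ler_piMr.
  by have := L0; lra.
have X4 : t ^+ 2 * CH * nrm S u <= 2 * CH * Ks * t ^+ 2.
  have -> : 2 * CH * Ks * t ^+ 2 = t ^+ 2 * CH * (2 * Ks) by ring.
  by rewrite ler_wpM2l // mulr_ge0.
have X5 : C * (t * z) + C * t ^+ 2 >= 2 * (Ks * (t * (L * z))) +
   (Ks * (16 * L * L) + 2 * CH * Ks) * t ^+ 2.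
  by have := ler_wpM2r (mulr_ge0 t0 z0) C1; have := ler_wpM2r t20 C2; lra.
by move: N N1 X1 X2 X3 X4 X5; lra.
Qed.

End Contraction.

(** * Tails and the error along a trajectory *)

Section Sequences.
Context (R : realType).

Lemma powR_bernoulli (t s : R) : 0 <= t -> 0 < s < 1 -> t `^ s <= 1 - s * (1 - t).
Proof.
move=> t0 /andP[s0 s1].
have := @conjugate_powR _ (t `^ s) 1 s^-1 (1 - s)^-1 (powR_ge0 _ _) ler01.
rewrite !invr_gt0 subr_gt0 s0 s1 !invrK subrKC mulr1 powR1 mul1r => /(_ isT isT erefl).
by rewrite -powRrM mulfV ?gt_eqF // powRr1 //; lra.
Qed.

Lemma powR_drop (x x' s : R) : 0 < x -> 0 <= x' -> 0 < s < 1 ->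
  s * ((x - x') * x `^ (s - 1)) <= x `^ s - x' `^ s.
Proof.
move=> x0 x'0 hs; have h := @powR_bernoulli (x' / x) s (divr_ge0 x'0 (ltW x0)) hs.
have E : x' `^ s = x `^ s * (x' / x) `^ s.
  by rewrite -powRM ?divr_ge0 ?(ltW x0) // mulrC divfK // gt_eqF.
have E1 : x `^ s = x * x `^ (s - 1).
  rewrite -{2}[x]powRr1 ?(ltW x0) // -powRD ?(gt_eqF x0) ?implybT //.
  by congr (_ `^ _); ring.
have xs0 : 0 <= x `^ s by exact: powR_ge0.
rewrite E; have := ler_wpM2l xs0 h.
have -> : x `^ s * (1 - s * (1 - x' / x)) = x `^ s - s * ((x - x') * x `^ (s - 1)).
  by rewrite E1; field; rewrite gt_eqF.
lra.
Qed.

Section Tails.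
Context (c al : nat -> R) (c0 : forall m, 0 <= c m) (al0 : forall m, 0 < al m)
  (alE : forall m, al m ^+ 2 = c m.+1 ^+ 2 + al m.+1 ^+ 2)
  (al_cvg : al m @[m --> \oo] --> 0) (th : R) (th01 : 0 < th < 1).

Lemma tail_le m n : (m <= n)%N -> al n <= al m.
Proof.
move=> /subnK <-; elim: (n - m)%N => // i IH; apply: le_trans IH.
have h : al (i.+1 + m) ^+ 2 <= al (i + m) ^+ 2 by rewrite addSn (alE (i + m)) lerDr sqr_ge0.
by rewrite -ler_sqr // nnegrE ltW.
Qed.

Lemma tail_sqr_sum m n : (m <= n)%N -> \sum_(m <= j < n) c j.+1 ^+ 2 <= al m ^+ 2.
Proof.
move=> mn; suff -> : \sum_(m <= j < n) c j.+1 ^+ 2 = al m ^+ 2 - al n ^+ 2.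
  by rewrite gerBl sqr_ge0.
rewrite -(subnKC mn); elim: (n - m)%N => [|i IH]; first by rewrite addn0 big_geq // subrr.
by rewrite addnS big_nat_recr ?leq_addr //= IH (alE (m + i)); ring.
Qed.

(** The discrete form of the integral of x^(-th) for x = al^2: since c_{j+1}^2 is the decrement of
    al_j^2, concavity of x^(1-th) ([powR_drop]) bounds each term by a telescoping difference. *)
Lemma tail_weights_sum m n :
  \sum_(m <= j < n) (c j.+1 / al j `^ th) ^+ 2 <= (1 - th)^-1 * (al 0%N ^+ 2) `^ (1 - th).
Proof.
case/andP: th01 => t0 t1; have s0 : 0 < 1 - th by lra.
have [mn|nm] := leqP m n; last first.
  by rewrite big_geq ?mulr_ge0 ?powR_ge0 ?invr_ge0 ?(ltW s0) // ltnW.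
have hs : 0 < 1 - th < 1 by apply/andP; split; lra.
have term j : (c j.+1 / al j `^ th) ^+ 2 <= (1 - th)^-1 *
    ((al j ^+ 2) `^ (1 - th) - (al j.+1 ^+ 2) `^ (1 - th)).
  have := powR_drop (exprn_gt0 2 (al0 j)) (sqr_ge0 (al j.+1)) hs.
  rewrite mulrC -ler_pdivlMr // [leRHS]mulrC => h; apply: le_trans h.
  have -> : al j ^+ 2 - al j.+1 ^+ 2 = c j.+1 ^+ 2 by rewrite alE addrK.
  rewrite exprMn ler_wpM2l ?sqr_ge0 //.
  have -> : 1 - th - 1 = - th by ring.
  have E : (al j `^ th) ^+ 2 = (al j ^+ 2) `^ th.
    by rewrite -(powR_mulrn 2 (powR_ge0 _ _)) -(powR_mulrn 2 (ltW (al0 j))) -!powRrM mulrC.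
  by rewrite powRN exprVn E.
apply: (@le_trans _ _ ((1 - th)^-1 * ((al m ^+ 2) `^ (1 - th) - (al n ^+ 2) `^ (1 - th)))).
  rewrite -(subnKC mn); elim: (n - m)%N => [|i IH].
    by rewrite addn0 big_geq // subrr mulr0.
  rewrite addnS big_nat_recr ?leq_addr //=; apply: le_trans (lerD IH (term _)) _.
  by rewrite -mulrDr addrA subrK.
rewrite ler_wpM2l ?invr_ge0 ?(ltW s0) //.
apply: (@le_trans _ _ ((al m ^+ 2) `^ (1 - th))); first by rewrite gerBl powR_ge0.
apply: ge0_ler_powR; rewrite ?nnegrE ?sqr_ge0 ?(ltW s0) //.
by rewrite ler_sqr ?nnegrE ?(ltW (al0 _)) // tail_le.
Qed.

Context (d : nat).
Implicit Types v eps r : nat -> 'cV[R]_d.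

(* Abel summation against the nonincreasing weights al j ^ th. *)
Lemma abel_bound eps N K : (forall m, (N <= m)%N ->
    `|\sum_(N <= j < m) (c j.+1 / al j `^ th) *: eps j.+1| <= K) ->
  forall n m, (N <= n)%N -> (n <= m)%N ->
    `|\sum_(n <= j < m) c j.+1 *: eps j.+1| <= 2 * K * al n `^ th.
Proof.
case/andP: th01 => t0 t1 hK n m Nn nm.
pose A j := al j `^ th; have A0 j : 0 < A j by exact: powR_gt0.
have Adec i j : (i <= j)%N -> A j <= A i.
  by move=> ij; apply: ge0_ler_powR; rewrite ?nnegrE ?(ltW t0) ?(ltW (al0 _)) // tail_le.
have K0 : 0 <= K by exact: le_trans (normr_ge0 _) (hK N (leqnn _)).
pose P i := \sum_(N <= j < i) (c j.+1 / A j) *: eps j.+1.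
pose Q i := \sum_(n <= j < i) c j.+1 *: eps j.+1.
(* The last partial sum is kept aside with its weight. Each further step then costs only the
   decrement of the weights times [K], and the decrements telescope. *)
have key i : (n <= i)%N -> `|Q i.+1 - A i *: P i.+1| <= K * (2 * A n - A i).
  move=> /subnKC <-; elim: (i - n)%N => [|l IH].
    rewrite addn0 /Q /P big_nat1 big_nat_recr //= scalerDr scalerA.
    rewrite mulrCA mulfV ?gt_eqF // mulr1 opprD addrCA subrr addr0 normrN normrZ.
    rewrite (ger0_norm (ltW (A0 n))) mulrC.
    have -> : 2 * A n - A n = A n by ring.
    by rewrite ler_pM2r // hK.
  have nl : (n <= (n + l).+1)%N by rewrite -addnS leq_addr.
  have Nl : (N <= (n + l).+1)%N by exact: leq_trans nl.
  rewrite addnS {1}/Q big_nat_recr //= -/(Q _) {1}/P big_nat_recr //= -/(P _).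
  have -> : Q (n + l).+1 + c (n + l).+2 *: eps (n + l).+2 -
     A (n + l).+1 *: (P (n + l).+1 + (c (n + l).+2 / A (n + l).+1) *: eps (n + l).+2) =
     (Q (n + l).+1 - A (n + l)%N *: P (n + l).+1) + (A (n + l)%N - A (n + l).+1) *: P (n + l).+1.
    rewrite scalerDr scalerA mulrCA mulfV ?gt_eqF // mulr1 scalerBl.
    by apply/colP => i0; rewrite !mxE; ring.
  apply: le_trans (ler_normD _ _) _; rewrite normrZ ger0_norm; last first.
    by rewrite subr_ge0 Adec.
  have : (A (n + l)%N - A (n + l).+1) * `|P (n + l).+1| <= (A (n + l)%N - A (n + l).+1) * K.
    by rewrite ler_wpM2l ?hK // subr_ge0 Adec.
  lra.
move: nm; rewrite leq_eqVlt => /predU1P[<-|].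
  by rewrite big_geq // normr0 mulr_ge0 ?powR_ge0 // mulr_ge0.
case: m => // m; rewrite ltnS => nm; have h := key m nm.
have -> : \sum_(n <= j < m.+1) c j.+1 *: eps j.+1 = (Q m.+1 - A m *: P m.+1) + A m *: P m.+1.
  by rewrite subrK.
apply: le_trans (ler_normD _ _) _; rewrite normrZ (ger0_norm (ltW (A0 m))).
have : A m * `|P m.+1| <= A m * K by rewrite ler_pM2l // hK // (leq_trans Nn) // leqW.
rewrite -/(A n); lra.
Qed.

(** The Cauchy-Schwarz inequality in termwise form: the weights q / (2 al) and al / (2 q), with q^2
    = eta, make each of the two sums contribute half of the bound. *)
Lemma tail_cauchy_schwarz (rho : nat -> R) (eta : R) n m :
  0 < eta -> (n <= m)%N -> \sum_(n <= j < m) rho j.+1 ^+ 2 <= eta ->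
  \sum_(n <= j < m) c j.+1 * rho j.+1 <= Num.sqrt eta * al n.
Proof.
move=> e0 nm hr; set q := Num.sqrt eta; have q0 : 0 < q by rewrite sqrtr_gt0.
have qq : eta = q ^+ 2 by rewrite sqr_sqrtr // ltW.
have A := al0 n.
apply: (@le_trans _ _ (\sum_(n <= j < m) (q / (2 * al n) * c j.+1 ^+ 2 + al n / (2 * q) * rho j.+1 ^+ 2))).
  apply: ler_sum_nat => j _.
  have -> : q / (2 * al n) * c j.+1 ^+ 2 + al n / (2 * q) * rho j.+1 ^+ 2 =
     c j.+1 * rho j.+1 + (q * c j.+1 - al n * rho j.+1) ^+ 2 / (2 * q * al n).
    by field; rewrite !gt_eqF.
  by rewrite lerDl divr_ge0 ?sqr_ge0 // !mulr_ge0 // ltW.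
rewrite big_split /= -!mulr_sumr.
have h1 : q / (2 * al n) * \sum_(n <= j < m) c j.+1 ^+ 2 <= q / (2 * al n) * al n ^+ 2.
  by rewrite ler_wpM2l ?tail_sqr_sum // divr_ge0 ?mulr_ge0 // ltW.
have h2 : al n / (2 * q) * \sum_(n <= j < m) rho j.+1 ^+ 2 <= al n / (2 * q) * q ^+ 2.
  by rewrite ler_wpM2l -?qq // divr_ge0 ?mulr_ge0 // ltW.
apply: le_trans (lerD h1 h2) _; rewrite le_eqVlt; apply/orP; left; apply/eqP.
by field; rewrite !gt_eqF.
Qed.

(** [z n] is the perturbation still to come, the limit of the partial sums [M] minus [M n]. The
    limit exists because increments after n are at most C al_n^th, which tends to 0. *)
Lemma noise_tail eps r N K Rt : (forall m, (N <= m)%N ->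
    `|\sum_(N <= j < m) (c j.+1 / al j `^ th) *: eps j.+1| <= K) ->
  (forall n m, \sum_(n <= j < m) `|r j.+1| ^+ 2 <= Rt) ->
  exists C z, [/\ 0 <= C,
    forall n, z n = z n.+1 + c n.+1 *: (eps n.+1 + r n.+1) &
    forall n, (N <= n)%N -> `|z n| <= C * al n `^ th].
Proof.
case/andP: th01 => t0 t1 hK hr.
pose v j := c j.+1 *: (eps j.+1 + r j.+1); pose M n := \sum_(0 <= j < n) v j.
have K0 : 0 <= K by exact: le_trans (normr_ge0 _) (hK N (leqnn _)).
pose Rt' := `|Rt| + 1; have Rt0 : 0 < Rt' by rewrite ltr_wpDl.
(* First the Abel bound for [eps], then the contribution of [r], of order al_n <= al_0^(1-th)
   al_n^th. *)
pose C := 2 * K + Num.sqrt Rt' * al 0%N `^ (1 - th).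
have C0 : 0 <= C by rewrite addr_ge0 ?mulr_ge0 ?sqrtr_ge0 ?powR_ge0.
have inc n m : (N <= n)%N -> (n <= m)%N -> `|M m - M n| <= C * al n `^ th.
  move=> Nn nm.
  have -> : M m - M n = \sum_(n <= j < m) c j.+1 *: eps j.+1 + \sum_(n <= j < m) c j.+1 *: r j.+1.
    rewrite /M (big_cat_nat (leq0n n) nm) /= addrAC subrr add0r -big_split /=.
    by apply: eq_bigr => j _; rewrite /v scalerDr.
  apply: le_trans (ler_normD _ _) _; rewrite mulrDl; apply: lerD; first exact: (abel_bound hK).
  apply: le_trans (ler_norm_sum _ _ _) _.
  apply: (@le_trans _ _ (\sum_(n <= j < m) c j.+1 * `|r j.+1|)).
    by apply: ler_sum => j _; rewrite normrZ ger0_norm.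
  apply: le_trans (tail_cauchy_schwarz (rho := fun j => `|r j|) Rt0 nm _) _.
    by apply: le_trans (hr n m) _; apply: le_trans (ler_norm _) _; rewrite lerDl.
  rewrite -mulrA ler_wpM2l ?sqrtr_ge0 //.
  rewrite -{1}[al n]powRr1 ?(ltW (al0 n)) //.
  have -> : al n `^ 1 = al n `^ (1 - th) * al n `^ th.
    by rewrite -powRD ?(gt_eqF (al0 n)) ?implybT // subrK.
  rewrite ler_pM2r ?powR_gt0 //.
  by apply: ge0_ler_powR; rewrite ?nnegrE ?(ltW (al0 _)) ?subr_ge0 ?(ltW t1) // tail_le.
have Acvg : C * al n `^ th @[n --> \oo] --> 0.
  rewrite -[X in _ --> X](mulr0 C); apply: cvgMr.
  apply/cvgrPdist_le => e e0.
  have e1 : 0 < e `^ th^-1 by exact: powR_gt0.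
  have /cvgrPdist_le/(_ _ e1)[n0 _ h] := al_cvg.
  exists n0 => // n /h; rewrite /= !sub0r !normrN !ger0_norm ?powR_ge0 ?(ltW (al0 _)) // => h'.
  have -> : e = (e `^ th^-1) `^ th by rewrite -powRrM mulVf ?gt_eqF // powRr1 // ltW.
  by apply: ge0_ler_powR; rewrite ?nnegrE ?powR_ge0 ?(ltW t0) ?(ltW (al0 _)).
have : cvg (M n @[n --> \oo]).
  apply/cauchy_cvgP/cauchy_exP => e e0.
  have e2 : 0 < e / 4 by rewrite divr_gt0.
  have /cvgrPdist_le/(_ _ e2)[n0 _ h] := Acvg.
  pose n1 := maxn N n0.
  have h1 := h n1 (leq_maxr _ _); rewrite /= sub0r normrN in h1.
  have hm m : (n1 <= m)%N -> `|M m - M n1| <= e / 4.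
    move=> nm; apply: le_trans (inc n1 m (leq_maxl _ _) nm) _.
    exact: le_trans (ler_norm _) h1.
  exists (M n1), n1 => // m hi; rewrite -ball_normE /= distrC.
  by apply: le_lt_trans (hm m hi) _; lra.
move=> /cvg_ex[Mo hMo]; exists C, (fun n => Mo - M n); split=> //.
  move=> n; rewrite /M big_nat_recr //= -/(M n) -/(v n).
  by rewrite opprD addrA subrK.
move=> n Nn; have cM : `|M m - M n| @[m --> \oo] --> `|Mo - M n|.
  by apply: cvg_norm; apply: cvgB => //; exact: cvg_cst.
have cC : (fun=> C * al n `^ th) @ \oo --> C * al n `^ th by exact: cvg_cst.
by apply: (ler_cvg_to cM cC); exists n => // m /= nm; exact: inc.
Qed.

End Tails.
End Sequences.

Section Path.
Context (R : realType).

Lemma cvg0_le (V : normedModType R) (x : nat -> V) (e : R) : 0 < e ->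
  x n @[n --> \oo] --> (0 : V) -> exists N, forall n, (N <= n)%N -> `|x n| <= e.
Proof.
move=> e0 /cvgrPdist_le/(_ _ e0)[N _ h]; exists N => n Nn.
by have := h n Nn; rewrite /= sub0r normrN.
Qed.

Lemma norm_usubmx n m (x : 'cV[R]_(n + m)) : `|usubmx x| <= `|x|.
Proof. by apply: normv_le => // i; rewrite mxE normv_entry. Qed.

Lemma norm_dsubmx n m (x : 'cV[R]_(n + m)) : `|dsubmx x| <= `|x|.
Proof. by apply: normv_le => // i; rewrite mxE normv_entry. Qed.

Context (gamma s : nat -> R) (gamma0 : forall n, 0 <= gamma n)
  (sE : forall n, s n.+1 = s n + gamma n.+1).

(** Comparison with the integral of exp(- kap s): each term is at most (1 + kap) / kap times the
    decrement of the exponential, the factor 1 + kap being the price of steps gamma <= 1. *)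
Lemma expR_sum (kap : R) N : 0 < kap -> (forall n, (N <= n)%N -> gamma n.+1 <= 1) ->
  forall n m, (N <= n)%N ->
  \sum_(n <= j < m) gamma j.+1 * expR (- kap * s j) <= (1 + kap) / kap * expR (- kap * s n).
Proof.
move=> k0 g1 n m Nn; pose E j := expR (- kap * s j).
have E0 j : 0 < E j by exact: expR_gt0.
have q0 : 0 < (1 + kap) / kap by rewrite divr_gt0 //; lra.
have term j : (n <= j)%N -> gamma j.+1 * E j <= (1 + kap) / kap * (E j - E j.+1).
  move=> nj; set x := gamma j.+1; have x0 : 0 <= x by exact: gamma0.
  have x1 : x <= 1 by apply: g1; exact: leq_trans nj.
  have -> : E j.+1 = E j * expR (- (kap * x)) by rewrite /E sE -expRD; congr expR; rewrite /x; ring.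
  have kx : 0 <= kap * x by rewrite mulr_ge0 // ltW.
  have h1 : expR (- (kap * x)) <= (1 + kap * x)^-1.
    rewrite expRN lef_pV2 ?posrE ?expR_gt0 //; last by lra.
    exact: expR_ge1Dx.
  have h2 : kap * x / (1 + kap) <= 1 - (1 + kap * x)^-1.
    have -> : 1 - (1 + kap * x)^-1 = kap * x / (1 + kap * x) by field; rewrite gt_eqF //; lra.
    rewrite ler_wpM2l // lef_pV2 ?posrE; [|lra|lra].
    by rewrite lerD2l ler_piMr // ltW.
  have h3 : kap * x / (1 + kap) <= 1 - expR (- (kap * x)) by lra.
  have := ler_wpM2l (ltW (E0 j)) h3.
  move=> /(ler_wpM2l (ltW q0)).
  have -> : (1 + kap) / kap * (E j * (kap * x / (1 + kap))) = x * E j.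
    by field; rewrite !gt_eqF //; lra.
  move=> h; apply: le_trans h _; rewrite le_eqVlt; apply/orP; left; apply/eqP; ring.
have [nm|mn] := leqP n m; last first.
  by rewrite big_geq; [exact: mulr_ge0 (ltW q0) (ltW (E0 n))|exact: ltnW].
apply: (@le_trans _ _ ((1 + kap) / kap * (E n - E m))); last first.
  by rewrite ler_pM2l // gerBl ltW.
rewrite -(subnKC nm); elim: (m - n)%N => [|i IH].
  by rewrite addn0 big_geq // subrr mulr0.
rewrite addnS big_nat_recr ?leq_addr //=.
apply: le_trans (lerD IH (term _ (leq_addr i n))) _.
by rewrite -mulrDr addrA subrK.
Qed.

Context (dp dm : nat) (S : 'M[R]_dm) (hS : posdef S) (Sp : 'M[R]_dp) (hSp : posdef Sp)
  (a : 'cV[R]_dp -> 'cV[R]_dm -> 'cV[R]_dp)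
  (b : 'cV[R]_dp -> 'cV[R]_dm -> 'cV[R]_dm) (g : 'cV[R]_dp -> 'cV[R]_dm)
  (mu' r1 C0 Ck nu : R) (r10 : 0 < r1) (C00 : 0 <= C0) (Ck0 : 0 <= Ck) (nu0 : 0 < nu).
Hypothesis contr : forall (t : R) p q zp zm, 0 <= t -> t <= r1 -> `|p| <= r1 -> `|q| <= r1 ->
    `|zp| <= r1 -> `|zm| <= r1 ->
    let p' := p + t *: a (p - zp) (q - zm) in
    let q' := q + t *: b (p - zp) (q - zm) in
    nrm S (q' - g p') <= (1 + t * mu') * nrm S (q - g p) +
      C0 * (t * (`|zp| + `|zm|) + t ^+ 2).
Hypothesis hgL : forall u u', `|u| <= r1 -> `|u'| <= r1 -> `|g u - g u'| <= `|u - u'|.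
Hypothesis hk : forall u v, `|u| <= r1 -> `|v| <= r1 ->
  `|a u v - a u (g u)| <= Ck * `|v - g u| `^ (1 + nu).

Context (c al tau : nat -> R) (c0 : forall m, 0 <= c m) (al0 : forall m, 0 < al m)
  (alE : forall m, al m ^+ 2 = c m.+1 ^+ 2 + al m.+1 ^+ 2)
  (al_cvg : al m @[m --> \oo] --> 0)
  (tauE : forall m, tau m = gamma m.+1 ^+ 2 + tau m.+1) (tau0 : forall m, 0 <= tau m)
  (N0 : nat) (C1 th bet : R) (C10 : 0 <= C1) (th01 : 0 < th < 1) (bet0 : bet < 0)
  (mub : mu' < bet)
  (tau_al : forall n, (N0 <= n)%N -> tau n <= C1 * al n)
  (al_exp : forall n, (N0 <= n)%N -> al n `^ th <= expR (bet * s n))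
  (al_exp1 : forall n, (N0 <= n)%N -> al n <= expR (bet * s n))
  (exp_al : forall eta : R, 0 < eta -> exists N, forall n, (N <= n)%N ->
     expR (bet * (1 + nu) * s n) <= eta * al n).

Context (eps r : nat -> 'cV[R]_(dp + dm)) (K Rt : R) (N1 : nat)
  (p : nat -> 'cV[R]_dp) (q : nat -> 'cV[R]_dm)
  (pE : forall n, p n.+1 = p n + gamma n.+1 *: a (p n) (q n) +
      c n.+1 *: usubmx (eps n.+1 + r n.+1))
  (qE : forall n, q n.+1 = q n + gamma n.+1 *: b (p n) (q n) +
      c n.+1 *: dsubmx (eps n.+1 + r n.+1))
  (p_cvg : p n @[n --> \oo] --> (0 : 'cV[R]_dp))
  (q_cvg : q n @[n --> \oo] --> (0 : 'cV[R]_dm))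
  (eps_sum : forall m, (N1 <= m)%N ->
    `|\sum_(N1 <= j < m) (c j.+1 / al j `^ th) *: eps j.+1| <= K)
  (r_sum : forall n m, \sum_(n <= j < m) `|r j.+1| ^+ 2 <= Rt)
  (r_tail : forall eta : R, 0 < eta -> exists N, forall n m, (N <= n)%N ->
     \sum_(n <= j < m) `|r j.+1| ^+ 2 <= eta).

Let e n := expR (bet * s n).
Let e_gt0 n : 0 < e n. Proof. exact: expR_gt0. Qed.

Let gamma_small x : 0 < x -> exists N, forall n, (N <= n)%N -> gamma n.+1 <= x.
Proof.
move=> x0; have y0 : 0 < x ^+ 2 / (C1 + 1) by rewrite divr_gt0 ?exprn_gt0 // ltr_wpDl.
have [N hN] := cvg0_le y0 al_cvg; exists (maxn N N0) => n; rewrite geq_max => /andP[Nn N0n].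
rewrite -ler_sqr ?nnegrE ?(ltW x0) //.
have := hN n Nn; rewrite ger0_norm ?(ltW (al0 n)) // => h.
apply: (@le_trans _ _ (tau n)); first by rewrite tauE lerDl.
apply: le_trans (tau_al N0n) _; apply: (@le_trans _ _ ((C1 + 1) * al n)).
  by rewrite ler_pM2r // lerDl.
by rewrite mulrC -ler_pdivlMr // ltr_wpDl.
Qed.

(** For the corrected position, [contr] is a linear recursion of rate mu' with forcing of order
    exp(bet s). As mu' < bet, the solution decays at the rate of the forcing. *)
Lemma unstable_distance : exists C N, 0 <= C /\ forall n, (N <= n)%N ->
  `|q n - g (p n)| <= C * e n.
Proof.
have [Cz [z [Cz0 zE zle]]] := noise_tail c0 al0 alE al_cvg th01 eps_sum r_sum.
have ze n : (maxn N1 N0 <= n)%N -> `|z n| <= Cz * e n.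
  rewrite geq_max => /andP[h1 h2]; apply: le_trans (zle n h1) _.
  by rewrite ler_wpM2l // al_exp.
have r2 : 0 < r1 / 2 by rewrite divr_gt0.
(* The decay of [e] is extracted from [exp_al]: (e n)^(1 + nu) <= al n eventually. *)
have e_small x : 0 < x -> exists N, forall n, (N <= n)%N -> e n <= x.
  move=> x0; have xp : 0 < x `^ (1 + nu) by exact: powR_gt0.
  have [Nx hNx] := exp_al ltr01; have [Ny hNy] := cvg0_le xp al_cvg.
  exists (maxn Nx Ny) => n; rewrite geq_max => /andP[h1 h2].
  rewrite leNgt; apply/negP => xe.
  have : x `^ (1 + nu) < e n `^ (1 + nu).
    by apply: gt0_ltr_powR; rewrite ?nnegrE ?(ltW x0) ?(ltW (e_gt0 n)) //; have := nu0; lra.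
  have -> : e n `^ (1 + nu) = expR (bet * (1 + nu) * s n).
    by rewrite /e -expRM; congr expR; ring.
  rewrite ltNge; apply/negP/negPn; apply: le_trans (hNx n h1) _; rewrite mul1r.
  exact: le_trans (ler_norm _) (hNy n h2).
have [Na hNa] := cvg0_le r2 p_cvg; have [Nb hNb] := cvg0_le r2 q_cvg.
have [Nc hNc] := e_small (r1 / 2 / (Cz + 1)) ltac:(by rewrite divr_gt0 // ltr_wpDl).
have [Nd hNd] := gamma_small r10.
have [Ne hNe] := gamma_small (x := (1 + `|mu'|)^-1) ltac:(by rewrite invr_gt0 ltr_wpDr).
pose N := maxn (maxn N1 N0) (maxn (maxn Na Nb) (maxn Nc (maxn Nd Ne))).
have big n : (N <= n)%N -> [/\ `|z n| <= Cz * e n, `|z n| <= r1 / 2, `|p n| <= r1 / 2,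
    `|q n| <= r1 / 2 & gamma n.+1 <= r1 /\ 0 <= 1 + gamma n.+1 * mu'].
  rewrite /N !geq_max => /andP[/andP[h11 h12] /andP[/andP[ha hb] /andP[hc /andP[hd he]]]].
  have h1 : (maxn N1 N0 <= n)%N by rewrite geq_max h11.
  have zn := ze n h1; split=> //; [|exact: hNa|exact: hNb|split; first exact: hNd].
    apply: le_trans zn _; apply: (@le_trans _ _ ((Cz + 1) * e n)).
      by rewrite ler_pM2r // lerDl.
    by rewrite mulrC -ler_pdivlMr ?hNc // ltr_wpDl.
  have h := hNe n he; have m1 : 0 < 1 + `|mu'| by rewrite ltr_wpDr.
  have : gamma n.+1 * (1 + `|mu'|) <= 1 by rewrite -ler_pdivlMr // mul1r.
  have : gamma n.+1 * - `|mu'| <= gamma n.+1 * mu'.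
    by rewrite ler_wpM2l // lerNl -normrN ler_norm.
  have := gamma0 n.+1; lra.
(* Adding the perturbation still to come removes it from the recursion: [ph], [qh] make Euler steps
   of the drift taken at the point shifted back by [z n]. *)
pose ph n := p n + usubmx (z n); pose qh n := q n + dsubmx (z n).
have phE n : ph n.+1 = ph n + gamma n.+1 *: a (ph n - usubmx (z n)) (qh n - dsubmx (z n)).
  rewrite /ph /qh !addrK pE (zE n); apply/colP => i; rewrite !mxE; ring.
have qhE n : qh n.+1 = qh n + gamma n.+1 *: b (ph n - usubmx (z n)) (qh n - dsubmx (z n)).
  rewrite /ph /qh !addrK qE (zE n); apply/colP => i; rewrite !mxE; ring.
pose u n := nrm S (qh n - g (ph n)).
(* Since tau n - tau n.+1 = gamma^2, adding [C0 * tau] absorbs the quadratic error of the Euler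
   step. *)
pose W n := u n + C0 * tau n.
pose C2 := 2 * C0 * Cz + C0 * `|mu'| * C1.
have C20 : 0 <= C2 by rewrite addr_ge0 // !mulr_ge0.
have NN0 n : (N <= n)%N -> (N0 <= n)%N by rewrite /N !geq_max => /andP[/andP[_ ->]].
have step n : (N <= n)%N -> W n.+1 <= (1 + gamma n.+1 * mu') * W n + gamma n.+1 * (C2 * e n).
  move=> Nn; have [z1 z2 p2 q2 [g2 g3]] := big n Nn.
  have zu := norm_usubmx (z n); have zd := norm_dsubmx (z n).
  have hp : `|ph n| <= r1 by apply: le_trans (ler_normD _ _) _; lra.
  have hq : `|qh n| <= r1 by apply: le_trans (ler_normD _ _) _; lra.
  have h := contr (gamma0 n.+1) g2 hp hq (_ : `|usubmx (z n)| <= r1) (_ : `|dsubmx (z n)| <= r1).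
  have {h} := h ltac:(by lra) ltac:(by lra); rewrite /= -phE -qhE -/(u n) -/(u n.+1) => h.
  rewrite /W; have tE := tauE n.
  have t1 : tau n <= C1 * e n.
    by apply: le_trans (tau_al (NN0 n Nn)) _; rewrite ler_wpM2l // al_exp1 // NN0.
  set t := gamma n.+1 in h tE g3 *; have t0 : 0 <= t by exact: gamma0.
  have m1 : t * - mu' * tau n <= t * `|mu'| * (C1 * e n).
    apply: (@le_trans _ _ (t * `|mu'| * tau n)); last by rewrite ler_wpM2l // mulr_ge0.
    by rewrite ler_wpM2r // ler_wpM2l // -normrN ler_norm.
  have m2 : C0 * (t * - mu' * tau n) <= C0 * (t * `|mu'| * (C1 * e n)) by rewrite ler_wpM2l.
  have m3 : C0 * (t * (`|usubmx (z n)| + `|dsubmx (z n)|)) <= C0 * (t * (2 * (Cz * e n))).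
    by rewrite ler_wpM2l // ler_wpM2l //; lra.
  have -> : tau n.+1 = tau n - t ^+ 2 by lra.
  rewrite /C2; lra.
(* The first term starts the induction at [N]; the second makes Kb (bet - mu') dominate the forcing
   constant [C2]. *)
pose Kb := W N / e N + C2 / (bet - mu').
have W0 n : 0 <= W n by rewrite addr_ge0 ?nrm_ge0 // mulr_ge0.
have bm : 0 < bet - mu' by rewrite subr_gt0.
have Kb0 : 0 <= Kb by rewrite addr_ge0 // divr_ge0 // ltW.
have KbC : C2 <= Kb * (bet - mu').
  by rewrite -ler_pdivrMr // /Kb lerDr divr_ge0 // ltW.
have Wle n : (N <= n)%N -> W n <= Kb * e n.
  move=> /subnKC <-; elim: (n - N)%N => [|i IH].
    by rewrite addn0 -ler_pdivrMr // /Kb lerDl divr_ge0 // ltW.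
  rewrite addnS; have Ni := leq_addr i N; apply: le_trans (step _ Ni) _.
  have [_ _ _ _ [_ g3]] := big _ Ni.
  set t := gamma (N + i).+1 in g3 *; have t0 : 0 <= t by exact: gamma0.
  have eS : e (N + i)%N * (1 + bet * t) <= e (N + i).+1.
    have -> : e (N + i).+1 = e (N + i)%N * expR (bet * t).
      by rewrite /e sE -expRD; congr expR; rewrite /t; ring.
    by rewrite ler_pM2l // expR_ge1Dx.
  have h1 : (1 + t * mu') * W (N + i)%N <= (1 + t * mu') * (Kb * e (N + i)%N) by rewrite ler_wpM2l.
  have h2 := ler_wpM2l Kb0 eS.
  have te : 0 <= t * e (N + i)%N by rewrite mulr_ge0 // ltW.
  have h3 := ler_wpM2r te KbC.
  lra.
have [Kn Kn0 hKn] := norm_le_nrm hS.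
exists (Kn * Kb + 2 * Cz), N; split=> [|n Nn].
  by rewrite addr_ge0 // !mulr_ge0 // ltW.
have [z1 z2 p2 q2 _] := big n Nn.
have zu := norm_usubmx (z n); have zd := norm_dsubmx (z n).
have hp : `|ph n| <= r1 by apply: le_trans (ler_normD _ _) _; lra.
have -> : q n - g (p n) = (qh n - g (ph n)) - dsubmx (z n) + (g (ph n) - g (p n)).
  by apply/colP => i; rewrite /qh !mxE; ring.
apply: le_trans (ler_normD _ _) _.
have h1 : `|g (ph n) - g (p n)| <= `|z n|.
  apply: le_trans (hgL hp (_ : `|p n| <= r1)) _; first by lra.
  by rewrite /ph addrAC subrr add0r.
have h2 : `|qh n - g (ph n)| <= Kn * (Kb * e n).
  apply: le_trans (hKn _) _; rewrite ler_pM2l //; apply: le_trans (Wle n Nn).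
  by rewrite lerDl mulr_ge0.
have := ler_normB (qh n - g (ph n)) (dsubmx (z n)); lra.
Qed.

Lemma remainder_small (del : R) : 0 < del -> exists N, forall n m, (N <= n)%N -> (n <= m)%N ->
  \sum_(n <= j < m) nrm Sp (p j.+1 - (p j + gamma j.+1 *: a (p j) (g (p j))) -
      c j.+1 *: usubmx (eps j.+1)) <= del * al n.
Proof.
move=> del0; have nu00 := nu0; have [C [N2 [C20 hC]]] := unstable_distance.
have [Ks Ks0 hKs] := nrm_le_norm hSp.
pose kap := - (bet * (1 + nu)).
have kap0 : 0 < kap by rewrite oppr_gt0 nmulr_rlt0 //; lra.
pose Q := Ks * (Ck * C `^ (1 + nu)) * ((1 + kap) / kap).
have KC0 : 0 <= Ks * (Ck * C `^ (1 + nu)).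
  by rewrite mulr_ge0 ?(ltW Ks0) // mulr_ge0 ?powR_ge0.
have Q0 : 0 <= Q by apply: mulr_ge0 => //; apply: divr_ge0; lra.
have [Na hNa] := cvg0_le r10 p_cvg; have [Nb hNb] := cvg0_le r10 q_cvg.
have [Nc hNc] := gamma_small ltr01.
(* The thresholds give the deviation of the drift from the graph and the terms [c r] a share
   [del / 2] each. *)
have [Nd hNd] := exp_al (eta := del / 2 / (Q + 1)) ltac:(by rewrite !divr_gt0 // ltr_wpDl).
have [Ne hNe] := r_tail (eta := (del / 2 / Ks) ^+ 2) ltac:(by rewrite exprn_gt0 // !divr_gt0).
exists (maxn N2 (maxn (maxn Na Nb) (maxn Nc (maxn Nd Ne)))) => n m.
rewrite !geq_max => /andP[h2 /andP[/andP[ha hb] /andP[hc /andP[hd he]]]] nm.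
apply: (@le_trans _ _ (\sum_(n <= j < m) (Ks * (Ck * C `^ (1 + nu)) * (gamma j.+1 * expR (- kap * s j))
   + Ks * (c j.+1 * `|r j.+1|)))).
  apply: ler_sum_nat => j /andP[nj _].
  have -> : p j.+1 - (p j + gamma j.+1 *: a (p j) (g (p j))) - c j.+1 *: usubmx (eps j.+1) =
     gamma j.+1 *: (a (p j) (q j) - a (p j) (g (p j))) + c j.+1 *: usubmx (r j.+1).
    by rewrite pE; apply/colP => i; rewrite !mxE; ring.
  apply: le_trans (hKs _) _; rewrite -mulrA -mulrDr ler_pM2l //.
  apply: le_trans (ler_normD _ _) _; rewrite !normrZ !ger0_norm //.
  apply: lerD; last by rewrite ler_wpM2l // norm_usubmx.
  rewrite mulrCA ler_wpM2l //.
  apply: le_trans (hk (hNa _ (leq_trans ha nj)) (hNb _ (leq_trans hb nj))) _.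
  rewrite -mulrA ler_wpM2l //.
  have -> : - kap * s j = bet * s j * (1 + nu) by rewrite /kap; ring.
  rewrite expRM -powRM ?(ltW (expR_gt0 _)) //.
  apply: ge0_ler_powR; rewrite ?nnegrE ?mulr_ge0 ?(ltW (expR_gt0 _)) //; first by lra.
  exact: hC (leq_trans h2 nj).
rewrite big_split /= -!mulr_sumr.
have s1 : \sum_(n <= j < m) gamma j.+1 * expR (- kap * s j) <= (1 + kap) / kap * expR (- kap * s n).
  by apply: (expR_sum (N := Nc)).
have s2 : expR (- kap * s n) <= del / 2 / (Q + 1) * al n.
  by have := hNd n hd; rewrite /kap opprK.
have s3 : \sum_(n <= j < m) c j.+1 * `|r j.+1| <= del / 2 / Ks * al n.
  have e3 : 0 < (del / 2 / Ks) ^+ 2 by rewrite exprn_gt0 // !divr_gt0.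
  have := tail_cauchy_schwarz al0 alE (rho := fun j => `|r j|) e3 nm (hNe n m he).
  by rewrite sqrtr_sqr ger0_norm // !divr_ge0 // ltW.
have A := al0 n.
have t1 : Ks * (Ck * C `^ (1 + nu)) * \sum_(n <= j < m) gamma j.+1 * expR (- kap * s j) <= del / 2 * al n.
  apply: (@le_trans _ _ (Q * expR (- kap * s n))).
    by rewrite /Q -[leRHS]mulrA ler_wpM2l.
  apply: (@le_trans _ _ ((Q + 1) * expR (- kap * s n))).
    by rewrite ler_pM2r ?expR_gt0 // lerDl.
  apply: le_trans (ler_wpM2l (addr_ge0 Q0 ler01) s2) _.
  rewrite le_eqVlt; apply/orP; left; apply/eqP; field.
  by rewrite gt_eqF // ltr_wpDl.
have t2 : Ks * \sum_(n <= j < m) c j.+1 * `|r j.+1| <= del / 2 * al n.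
  apply: le_trans (ler_wpM2l (ltW Ks0) s3) _.
  by rewrite le_eqVlt; apply/orP; left; apply/eqP; field; rewrite gt_eqF.
lra.
Qed.

End Path.

(** * The drift near the equilibrium in adapted coordinates *)

Section Geometry.
Context (R : realType).

Lemma continuous_dist (V W : normedModType R) (f : V -> W) (x : V) :
  (forall e : R, 0 < e -> exists2 r : R, 0 < r &
    forall y, `|y - x| <= r -> `|f y - f x| <= e) -> {for x, continuous f}.
Proof.
move=> h; apply/cvgrPdist_le => e e0; have [r r0 hr] := h e e0.
apply/nbhs_ballP; exists r => // y; rewrite -ball_normE /= distrC => /ltW yr.
by rewrite distrC; exact: hr.
Qed.

Lemma continuous_lip (V W : normedModType R) (f : V -> W) (k : R) : 0 <= k ->
  (forall x y, `|f x - f y| <= k * `|x - y|) -> continuous f.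
Proof.
move=> k0 hf x; apply: continuous_dist => e e0; have k1 : 0 < k + 1 by rewrite ltr_wpDl.
exists (e / (k + 1)) => [|y hy]; first by rewrite divr_gt0.
apply: le_trans (hf _ _) _; apply: (@le_trans _ _ ((k + 1) * `|y - x|)).
  by rewrite ler_wpM2r // lerDl.
by rewrite mulrC -ler_pdivlMr.
Qed.

Lemma norm_col_mx n m (u : 'cV[R]_n) (v : 'cV[R]_m) : `|col_mx u v| <= `|u| + `|v|.
Proof.
apply: normv_le => [|i]; first exact: addr_ge0.
rewrite mxE; case: splitP => j _.
  by apply: le_trans (normv_entry u j) _; rewrite lerDl.
by apply: le_trans (normv_entry v j) _; rewrite lerDr.
Qed.

Lemma spectrumN n (H : 'M[R]_n) z : spectrum (- H) z -> spectrum H (- z).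
Proof.
rewrite /spectrum /= => /eigenvalueP[v vH v0]; apply/eigenvalueP; exists v => //.
by move: vH; rewrite map_mxN mulmxN scaleNr => <-; rewrite opprK.
Qed.

Lemma max_Re_spectrum_ge n (H : 'M[R]_n) z :
  (forall z, spectrum H z -> complex.Re z < 0) -> spectrum H z ->
  complex.Re z <= max_Re_spectrum H.
Proof.
move=> hH hz; apply: sup_upper_bound; last by exists z.
split; first by exists (complex.Re z), z.
by exists 0 => _ [z' hz' <-]; exact/ltW/hH.
Qed.

Section HMap.
Context (dp dm : nat) (f : 'cV[R]_(dp + dm) -> 'cV[R]_(dp + dm)) (xstar : 'cV[R]_(dp + dm))
  (P : 'M[R]_(dp + dm)) (Hp : 'M[R]_dp) (Hm : 'M[R]_dm)
  (hf : exists2 U, nbhs xstar U & C1_on U f)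
  (hsplit : hyperbolic_splitting (jacmx f xstar) P Hp Hm).

Let hy := hmap f xstar P.
Definition hplus (u : 'cV[R]_dp) (v : 'cV[R]_dm) : 'cV[R]_dp :=
  usubmx (hmap f xstar P (col_mx u v)).
Definition hminus (u : 'cV[R]_dp) (v : 'cV[R]_dm) : 'cV[R]_dm :=
  dsubmx (hmap f xstar P (col_mx u v)).

(** Strict differentiability of [f] at [xstar], conjugated by the change of coordinates, which makes
    the derivative block diagonal. Continuity near 0 will be needed to measure the drift. *)
Lemma hmap_strict (e : R) : 0 < e -> exists2 r : R, 0 < r &
  (forall y, `|y| <= r -> {for y, continuous hy}) /\
  forall y y', `|y| <= r -> `|y'| <= r ->
    `|hy y - hy y' - block_mx Hp 0 0 Hm *m (y - y')| <= e * `|y - y'|.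
Proof.
move=> e0; case: hsplit => Pu hP _ _; case: hf => U nU C1U.
pose k1 := (dp + dm)%:R * `|invmx P| + 1; pose k2 := (dp + dm)%:R * `|P| + 1.
have k10 : 0 < k1 by rewrite ltr_wpDl // mulr_ge0.
have k20 : 0 < k2 by rewrite ltr_wpDl // mulr_ge0.
have hk1 (v : 'cV[R]_(dp + dm)) : `|invmx P *m v| <= k1 * `|v|.
  by apply: le_trans (norm_mulmx _ _) _; rewrite ler_wpM2r // lerDl.
have hk2 (v : 'cV[R]_(dp + dm)) : `|P *m v| <= k2 * `|v|.
  by apply: le_trans (norm_mulmx _ _) _; rewrite ler_wpM2r // lerDl.
have e'0 : 0 < e / (k1 * k2) by rewrite divr_gt0 // mulr_gt0.
have [r r0 [hd _ hs]] := strict_diff nU C1U e'0.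
have yr y : `|y| <= r / k2 -> `|xstar + P *m y - xstar| <= r.
  move=> hly; rewrite addrAC subrr add0r; apply: le_trans (hk2 y) _.
  by rewrite mulrC -ler_pdivlMr.
exists (r / k2); first exact: divr_gt0.
split=> [y hly|y y' hly hly'].
  have cf := differentiable_continuous (hd _ (yr y hly)).
  have lin m n (M : 'M[R]_(m, n)) : continuous (fun v : 'cV[R]_n => M *m v).
    apply: (@continuous_lip _ _ _ (n%:R * `|M|)) => [|v v']; first exact: mulr_ge0.
    by rewrite -mulmxBr; exact: norm_mulmx.
  have aff : {for y, continuous (fun y => xstar + P *m y)}.
    apply: continuous_dist => x x0; have [t t0 ht] := cvg_norm_ball x0 (lin _ _ P y).
    exists t => // w /ht; by rewrite opprD addrACA subrr add0r.
  have c2 := @continuous_comp _ _ _ (fun y => xstar + P *m y) f y aff cf.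
  exact: (@continuous_comp _ _ _ (f \o (fun y => xstar + P *m y)) (fun v => invmx P *m v) y c2 (@lin _ _ _ _)).
have E : hy y - hy y' - block_mx Hp 0 0 Hm *m (y - y') =
   invmx P *m (f (xstar + P *m y) - f (xstar + P *m y') -
     jacmx f xstar *m (xstar + P *m y - (xstar + P *m y'))).
  have -> : xstar + P *m y - (xstar + P *m y') = P *m (y - y').
    by rewrite opprD addrACA subrr add0r mulmxBr.
  by rewrite /hy /hmap -hP !mulmxBr !mulmxA.
rewrite E; apply: le_trans (hk1 _) _.
apply: (@le_trans _ _ (k1 * (e / (k1 * k2) * (k2 * `|y - y'|)))).
  rewrite ler_pM2l //; apply: le_trans (hs _ _ (yr y hly) (yr y' hly')) _.
  rewrite ler_pM2l //; apply: le_trans (hk2 _).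
  by rewrite opprD addrACA subrr add0r mulmxBr.
by rewrite le_eqVlt; apply/orP; left; apply/eqP; field; rewrite !gt_eqF.
Qed.

Lemma hpm_strict (e : R) : 0 < e -> exists2 r : R, 0 < r &
  (forall y, `|y| <= r -> {for y, continuous hy}) /\
  forall u v u' v', `|u| <= r -> `|v| <= r -> `|u'| <= r -> `|v'| <= r ->
    `|hplus u v - hplus u' v' - Hp *m (u - u')| <= e * (`|u - u'| + `|v - v'|) /\
    `|hminus u v - hminus u' v' - Hm *m (v - v')| <= e * (`|u - u'| + `|v - v'|).
Proof.
move=> e0; have [r r0 [hc hr]] := hmap_strict e0.
exists (r / 2); first exact: divr_gt0.
split=> [y hly|u v u' v' hu hv hu' hv']; first by apply: hc; lra.
have n1 : `|col_mx u v| <= r by apply: le_trans (norm_col_mx _ _) _; lra.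
have n2 : `|col_mx u' v'| <= r by apply: le_trans (norm_col_mx _ _) _; lra.
have := hr _ _ n1 n2.
have E : col_mx u v - col_mx u' v' = col_mx (u - u') (v - v').
  by rewrite opp_col_mx add_col_mx.
rewrite E mul_block_col !mul0mx addr0 add0r => h1.
have h2 := le_trans h1 (ler_wpM2l (ltW e0) (norm_col_mx (u - u') (v - v'))).
split; apply: le_trans h2.
- have -> : hplus u v - hplus u' v' - Hp *m (u - u') =
    usubmx (hy (col_mx u v) - hy (col_mx u' v') - col_mx (Hp *m (u - u')) (Hm *m (v - v'))).
    by rewrite [RHS]linearB [X in _ = X - _]linearB /= col_mxKu.
  by apply: normv_le => // i; rewrite mxE normv_entry.
- have -> : hminus u v - hminus u' v' - Hm *m (v - v') =
    dsubmx (hy (col_mx u v) - hy (col_mx u' v') - col_mx (Hp *m (u - u')) (Hm *m (v - v'))).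
    by rewrite [RHS]linearB [X in _ = X - _]linearB /= col_mxKd.
  by apply: normv_le => // i; rewrite mxE normv_entry.
Qed.

Context (Np : set 'cV[R]_dp) (Nm : set 'cV[R]_dm) (g : 'cV[R]_dp -> 'cV[R]_dm)
  (hg : unstable_graph f xstar P Np Nm g) (hequi : equilibrium f xstar).

(** As Dg(0) = 0, strict differentiability gives [g] a Lipschitz constant as small as desired near
    0. *)
Lemma graph_strict (e : R) : 0 < e -> exists2 r : R, 0 < r &
  [/\ forall u, `|u| <= r -> Np u, forall v, `|v| <= r -> Nm v,
   forall u, `|u| <= r -> differentiable g u /\
     forall v : 'cV[R]_dp, `|jacmx g u *m v| <= e * `|v| &
   forall u u', `|u| <= r -> `|u'| <= r -> `|g u - g u'| <= e * `|u - u'|].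
Proof.
move=> e0; case: hg => -[nNp _] [nNm _] [_ C1g] [g0 Jg0] _.
have [r1 r10 [hd hJ hs]] := strict_diff nNp C1g e0.
have [r2 r20 h2] := nbhs_norm_ball nNp; have [r3 r30 h3] := nbhs_norm_ball nNm.
have low x : x <= Num.min r1 (Num.min r2 r3) -> [/\ x <= r1, x <= r2 & x <= r3].
  by rewrite !le_min => /and3P[].
exists (Num.min r1 (Num.min r2 r3)); first by rewrite !lt_min r10 r20.
split=> [u /low[_ hh _]|v /low[_ _ hh]|u /low[hh _ _]|u u' /low[hh _ _] /low[hh' _ _]].
- by apply: h2; rewrite subr0.
- by apply: h3; rewrite subr0.
- split; first by apply: hd; rewrite subr0.
  by move=> v; have := hJ u v; rewrite subr0 Jg0 mul0mx subr0; exact.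
- have := hs u u'; rewrite !subr0 Jg0 mul0mx subr0; exact.
Qed.

Context (sp : {dot 'cV[R]_dp for idfun}) (sm : {dot 'cV[R]_dm for idfun})
  (nu Cnu : R) (nu_gt0 : 0 < nu)
  (hk : forall x, Nstar xstar P Np Nm x ->
     let u := psi xstar P g x in
     ipnorm sp (kplus f xstar P g u.1 u.2 - kplus f xstar P g u.1 0)
       <= Cnu * ipnorm sm u.2 `^ (1 + nu)).

(** Hypothesis (i) at the point with coordinates (u, v): there u^- = v - g u, so [kplus] takes the
    values h^+(u, v) and, for u^- = 0, h^+(u, g u). The norms of the statement are traded for the
    sup norm. *)
Lemma hplus_graph_le : exists2 Ck, 0 <= Ck & forall u v, Np u -> Nm v ->
  `|hplus u v - hplus u (g u)| <= Ck * `|v - g u| `^ (1 + nu).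
Proof.
case: hsplit => Pu _ _ _.
have [S1 hS1 E1] := ipnorm_nrm sp; have [S2 hS2 E2] := ipnorm_nrm sm.
have [k1 k10 hk1] := norm_le_nrm hS1; have [k2 k20 hk2] := nrm_le_norm hS2.
exists (k1 * (`|Cnu| * k2 `^ (1 + nu))).
  by rewrite mulr_ge0 ?(ltW k10) // mulr_ge0 // powR_ge0.
move=> u v Nu Nv; have := hk (x := xstar + P *m col_mx u v).
rewrite /Nstar /psi /kplus /= addrAC subrr add0r mulKmx // col_mxKu col_mxKd.
rewrite subrK add0r => /(_ (conj Nu Nv)); rewrite -/(hplus u v) -/(hplus u (g u)).
rewrite E1 E2 => h1; apply: le_trans (hk1 _) _; rewrite -mulrA ler_pM2l //.
apply: le_trans h1 _; apply: (@le_trans _ _ (`|Cnu| * nrm S2 (v - g u) `^ (1 + nu))).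
  by rewrite ler_wpM2r ?powR_ge0 // ler_norm.
rewrite -mulrA ler_wpM2l // -powRM ?(ltW k20) //.
apply: ge0_ler_powR; rewrite ?nnegrE ?nrm_ge0 ?mulr_ge0 ?(ltW k20) //.
by have := nu_gt0; lra.
Qed.

(** Two adapted inner products: [S] contracts along [Hm] at a rate below mu', and [Sp], obtained
    from [lyapunov] for [- Hp] with bound 0, makes the reduced drift point outwards near 0. *)
Lemma local_geometry (mu' : R) : max_Re_spectrum Hm < mu' ->
  exists S Sp r1 C0 Ck, [/\ posdef S, posdef Sp, 0 < r1, 0 <= C0 & 0 <= Ck] /\
  [/\ forall (t : R) p q zp zm, 0 <= t -> t <= r1 -> `|p| <= r1 -> `|q| <= r1 ->
        `|zp| <= r1 -> `|zm| <= r1 ->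
        let p' := p + t *: hplus (p - zp) (q - zm) in
        let q' := q + t *: hminus (p - zp) (q - zm) in
        nrm S (q' - g p') <= (1 + t * mu') * nrm S (q - g p) +
          C0 * (t * (`|zp| + `|zm|) + t ^+ 2),
      forall u u', `|u| <= r1 -> `|u'| <= r1 -> `|g u - g u'| <= `|u - u'|,
      forall u v, `|u| <= r1 -> `|v| <= r1 ->
        `|hplus u v - hplus u (g u)| <= Ck * `|v - g u| `^ (1 + nu),
      forall u, `|u| <= r1 -> {for u, continuous (fun u => hplus u (g u))} &
      forall u, `|u| <= r1 -> 0 <= ipm Sp u (hplus u (g u))].
Proof.
move=> hmu; case: (hsplit) => _ _ spp spm.
case: (hg) => _ _ _ [g0 _] hinv.
have hm z : spectrum Hm z -> complex.Re z < mu'.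
  by move=> hz; apply: le_lt_trans (max_Re_spectrum_ge spm hz) hmu.
have [S [e1 [e10 hS hH]]] := lyapunov hm.
have hpN z : spectrum (- Hp) z -> complex.Re z < 0.
  by move=> /spectrumN/spp; case: z => x y /=; rewrite oppr_gt0.
have [Sp [e2 [e20 hSp hHp]]] := lyapunov hpN.
have [Ks Ks0 hKs] := nrm_le_norm hS; have [Kn Kn0 hKn] := norm_le_nrm hS.
have [Kp Kp0 hKp] := nrm_le_norm hSp; have [Kq Kq0 hKq] := norm_le_nrm hSp.
pose L := (dp%:R * `|Hp| + dm%:R * `|Hm|) + 1.
have L0 : 0 <= L by rewrite !addr_ge0 // mulr_ge0.
have KK : 0 < Ks * Kn * (1 + L) by rewrite !mulr_gt0 // ltr_wpDr.
(* The nonlinear parts must fit into the Lyapunov margins: [e1] for the contraction along [Hm], [e2]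
   for the outward direction, where the 2 comes from |u| + |g u| <= 2 |u|. *)
pose e := Num.min 1 (Num.min (e1 / (Ks * Kn * (1 + L))) (e2 / (2 * (Kp * Kq)))).
have KKp : 0 < 2 * (Kp * Kq) by rewrite !mulr_gt0.
have e0 : 0 < e by rewrite !lt_min ltr01 !divr_gt0.
have [ee1 ee2 ee3] : [/\ e <= 1, e * (Ks * Kn * (1 + L)) <= e1 & e * (2 * (Kp * Kq)) <= e2].
  by rewrite -!ler_pdivlMr // /e !ge_min !lexx !orbT.
have [ra ra0 [hc hab]] := hpm_strict e0; have [rb rb0 [hNp hNm hgd hgL]] := graph_strict e0.
pose r := Num.min ra rb.
have r0 : 0 < r by rewrite lt_min ra0.
have rab x : x <= r -> x <= ra /\ x <= rb by rewrite le_min => /andP[].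
have haL u v u' v' : `|u| <= r -> `|v| <= r -> `|u'| <= r -> `|v'| <= r ->
    `|hplus u v - hplus u' v'| <= L * (`|u - u'| + `|v - v'|).
  move=> /rab[h1 _] /rab[h2 _] /rab[h3 _] /rab[h4 _].
  have [h _] := hab _ _ _ _ h1 h2 h3 h4.
  have -> : hplus u v - hplus u' v' =
     (hplus u v - hplus u' v' - Hp *m (u - u')) + Hp *m (u - u') by rewrite subrK.
  apply: le_trans (ler_normD _ _) _; have h5 := norm_mulmx Hp (u - u').
  have p1 : 0 <= dp%:R * `|Hp| * `|v - v'| by rewrite !mulr_ge0.
  have p2 : 0 <= dm%:R * `|Hm| * (`|u - u'| + `|v - v'|) by rewrite mulr_ge0 ?addr_ge0 // mulr_ge0.
  have : e * (`|u - u'| + `|v - v'|) <= 1 * (`|u - u'| + `|v - v'|) by rewrite ler_wpM2r ?addr_ge0.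
  rewrite /L; lra.
have hbL u v u' v' : `|u| <= r -> `|v| <= r -> `|u'| <= r -> `|v'| <= r ->
    `|hminus u v - hminus u' v'| <= L * (`|u - u'| + `|v - v'|).
  move=> /rab[h1 _] /rab[h2 _] /rab[h3 _] /rab[h4 _].
  have [_ h] := hab _ _ _ _ h1 h2 h3 h4.
  have -> : hminus u v - hminus u' v' =
     (hminus u v - hminus u' v' - Hm *m (v - v')) + Hm *m (v - v') by rewrite subrK.
  apply: le_trans (ler_normD _ _) _; have h5 := norm_mulmx Hm (v - v').
  have p1 : 0 <= dm%:R * `|Hm| * `|u - u'| by rewrite !mulr_ge0.
  have p2 : 0 <= dp%:R * `|Hp| * (`|u - u'| + `|v - v'|) by rewrite mulr_ge0 ?addr_ge0 // mulr_ge0.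
  have : e * (`|u - u'| + `|v - v'|) <= 1 * (`|u - u'| + `|v - v'|) by rewrite ler_wpM2r ?addr_ge0.
  rewrite /L; lra.
have ha0 : hplus 0 0 = 0.
  by rewrite /hplus /hmap col_mx0 mulmx0 addr0 hequi mulmx0 linear0.
have hb u v v' : `|u| <= r -> `|v| <= r -> `|v'| <= r ->
    `|hminus u v - hminus u v' - Hm *m (v - v')| <= e * `|v - v'|.
  move=> /rab[h1 _] /rab[h2 _] /rab[h4 _].
  by have [_] := hab _ _ _ _ h1 h2 h1 h4; rewrite subrr normr0 add0r.
have hgL' u u' : `|u| <= r -> `|u'| <= r -> `|g u - g u'| <= e * `|u - u'|.
  by move=> /rab[_ h1] /rab[_ h2]; exact: hgL.
have gle u : `|u| <= r -> `|g u| <= `|u|.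
  move=> ur; have := hgL' u 0 ur; rewrite normr0 g0 !subr0 => /(_ (ltW r0)) h.
  by apply: le_trans h _; rewrite ler_piMl // ltW.
have hgd' u : `|u| <= r -> differentiable g u /\ forall v : 'cV[R]_dp, `|jacmx g u *m v| <= e * `|v|.
  by move=> /rab[_ h1]; exact: hgd.
have hgb u : `|u| <= r -> jacmx g u *m hplus u (g u) = hminus u (g u).
  move=> ur; have [_ h1] := rab _ ur; have [_ h2] := rab _ (le_trans (gle u ur) ur).
  have := hinv (col_mx u (g u)); rewrite col_mxKu col_mxKd => <- //.
    exact: hNp.
  exact: hNm.
have he : Ks * Kn * (e * (1 + L)) <= mu' - (mu' - e1) by lra.
have [r1 [C0 [r10 C00 contr]]] := contraction_step hS hH r0 L0 (ltW e0) ee1 Ks0 hKs hKn he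
   haL hbL ha0 hb hgL' g0 hgd' hgb.
have [Ck Ck0 hCk] := hplus_graph_le.
pose r2 := Num.min r1 (r / 2).
have r20 : 0 < r2 by rewrite lt_min r10 divr_gt0.
have low x : x <= r2 -> [/\ x <= r1, x <= r / 2 & x <= r].
  by rewrite le_min => /andP[h1 h2]; split=> //; lra.
exists S, Sp, r2, C0, Ck; split; first by split; [exact: hS | exact: hSp | exact: r20 | exact: C00 | exact: Ck0].
split.
- move=> t p q zp zm t0 /low[h1 _ _] /low[h2 _ _] /low[h3 _ _] /low[h4 _ _] /low[h5 _ _].
  exact: contr.
- move=> u u' /low[_ _ h1] /low[_ _ h2]; apply: le_trans (hgL' _ _ h1 h2) _.
  by rewrite ler_piMl.
- move=> u v /low[_ _ h1] /low[_ _ h2]; apply: hCk.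
    by apply: hNp; have [] := rab _ h1.
  by apply: hNm; have [] := rab _ h2.
- move=> u /low[_ h1 h2].
  have cg := differentiable_continuous (hgd' u h2).1.
  have cc : {for u, continuous (fun u => col_mx u (g u))}.
    apply: continuous_dist => x x0; have x20 : 0 < x / 2 by rewrite divr_gt0.
    have [y y0 hny] := cvg_norm_ball x20 cg.
    exists (Num.min (x / 2) y) => [|w]; first by rewrite lt_min x20.
    rewrite le_min => /andP[h3 /hny h4]; rewrite opp_col_mx add_col_mx.
    by apply: le_trans (norm_col_mx _ _) _; lra.
  have hcu : `|col_mx u (g u)| <= ra.
    apply: le_trans (norm_col_mx _ _) _; have := gle u h2; have [] := rab _ (lexx r); lra.
  have c2 := @continuous_comp _ _ _ (fun u => col_mx u (g u)) hy u cc (hc _ hcu).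
  apply: continuous_dist => x x0; have [y y0 hny] := cvg_norm_ball x0 c2.
  exists y => // w /hny; apply: le_trans; rewrite /hplus -linearB /=.
  by apply: normv_le => // i; rewrite mxE normv_entry.
- move=> u /low[_ _ h2]; have [hu _] := rab _ h2.
  have [hgu _] := rab _ (le_trans (gle u h2) h2).
  have n0 : `|0 : 'cV[R]_dp| <= ra by rewrite normr0 ltW.
  have n0' : `|0 : 'cV[R]_dm| <= ra by rewrite normr0 ltW.
  have [h3 _] := hab _ _ _ _ hu hgu n0 n0'; rewrite ha0 !subr0 in h3.
  set w := hplus u (g u) - Hp *m u in h3.
  have -> : hplus u (g u) = w - (- Hp *m u) by rewrite /w mulNmx opprK subrK.
  rewrite -scaleN1r ipmDr ipmZr mulN1r subr_ge0; apply: le_trans (hHp u) _.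
  rewrite sub0r mulNr lerNl.
  apply: le_trans (ler_norm _) _; rewrite normrN; apply: le_trans (ipm_le_nrm _ _ hSp) _.
  have w1 : nrm Sp w <= Kp * (e * (2 * (Kq * nrm Sp u))).
    apply: le_trans (hKp _) _; rewrite ler_pM2l //; apply: le_trans h3 _.
    rewrite ler_pM2l //; have := gle u h2; have := hKq u; lra.
  have nn := nrm_ge0 Sp u; apply: le_trans (ler_wpM2l nn w1) _.
  rewrite -nrm_sqr // expr2.
  have -> : nrm Sp u * (Kp * (e * (2 * (Kq * nrm Sp u)))) =
    e * (2 * (Kp * Kq)) * (nrm Sp u * nrm Sp u) by ring.
  by rewrite ler_wpM2r // mulr_ge0.
Qed.

End HMap.
End Geometry.

(** * Tails of series and exponential rates from hypothesis (ii) *)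

Section Rates.
Context (R : realType).

Lemma limn_esup_lt (u : nat -> \bar R) (x : \bar R) : (limn_esup u < x)%E ->
  exists N, forall n, (N <= n)%N -> (u n < x)%E.
Proof.
rewrite /limn_esup /limf_esup => /ereal_inf_lt[_ [V [N _ NV] <-] hV].
exists N => n Nn; apply: le_lt_trans hV; apply: ereal_sup_ubound.
by exists n => //; exact: NV.
Qed.

Lemma limn_einf_gt (u : nat -> \bar R) (x : \bar R) : (x < limn_einf u)%E ->
  exists N, forall n, (N <= n)%N -> (x < u n)%E.
Proof.
move=> h0; have : (limn_esup (-%E \o u) < - x)%E by rewrite limn_esupN lteN2.
by move=> /limn_esup_lt[N h]; exists N => n /h /=; rewrite lteN2.
Qed.

Section Tail.
Variable (x : nat -> R) (x0 : forall n, 0 <= x n).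

Definition tail (n : nat) : R := fine (\sum_(n.+1 <= k <oo) (x k)%:E)%E.

Let x0E k : (0%R <= (x k)%:E)%E. Proof. by rewrite lee_fin. Qed.

Lemma tail_ge0 n : 0 <= tail n.
Proof. by apply: fine_ge0; apply: nneseries_ge0 => k _ _; exact: x0E. Qed.

Hypothesis xfin : (\sum_(0 <= k <oo) (x k)%:E < +oo)%E.

Lemma tail_lty n : (\sum_(n <= k <oo) (x k)%:E < +oo)%E.
Proof.
apply: le_lt_trans xfin; rewrite (nneseries_split 0 n) // add0n leeDr //.
by apply: sume_ge0.
Qed.

Lemma tailE n : tail n = x n.+1 + tail n.+1.
Proof.
rewrite /tail (nneseries_split n.+1 1) // addn1 big_nat1 fineD //.
by rewrite ge0_fin_numE ?tail_lty // nneseries_ge0.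
Qed.

Lemma tail_cvg : tail n @[n --> \oo] --> 0.
Proof.
have h := nneseries_tail_cvg xfin (fun k _ => x0E k).
have h2 : ((fun n => \sum_(n.+1 <= k <oo) (x k)%:E)%E n @[n --> \oo] --> 0%E).
  by have := h; rewrite -(cvg_shiftS (fun N => \sum_(N <= k <oo) (x k)%:E)%E).
exact: fine_cvg h2.
Qed.

Lemma sum_le_tail n m : \sum_(n <= j < m) x j.+1 <= tail n.
Proof.
have [nm|mn] := leqP n m; last by rewrite big_geq ?tail_ge0 // ltnW.
suff -> : \sum_(n <= j < m) x j.+1 = tail n - tail m by rewrite gerBl tail_ge0.
rewrite -(subnKC nm); elim: (m - n)%N => [|i IH]; first by rewrite addn0 big_geq // subrr.
by rewrite addnS big_nat_recr ?leq_addr //= IH (tailE (n + i)); ring.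
Qed.

End Tail.

Lemma tail_fin (x : nat -> R) (x0 : forall n, 0 <= x n) n :
  (\sum_(n.+1 <= k <oo) (x k)%:E < +oo)%E -> (\sum_(0 <= k <oo) (x k)%:E < +oo)%E.
Proof.
move=> h; rewrite (nneseries_split 0 n.+1) => [|k _]; last by rewrite lee_fin.
by rewrite add0n lte_add_pinfty // sumEFin ltry.
Qed.

Lemma partial_sum_large (x : nat -> R) (x0 : forall n, 0 <= x n) :
  (\sum_(0 <= k <oo) (x k)%:E = +oo)%E ->
  forall A, exists N, forall n, (N <= n)%N -> A <= \sum_(k < n.+1) x k.
Proof.
move=> hx A; apply: contrapT => hA.
have hb n : \sum_(0 <= k < n) x k <= `|A|.
  rewrite leNgt; apply/negP => h; apply: hA; exists n => m nm.
  apply: le_trans (ler_norm _) _; apply: le_trans (ltW h) _.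
  rewrite -(big_mkord xpredT x) (big_cat_nat (leq0n n) (leqW nm)) /= lerDl.
  exact: sumr_ge0.
have : (\sum_(0 <= k <oo) (x k)%:E <= `|A|%:E)%E.
  apply: lime_le; first by apply: is_cvg_nneseries => k _ _; rewrite lee_fin.
  by apply: nearW => n; rewrite sumEFin lee_fin.
by rewrite hx leye_eq.
Qed.

Lemma expR_decay (kap eta : R) : 0 < kap -> 0 < eta -> forall t, (kap * eta)^-1 <= t ->
  expR (- (kap * t)) <= eta.
Proof.
move=> k0 e0 t ht; have ke : 0 < kap * eta by exact: mulr_gt0.
have t0 : 0 < t by apply: lt_le_trans ht; rewrite invr_gt0.
have kt : eta^-1 <= kap * t.
  have := ler_wpM2l (ltW k0) ht; rewrite invfM mulrA mulfV ?gt_eqF // mul1r; exact.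
rewrite expRN invf_ple ?posrE ?expR_gt0 //.
apply: le_trans (expR_ge1Dx _); lra.
Qed.

Lemma rates (gamma c : nat -> R) (mu nu : R) (s := fun n => \sum_(k < n.+1) gamma k) :
  (forall A, exists N, forall n, (N <= n)%N -> A <= s n) ->
  (forall n, 0 < alpha c n) -> 0 < nu ->
  (limn_esup (log_ratio gamma c) < 0)%E ->
  (maxe (limn_esup (log_ratio gamma c)) mu%:E * (1 + nu)%:E < limn_einf (log_ratio gamma c))%E ->
  exists mu' bet th N, [/\ mu < mu', mu' < bet, bet < 0 & 0 < th < 1] /\
   [/\ forall n, (N <= n)%N -> alpha c n `^ th <= expR (bet * s n),
       forall n, (N <= n)%N -> alpha c n <= expR (bet * s n) &
       forall eta : R, 0 < eta -> exists N', forall n, (N' <= n)%N ->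
         expR (bet * (1 + nu) * s n) <= eta * alpha c n].
Proof.
move=> s_large al0 nu0; set lam := limn_esup _; set iot := limn_einf _ => lam0.
have nu1 : 0 < 1 + nu by lra.
have il : (iot <= lam)%E by exact: limn_einf_sup.
set M := maxe lam mu%:E; have Mlam : (lam <= M)%E by rewrite /M le_max lexx.
have Mmu : (mu%:E <= M)%E by rewrite /M le_max lexx orbT.
move=> hM.
(* The supremum is finite: it is at least mu, and +oo would make the left side of the strict
   inequality [hM] equal to +oo. *)
have [m Mm] : exists m, M = m%:E.
  move: Mmu hM; case: (M) => [m _ _|_|//]; first by exists m.
  by rewrite gt0_mulye ?lte_fin // => /lt_le_trans /(_ (leey _)); rewrite ltxx.
rewrite Mm in Mlam Mmu hM; rewrite -EFinM in hM.
have [io iE] : exists io, iot = io%:E.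
  move: hM il; case: (iot) => [io _ _|_|//]; first by exists io.
  by rewrite leye_eq => /eqP lE; rewrite lE in lam0.
rewrite iE in hM il; rewrite lte_fin in hM.
have [la lE] : exists la, lam = la%:E.
  move: il lam0; case: (lam) => [la _ _|//|]; first by exists la.
  by rewrite leeNy_eq.
rewrite lE in Mlam il lam0; rewrite !lee_fin in Mlam il; rewrite lte_fin in lam0.
rewrite lee_fin in Mmu.
(* Otherwise m (1 + nu) >= 0 would lie below the liminf, which is at most the negative limsup. *)
have m0 : m < 0.
  rewrite ltNge; apply/negP => m0; have : m * (1 + nu) >= 0 by rewrite mulr_ge0 // ltW.
  lra.
have mio : m < io / (1 + nu) by rewrite ltr_pdivlMr.
(* Midway between the supremum [m] and liminf / (1 + nu), which gives both m < bet and bet (1 + nu)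
   < io. *)
pose bet := (m + io / (1 + nu)) / 2.
have mb : m < bet by rewrite /bet; lra.
have bio : bet * (1 + nu) < io.
  have : bet < io / (1 + nu) by rewrite /bet; lra.
  by rewrite ltr_pdivlMr.
have bet0 : bet < 0.
  have : io / (1 + nu) < 0 by rewrite pmulr_llt0 ?invr_gt0 //; lra.
  rewrite /bet; lra.
pose lam' := (la + bet) / 2.
have [l1 l2 l3] : [/\ la < lam', lam' < bet & lam' < 0] by rewrite /lam'; split; lra.
pose ell := (bet * (1 + nu) + io) / 2.
have [e1 e2] : bet * (1 + nu) < ell /\ ell < io by rewrite /ell; split; lra.
pose th := bet / lam'.
have th01 : 0 < th < 1.
  apply/andP; split.
    by rewrite /th -[bet]opprK -[lam']opprK invrN mulrNN divr_gt0 // oppr_gt0.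
  by rewrite /th ltr_ndivrMr // mul1r.
have [Na hNa] : exists N, forall n, (N <= n)%N -> alpha c n <= expR (lam' * s n).
  have [N1 h1] := limn_esup_lt (u := log_ratio gamma c) (x := lam'%:E) ltac:(by rewrite -/lam lE lte_fin).
  have [N2 h2] := s_large 1; exists (maxn N1 N2) => n; rewrite geq_max => /andP[n1 n2].
  have s0 : 0 < s n by apply: lt_le_trans (h2 n n2).
  have := h1 n n1; rewrite /log_ratio lte_fin ltr_pdivrMr // => h.
  by rewrite -[alpha c n]lnK ?posrE // ler_expR ltW.
have [Nb hNb] : exists N, forall n, (N <= n)%N -> expR (ell * s n) <= alpha c n.
  have [N1 h1] := limn_einf_gt (u := log_ratio gamma c) (x := ell%:E) ltac:(by rewrite -/iot iE lte_fin).
  have [N2 h2] := s_large 1; exists (maxn N1 N2) => n; rewrite geq_max => /andP[n1 n2].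
  have s0 : 0 < s n by apply: lt_le_trans (h2 n n2).
  have := h1 n n1; rewrite /log_ratio lte_fin ltr_pdivlMr // => h.
  by rewrite -[alpha c n]lnK ?posrE // ler_expR ltW.
have [Nc hNc] := s_large 0.
exists ((mu + bet) / 2), bet, th, (maxn Na Nc); split.
  by split=> //; lra.
split.
- move=> n; rewrite geq_max => /andP[n1 n2].
  have -> : bet * s n = lam' * s n * th by rewrite /th; field; rewrite lt_eqF.
  rewrite expRM; apply: ge0_ler_powR; rewrite ?nnegrE ?(ltW (al0 n)) ?(ltW (expR_gt0 _)) ?hNa //.
  by case/andP: th01 => /ltW.
- move=> n; rewrite geq_max => /andP[n1 n2]; apply: le_trans (hNa n n1) _.
  by rewrite ler_expR ler_wpM2r ?hNc // ltW.
- move=> eta eta0; have kap0 : 0 < ell - bet * (1 + nu) by rewrite subr_gt0.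
  have [Nd hNd] := s_large ((ell - bet * (1 + nu)) * eta)^-1.
  exists (maxn Nb Nd) => n; rewrite geq_max => /andP[n1 n2].
  have h := expR_decay kap0 eta0 (hNd n n2).
  have -> : bet * (1 + nu) * s n = - ((ell - bet * (1 + nu)) * s n) + ell * s n by ring.
  by rewrite expRD ler_pM ?expR_ge0 ?hNb.
Qed.

End Rates.

(** * Proof of the theorem *)

Section Noise.
Variables (R : realType) (disp : measure_display) (T : measurableType disp).
Variables (Pr : probability T R) (G : set (set T)).
Hypotheses (hG : sigma_algebra setT G) (GT : G `<=` measurable).

Lemma measurable_wrt_continuous (d : nat) (Y : T -> 'cV[R]_d) (phi : 'cV[R]_d -> R) :
  measurable_wrt G (Y : T -> g_sigma_algebraType (@open 'cV[R]_d)) ->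
  continuous phi -> measurable_wrt G (fun w => phi (Y w)).
Proof.
move=> hY cphi.
have mphi : measurable_fun setT (phi : g_sigma_algebraType (@open 'cV[R]_d) -> R).
  apply: (measurability _ (RGenOInfty.measurableE R)) => /= _ [_ [a ->]] <-.
  rewrite setTI; apply: sub_sigma_algebra.
  have /continuousP := cphi; apply; exact: interval_open.
exact: (measurableT_comp mphi hY).
Qed.

Lemma measurable_wrt_coord (n d : nat) (Y : T -> 'cV[R]_d)
  (phi : 'cV[R]_d -> 'cV[R]_n) (i : 'I_n) :
  measurable_wrt G (Y : T -> g_sigma_algebraType (@open 'cV[R]_d)) ->
  continuous phi -> measurable_wrt G (fun w => phi (Y w) i 0).
Proof.
move=> hY cphi; apply: (@measurable_wrt_continuous _ _ (fun u => phi u i 0)) hY _ => x.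
apply: (@continuous_comp _ _ _ phi (fun u : 'cV[R]_n => u i 0)).
  exact: cphi.
exact: coord_continuous.
Qed.

Lemma sqr_le_powR (a x : R) : 2 <= a -> 0 <= x -> x ^+ 2 <= 1 + x `^ a.
Proof.
move=> a2 x0; have [x1|x1] := leP x 1.
  apply: (@le_trans _ _ 1); last by rewrite lerDl powR_ge0.
  exact: exprn_ile1.
rewrite -powR_mulrn //; apply: le_trans (_ : x `^ a <= _); last by rewrite lerDr.
by apply: ler_powR => //; exact: ltW.
Qed.

Section Moments.
Variables (n m : nat) (S : 'M[R]_n) (S' : 'M[R]_m) (M : 'M[R]_(m, n)).
Variables (eps : T -> 'cV[R]_n) (K : set T) (a B k : R) (W : T -> \bar R).
Hypotheses (a2 : 2 < a) (B0 : 0 <= B) (k0 : 0 <= k) (GK : G K).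
Hypothesis hk : forall u, nrm S' (M *m u) <= k * nrm S u.
Hypothesis meps : forall i, measurable_fun setT (fun w => eps w i 0).
Hypothesis cW : is_condexp_ge0 Pr G (fun w => (nrm S (eps w) `^ a)%:E) W.
Hypothesis WB : forall w, K w -> (W w <= B%:E)%E.

Let mK : measurable K. Proof. exact: GT. Qed.

Lemma measurable_mulmx_coord i : measurable_fun setT (fun w => (M *m eps w) i 0).
Proof.
under eq_fun => w do rewrite mxE.
apply: measurable_sum => j; apply: measurable_funM => //; exact: meps.
Qed.

Let mpow : measurable_fun setT (fun w => nrm S (eps w) `^ a).
Proof. by apply: measurableT_comp (measurable_powR _) _; exact: measurable_nrm. Qed.

Let ipow : Pr.-integrable K (EFin \o (fun w => nrm S (eps w) `^ a)).
Proof. by apply: condexp_integrable cW WB => // w; exact: powR_ge0. Qed.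

Let ipow1 : Pr.-integrable K (EFin \o (fun w => 1 + nrm S (eps w) `^ a)).
Proof.
have i1 : Pr.-integrable K (EFin \o (fun=> 1 : R)).
  by apply: (@bounded_integrable _ _ _ _ _ _ 1) => // w _; rewrite normr1.
by have := integrableD mK i1 ipow.
Qed.

(** Dominated by a multiple of 1 + |eps|^a, integrable on [K] because [W] is bounded there. *)
Lemma sqr_integrable : Pr.-integrable K (EFin \o (fun w => nrm S' (M *m eps w) ^+ 2)).
Proof.
have i2 := integrableZl mK (k ^+ 2) ipow1.
apply: (le_integrable mK _ _ i2).
  apply/measurable_EFinP; apply: measurable_funX; apply: measurable_nrm => i.
  exact: measurable_funS (measurable_mulmx_coord i).
move=> w _ /=; rewrite lee_fin !ger0_norm ?sqr_ge0 ?mulr_ge0 ?sqr_ge0 //; last first.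
  by rewrite addr_ge0 // powR_ge0.
apply: le_trans (_ : (k * nrm S (eps w)) ^+ 2 <= _).
  by rewrite lerXn2r ?nnegrE ?mulr_ge0 ?nrm_ge0.
by rewrite exprMn ler_wpM2l ?sqr_ge0 // sqr_le_powR ?nrm_ge0 // ltW.
Qed.

Lemma centered_noise : posdef S -> is_condexp_vec Pr G eps (cst 0) ->
  centered Pr G K (fun w => M *m eps w).
Proof.
move=> hS h0; apply: (centered_lin GT) => // i.
suff ieps : Pr.-integrable K (EFin \o (fun w => eps w i 0)).
  have h0i : is_condexp Pr G (fun w => eps w i 0) (cst 0).
    have <- : (fun=> (0 : 'cV[R]_n) i 0) = cst 0 :> (T -> R) by rewrite mxE.
    exact: h0.
  exact: (condexp0 hG GT GK ieps h0i).
have [k1 k10 h1] := norm_le_nrm hS.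
have i2 := integrableZl mK k1 ipow1.
apply: (le_integrable mK _ _ i2).
  by apply/measurable_EFinP; exact: measurable_funS (meps i).
move=> w _ /=; rewrite lee_fin; apply: le_trans (normv_entry _ _) _.
apply: le_trans (h1 _) _; rewrite [leRHS]ger0_norm; last first.
  by rewrite mulr_ge0 ?addr_ge0 ?powR_ge0 // ltW.
rewrite ler_pM2l //; have := @sqr_le_powR a (nrm S (eps w)) (ltW a2) (nrm_ge0 _ _).
have := nrm_ge0 S (eps w); have [x1|x1] := leP (nrm S (eps w)) 1.
  by have := powR_ge0 (nrm S (eps w)) a; lra.
by move=> x0; apply: le_trans; rewrite expr2 ler_peMl // ltW.
Qed.

Lemma noise_sqr_le : cond_ge0 Pr G K (fun w => k ^+ 2 * (1 + B) - nrm S' (M *m eps w) ^+ 2).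
Proof.
have h1 : cond_ge0 Pr G K (fun w => B - nrm S (eps w) `^ a).
  by apply: condexp_le cW WB => // w; exact: powR_ge0.
apply: (cond_ge0_le GT mK (cond_ge0Z GT mK (sqr_ge0 k) h1)).
  apply: integrable_subR => //; last exact: sqr_integrable.
  by apply: (@bounded_integrable _ _ _ _ _ _ `|k ^+ 2 * (1 + B)|).
move=> w _; have h2 := @sqr_le_powR a (nrm S (eps w)) (ltW a2) (nrm_ge0 _ _).
have h3 : nrm S' (M *m eps w) ^+ 2 <= k ^+ 2 * nrm S (eps w) ^+ 2.
  by rewrite -exprMn lerXn2r ?nnegrE ?mulr_ge0 ?nrm_ge0.
by have := ler_wpM2l (sqr_ge0 k) h2; lra.
Qed.

Lemma noise_pow_le :
  cond_ge0 Pr G K (fun w => k `^ a * B - nrm S' (M *m eps w) `^ a).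
Proof.
have h1 : cond_ge0 Pr G K (fun w => B - nrm S (eps w) `^ a).
  by apply: condexp_le cW WB => // w; exact: powR_ge0.
have a0 : 0 <= a by have := a2; lra.
have h3 w : nrm S' (M *m eps w) `^ a <= k `^ a * nrm S (eps w) `^ a.
  by rewrite -powRM ?nrm_ge0 // ge0_ler_powR ?nnegrE ?mulr_ge0 ?nrm_ge0.
apply: (cond_ge0_le GT mK (cond_ge0Z GT mK (powR_ge0 k a) h1)).
  apply: integrable_subR => //.
    by apply: (@bounded_integrable _ _ _ _ _ _ `|k `^ a * B|).
  have i2 := integrableZl mK (k `^ a) ipow.
  apply: (le_integrable mK _ _ i2).
    apply/measurable_EFinP; apply: measurableT_comp (measurable_powR _) _.
    by apply: measurable_nrm => i; exact: measurable_funS (measurable_mulmx_coord i).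
  by move=> w _ /=; rewrite lee_fin !ger0_norm ?mulr_ge0 ?powR_ge0.
by move=> w _; have := h3 w; lra.
Qed.

(** The lower bound is given in the norm [S1] of the statement and is needed in the adapted norm
    [S']; [k1] compares the two. *)
Lemma noise_sqr_ge (S1 : 'M[R]_m) (k1 b : R) (V : T -> \bar R) : 0 < k1 -> 0 <= b ->
  (forall u, nrm S1 u <= k1 * nrm S' u) ->
  is_condexp_ge0 Pr G (fun w => (nrm S1 (M *m eps w) ^+ 2)%:E) V ->
  (forall w, K w -> (b%:E <= V w)%E) ->
  cond_ge0 Pr G K (fun w => nrm S' (M *m eps w) ^+ 2 - b / k1 ^+ 2).
Proof.
move=> k10 b0 h1 cV bV; have k20 : 0 < k1 ^+ 2 by rewrite exprn_gt0.
have le1 w : nrm S1 (M *m eps w) ^+ 2 <= k1 ^+ 2 * nrm S' (M *m eps w) ^+ 2.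
  by rewrite -exprMn lerXn2r ?nnegrE ?mulr_ge0 ?nrm_ge0 // ltW.
have i2 := integrableZl mK (k1 ^+ 2) sqr_integrable.
have iV : Pr.-integrable K (EFin \o (fun w => nrm S1 (M *m eps w) ^+ 2)).
  apply: (le_integrable mK _ _ i2).
    apply/measurable_EFinP; apply: measurable_funX; apply: measurable_nrm => i.
    exact: measurable_funS (measurable_mulmx_coord i).
  move=> w _ /=; rewrite lee_fin ger0_norm ?sqr_ge0 // ger0_norm; first exact: le1.
  by apply: mulr_ge0; exact: sqr_ge0.
have h2 := condexp_ge hG GT GK b0 iV cV bV.
have ki0 : 0 <= (k1 ^+ 2)^-1 by rewrite invr_ge0 ltW.
apply: (cond_ge0_le GT mK (cond_ge0Z GT mK ki0 h2)).
  apply: integrable_subR => //; first exact: sqr_integrable.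
  by apply: (@bounded_integrable _ _ _ _ _ _ `|b / k1 ^+ 2|).
move=> w _; rewrite mulrBr [b / _]mulrC lerB // ler_pdivrMl //.
Qed.

End Moments.
End Noise.

Section Alpha.
Context (R : realType) (c : nat -> R).
Hypotheses (c_neq0 : forall N, exists2 n, (N <= n)%N & c n != 0)
  (c_sum : (\sum_(0 <= n <oo) (c n ^+ 2)%:E < +oo)%E).

Let c2 n : 0 <= c n ^+ 2. Proof. exact: sqr_ge0. Qed.

Let alpha_tail n : alpha c n ^+ 2 = tail (fun k => c k ^+ 2) n.
Proof. by rewrite sqr_sqrtr //; exact: tail_ge0. Qed.

Lemma alphaE n : alpha c n ^+ 2 = c n.+1 ^+ 2 + alpha c n.+1 ^+ 2.
Proof. by rewrite !alpha_tail; exact: (tailE c2 c_sum). Qed.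

(** Every tail contains a non-zero [c]. *)
Lemma alpha_gt0 n : 0 < alpha c n.
Proof.
rewrite sqrtr_gt0; have [[|m] nm cm] := c_neq0 n.+1; first by [].
have mem : m \in index_iota n m.+1 by rewrite mem_index_iota leqnn andbT.
apply: lt_le_trans (sum_le_tail c2 c_sum n m.+1).
rewrite (big_rem m) //=; apply: (@lt_le_trans _ _ (c m.+1 ^+ 2)); first by rewrite exprn_even_gt0.
by rewrite lerDl; apply: sumr_ge0.
Qed.

Lemma alpha_cvg : alpha c n @[n --> \oo] --> 0.
Proof.
rewrite -(@sqrtr0 R).
exact: (cvg_comp _ _ (tail_cvg c2 c_sum) (@sqrt_continuous R 0)).
Qed.

End Alpha.

Section PathRemainder.
Context (R : realType) (dp dm : nat) (f : 'cV[R]_(dp + dm) -> 'cV[R]_(dp + dm))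
  (xstar : 'cV[R]_(dp + dm)) (P : 'M[R]_(dp + dm)) (hP : P \in unitmx)
  (S : 'M[R]_dm) (hS : posdef S) (Sp : 'M[R]_dp) (hSp : posdef Sp)
  (g : 'cV[R]_dp -> 'cV[R]_dm).
Context (mu' r1 C0 Ck nu : R) (r10 : 0 < r1) (C00 : 0 <= C0) (Ck0 : 0 <= Ck) (nu0 : 0 < nu).
Hypothesis contr : forall (t : R) p q zp zm, 0 <= t -> t <= r1 -> `|p| <= r1 -> `|q| <= r1 ->
    `|zp| <= r1 -> `|zm| <= r1 ->
    let p' := p + t *: hplus f xstar P (p - zp) (q - zm) in
    let q' := q + t *: hminus f xstar P (p - zp) (q - zm) in
    nrm S (q' - g p') <= (1 + t * mu') * nrm S (q - g p) +
      C0 * (t * (`|zp| + `|zm|) + t ^+ 2).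
Hypothesis hgL : forall u u', `|u| <= r1 -> `|u'| <= r1 -> `|g u - g u'| <= `|u - u'|.
Hypothesis hk : forall u v, `|u| <= r1 -> `|v| <= r1 ->
  `|hplus f xstar P u v - hplus f xstar P u (g u)| <= Ck * `|v - g u| `^ (1 + nu).
Context (gamma c : nat -> R) (gamma0 : forall n, 0 <= gamma n) (c0 : forall n, 0 <= c n).
Hypotheses (c_neq0 : forall N, exists2 n, (N <= n)%N & c n != 0)
  (c_sum : (\sum_(0 <= n <oo) (c n ^+ 2)%:E < +oo)%E)
  (gamma2_O : exists C : R, \forall t \near \oo,
     (\sum_(t.+1 <= n <oo) (gamma n ^+ 2)%:E <= (C * alpha c t)%:E)%E).
Let s n := \sum_(k < n.+1) gamma k.
Context (th bet : R) (N0 : nat) (th01 : 0 < th < 1) (bet0 : bet < 0) (mub : mu' < bet)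
  (al_exp : forall n, (N0 <= n)%N -> alpha c n `^ th <= expR (bet * s n))
  (al_exp1 : forall n, (N0 <= n)%N -> alpha c n <= expR (bet * s n))
  (exp_al : forall eta : R, 0 < eta -> exists N, forall n, (N <= n)%N ->
     expR (bet * (1 + nu) * s n) <= eta * alpha c n).
Context (X eps r : nat -> 'cV[R]_(dp + dm)) (S0 : 'M[R]_(dp + dm)) (hS0 : posdef S0).
Hypotheses (X_rec : forall n, X n.+1 - X n =
     gamma n.+1 *: f (X n) + c n.+1 *: (eps n.+1 + r n.+1))
  (X_cvg : X n @[n --> \oo] --> xstar)
  (r_fin : (\sum_(0 <= n <oo) (nrm S0 (r n) ^+ 2)%:E < +oo)%E)
  (K : R) (N1 : nat)
  (eps_sum : forall m, (N1 <= m)%N ->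
    nrm S0 (\sum_(N1 <= j < m) (c j.+1 / alpha c j `^ th) *: eps j.+1) <= K).

Let y n := invmx P *m (X n - xstar).
Let z n := usubmx (y n).

Lemma local_coord_cvg : y n @[n --> \oo] --> (0 : 'cV[R]_(dp + dm)).
Proof.
apply/cvgrPdist_le => e e0; pose k := (dp + dm)%:R * `|invmx P| + 1.
have k0 : 0 < k by rewrite ltr_wpDl // mulr_ge0.
have ek : 0 < e / k by rewrite divr_gt0.
have /cvgrPdist_le/(_ _ ek)[N _ hN] := X_cvg; exists N => // n /hN /= h.
rewrite sub0r normrN; apply: le_trans (norm_mulmx _ _) _.
apply: (@le_trans _ _ (k * `|X n - xstar|)).
  by apply: ler_wpM2r => //; rewrite lerDl.
by rewrite mulrC -ler_pdivlMr // distrC.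
Qed.

(** A statement about a single trajectory: probability enters only through [X_cvg], [r_fin] and
    [eps_sum], to be verified almost surely on the event considered. *)
Lemma path_remainder (del : R) : 0 < del -> exists N, forall n m, (N <= n)%N -> (n <= m)%N ->
  \sum_(n <= j < m) nrm Sp (z j.+1 - (z j + gamma j.+1 *: hplus f xstar P (z j) (g (z j))) -
      c j.+1 *: usubmx (invmx P *m eps j.+1)) <= del * alpha c n.
Proof.
have hmapE n : hmap f xstar P (col_mx (z n) (dsubmx (y n))) = invmx P *m f (X n).
  by rewrite /hmap /z vsubmxK /y mulKVmx // addrC subrK.
have yE n : y n.+1 = y n + gamma n.+1 *: (invmx P *m f (X n)) +
    c n.+1 *: (invmx P *m eps n.+1 + invmx P *m r n.+1).
  rewrite /y; have -> : X n.+1 = X n + (X n.+1 - X n) by rewrite addrC subrK.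
  by rewrite X_rec addrAC !mulmxDr -!scalemxAr !mulmxDr !addrA.
have [C [N _ hC]] := gamma2_O.
have g2 n : 0 <= gamma n ^+ 2 by exact: sqr_ge0.
have gfin : (\sum_(0 <= n <oo) (gamma n ^+ 2)%:E < +oo)%E.
  by apply: (@tail_fin _ _ g2 N); apply: le_lt_trans (hC N (leqnn N)) _; rewrite ltry.
pose tau := tail (fun n => gamma n ^+ 2).
have al0 := alpha_gt0 c_neq0 c_sum.
have tau_al n : (maxn N0 N <= n)%N -> tau n <= `|C| * alpha c n.
  rewrite geq_max => /andP[_ Nn]; apply: (@le_trans _ _ (C * alpha c n)).
    have h := hC n Nn; rewrite -lee_fin; apply: le_trans (h).
    rewrite /tau /tail fineK // ge0_fin_numE; last by apply: nneseries_ge0 => k _ _; rewrite lee_fin.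
    by apply: le_lt_trans h _; rewrite ltry.
  by rewrite ler_pM2r // ler_norm.
have [k k0 hk0] := norm_le_nrm hS0.
pose k1 := (dp + dm)%:R * `|invmx P| * k.
have k10 : 0 <= k1 by rewrite !mulr_ge0 // ltW.
have hk1 u : `|invmx P *m u| <= k1 * nrm S0 u.
  apply: le_trans (norm_mulmx _ _) _; by rewrite -[leRHS]mulrA ler_wpM2l.
have r0 n : 0 <= nrm S0 (r n) ^+ 2 by exact: sqr_ge0.
have r_le n m : \sum_(n <= j < m) `|invmx P *m r j.+1| ^+ 2 <=
    k1 ^+ 2 * tail (fun n => nrm S0 (r n) ^+ 2) n.
  apply: le_trans (ler_wpM2l (sqr_ge0 k1) (sum_le_tail r0 r_fin n m)).
  rewrite big_distrr /=; apply: ler_sum => j _; rewrite -exprMn.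
  by rewrite lerXn2r ?nnegrE ?(mulr_ge0 k10) ?nrm_ge0.
have tail0 n : tail (fun n => nrm S0 (r n) ^+ 2) n <= tail (fun n => nrm S0 (r n) ^+ 2) 0.
  elim: n => [//|n IH]; apply: le_trans IH; rewrite [leRHS](tailE r0 r_fin).
  by rewrite lerDr.
have ycvg := local_coord_cvg.
have sub_cvg (n : nat) (phi : 'cV[R]_(dp + dm) -> 'cV[R]_n) :
    (forall u, `|phi u| <= `|u|) -> phi (y j) @[j --> \oo] --> (0 : 'cV[R]_n).
  move=> hphi; apply/cvgrPdist_le => e e0; have [M hM] := cvg0_le e0 ycvg.
  by exists M => // j /hM; rewrite sub0r normrN; exact: le_trans (hphi _).
apply: (@remainder_small _ gamma s gamma0 _ dp dm S hS Sp hSp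
  (hplus f xstar P) (hminus f xstar P) g mu' r1 C0 Ck nu r10 C00 Ck0 nu0 contr hgL hk
  c (alpha c) tau c0 al0 (alphaE c_sum) (alpha_cvg c_sum) (tailE g2 gfin) (tail_ge0 g2)
  (maxn N0 N) `|C| th bet _ th01 bet0 mub tau_al _ _ exp_al
  (fun n => invmx P *m eps n) (fun n => invmx P *m r n) (k1 * K)
  (k1 ^+ 2 * tail (fun n => nrm S0 (r n) ^+ 2) 0) N1 z (fun n => dsubmx (y n))) => //.
- by move=> n; rewrite /s big_ord_recr.
- by move=> n; rewrite geq_max => /andP[h _]; exact: al_exp.
- by move=> n; rewrite geq_max => /andP[h _]; exact: al_exp1.
- by move=> n; rewrite /hplus hmapE /z yE !linearD /= !linearZ.
- by move=> n; rewrite /hminus hmapE yE !linearD /= !linearZ.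
- apply: sub_cvg; exact: norm_usubmx.
- apply: sub_cvg; exact: norm_dsubmx.
- move=> m N1m; under eq_bigr => j _ do rewrite scalemxAr.
  rewrite -mulmx_sumr; apply: le_trans (hk1 _) _.
  by rewrite ler_wpM2l // eps_sum.
- move=> n m; apply: le_trans (r_le n m) _.
  by rewrite ler_wpM2l ?sqr_ge0.
- move=> eta eta0; have e1 : 0 < eta / (k1 ^+ 2 + 1) by rewrite divr_gt0 // ltr_wpDl ?sqr_ge0.
  have [M hM] := cvg0_le e1 (tail_cvg r0 r_fin); exists M => n m Mn.
  apply: le_trans (r_le n m) _.
  have := hM n Mn; rewrite ger0_norm ?tail_ge0 // => h.
  apply: (@le_trans _ _ ((k1 ^+ 2 + 1) * tail (fun n => nrm S0 (r n) ^+ 2) n)).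
    by rewrite ler_wpM2r ?tail_ge0 // lerDl.
  by rewrite mulrC -ler_pdivlMr // ltr_wpDl ?sqr_ge0.
Qed.

End PathRemainder.

Lemma continuous_scaleD (R : realType) (V W : normedModType R) (f h : V -> W) (k : R) :
  continuous f -> continuous h -> continuous (fun x => f x + k *: h x).
Proof. by move=> cf ch x; apply: cvgD; [exact: cf | apply: cvgZr; exact: ch]. Qed.

(* Used to make the drift globally defined and continuous, hence measurable. *)
Lemma ball_retraction (R : realType) (V : normedModType R) (r : R) : 0 < r ->
  exists ret : V -> V, [/\ continuous ret, forall u, `|ret u| <= r &
    forall u, `|u| <= r -> ret u = u].
Proof.
move=> r0; have m0 (u : V) : 0 < Num.max r `|u| by rewrite lt_max r0.
exists (fun u => (r / Num.max r `|u|) *: u); split.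
- move=> x; apply: cvgZ; last exact: cvg_id.
  apply: cvgM; first exact: cvg_cst.
  apply: cvgV; first by rewrite gt_eqF.
  apply: (@continuous_max _ _ (fun=> r) (fun u : V => `|u|)).
    exact: cvg_cst.
  exact: norm_continuous.
- move=> u; rewrite normrZ [`|r / _|]ger0_norm; last exact: ltW (divr_gt0 r0 (m0 u)).
  by rewrite mulrAC ler_pdivrMr // ler_pM2l // le_max lexx orbT.
- by move=> u ur; rewrite max_l // divff ?scale1r // gt_eqF.
Qed.

Section Events.
Context (R : realType) (disp : measure_display) (T : measurableType disp)
  (F : nat -> set (set T)) (hF : filtration F).

Let hsig n : sigma_algebra setT (F n) := let: And3 h _ _ := hF in h n.
Let hsub n : F n `<=` measurable := let: And3 _ h _ := hF in h n.

Lemma measurable_cvg (d : nat) (X : nat -> T -> 'cV[R]_d) (x : 'cV[R]_d) : adapted F X ->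
  measurable [set w | X n w @[n --> \oo] --> x].
Proof.
move=> hX; pose B k m := [set w | `|X m w - x| <= k.+1%:R^-1].
have mB k m : measurable (B k m).
  have h : measurable_wrt (F m) (fun w => `|X m w - x|).
    apply: (@measurable_wrt_continuous _ _ _ _ d (X m) (fun u => `|u - x|)); first exact: hX.
    apply: (@continuous_lip _ _ _ _ 1) => // u v; rewrite mul1r.
    by apply: le_trans (ler_dist_dist _ _) _; rewrite opprB addrA subrK.
  apply: (@hsub m); have -> : B k m = (fun w => `|X m w - x|) @^-1` `]-oo, k.+1%:R^-1].
    by apply/seteqP; split=> w; rewrite /B /= in_itv.
  exact: (measurable_wrt_preimage (hsig m) h).
have -> : [set w | X n w @[n --> \oo] --> x] =
    \bigcap_k \bigcup_M \bigcap_m B k (M + m)%N.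
  apply/seteqP; split=> w /=.
    move=> /cvgrPdist_le hw k _; have /hw[M _ hM] : 0 < k.+1%:R^-1 :> R by rewrite invr_gt0.
    by exists M => // m _; rewrite /B /= distrC; apply: hM => /=; exact: leq_addr.
  move=> hw; apply/cvgrPdist_le => e e0; have [M _ hM] := hw (Num.truncn e^-1) I.
  exists M => // m /= Mm; rewrite -(subnKC Mm) distrC.
  apply: le_trans (hM (m - M)%N I) _.
  by rewrite -[leRHS]invrK lef_pV2 ?posrE ?invr_gt0 // ltW // truncnS_gt.
apply: bigcap_measurableType => k _; apply: bigcupT_measurable => M.
by apply: bigcap_measurableType => m _; exact: mB.
Qed.

(** One integer [j] serves both as lower and as upper level. The event is known at time m, before
    the noise of index m + 1 whose moments it controls. *)
Definition moment_event (V W : nat -> T -> \bar R) (j m : nat) : set T :=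
  [set w | ((j.+1%:R^-1)%:E <= V m w)%E /\ (W m w <= j.+1%:R%:E)%E].

Lemma moment_event_in V W j m : measurable_wrt (F m) (V m) -> measurable_wrt (F m) (W m) ->
  F m (moment_event V W j m).
Proof.
move=> hV hW.
have -> : moment_event V W j m = V m @^-1` `[(j.+1%:R^-1)%:E, +oo[ `&` W m @^-1` `]-oo, j.+1%:R%:E].
  by apply/seteqP; split=> w; rewrite /moment_event /= !in_itv /= andbT.
apply: (sigma_setI (hsig m)); apply: (measurable_wrt_preimage (hsig m)) => //;
  exact: emeasurable_itv.
Qed.

Lemma moment_event_eventually (V W : nat -> T -> \bar R) w :
  (0 < limn_einf (fun n => V n w))%E -> (limn_esup (fun n => W n w) < +oo)%E ->
  exists j N, forall m, (N <= m)%N -> moment_event V W j m w.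
Proof.
move=> hV hW.
have [b b0 hb] : exists2 b : R, 0 < b & exists N, forall n, (N <= n)%N -> (b%:E <= V n w)%E.
  have [b b0 hb] : exists2 b : R, 0 < b & (b%:E < limn_einf (fun n => V n w))%E.
    case: (limn_einf (fun n => V n w)) hV => [x||] //.
      by rewrite lte_fin => x0; exists (x / 2); rewrite ?lte_fin; lra.
    by move=> _; exists 1; rewrite // ltry.
  by exists b => //; have [N hN] := limn_einf_gt hb; exists N => n /hN/ltW.
have [B hB] : exists B : R, exists N, forall n, (N <= n)%N -> (W n w <= B%:E)%E.
  have [B hB] : exists B : R, (limn_esup (fun n => W n w) < B%:E)%E.
    case: (limn_esup (fun n => W n w)) hW => [x||] //.
      by move=> _; exists (x + 1); rewrite lte_fin ltrDl.
    by move=> _; exists 0; rewrite ltNyr.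
  by exists B; have [N hN] := limn_esup_lt hB; exists N => n /hN/ltW.
case: hb hB => N hN [M hM].
exists (maxn (Num.truncn b^-1) (Num.truncn `|B|)), (maxn N M) => m.
rewrite geq_max => /andP[Nm Mm]; split.
  apply: le_trans (hN m Nm); rewrite lee_fin -[leRHS]invrK lef_pV2 ?posrE ?invr_gt0 //.
  apply: (@le_trans _ _ (Num.truncn b^-1).+1%:R); first by rewrite ltW // truncnS_gt.
  by rewrite ler_nat ltnS leq_maxl.
apply: le_trans (hM m Mm) _; rewrite lee_fin; apply: le_trans (ler_norm _) _.
apply: (@le_trans _ _ (Num.truncn `|B|).+1%:R); first by rewrite ltW // truncnS_gt.
by rewrite ler_nat ltnS leq_maxr.
Qed.

End Events.

Section NoiseEvents.
Context (R : realType) (disp : measure_display) (T : measurableType disp)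
  (Pr : probability T R) (F : nat -> set (set T)) (hF : filtration F).
Context (n m : nat) (S : 'M[R]_n) (S1 S' : 'M[R]_m) (hS : posdef S) (hS1 : posdef S1)
  (hS' : posdef S') (M : 'M[R]_(m, n)) (eps : nat -> T -> 'cV[R]_n)
  (V W : nat -> T -> \bar R) (a : R) (a2 : 2 < a).
Hypotheses
  (heps : forall k i, measurable_wrt (F k) (fun w => eps k w i 0))
  (eps_mean : forall k, is_condexp_vec Pr (F k) (eps k.+1) (cst 0))
  (hV : forall k, is_condexp_ge0 Pr (F k) (fun w => (nrm S1 (M *m eps k.+1 w) ^+ 2)%:E) (V k))
  (hW : forall k, is_condexp_ge0 Pr (F k) (fun w => (nrm S (eps k.+1 w) `^ a)%:E) (W k)).
Context (j : nat).
Let Q := moment_event V W j.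

Let hsig k : sigma_algebra setT (F k) := let: And3 h _ _ := hF in h k.
Let hsub k : F k `<=` measurable := let: And3 _ h _ := hF in h k.

Let FQ k : F k (Q k).
Proof. by apply: (moment_event_in hF); [case: (hV k)|case: (hW k)]. Qed.

Let meps k i : measurable_fun setT (fun w => eps k w i 0).
Proof. exact: (measurable_wrt_fun (hsig k) (@hsub k) (@heps k i)). Qed.

Let WB k w : Q k w -> (W k w <= j.+1%:R%:E)%E. Proof. by case. Qed.

Lemma noise_martingale (d : nat -> R) (Dtot : R) N :
  (forall k l, \sum_(k <= i < l) d i.+1 ^+ 2 <= Dtot) ->
  {ae Pr, forall w, (forall k, (N <= k)%N -> moment_event V W j k w) ->
    exists K, forall k, (N <= k)%N -> nrm S (wsum d eps N k w) <= K}.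
Proof.
move=> hd.
(* The identity matrix brings [eps] itself under the lemmas on linear images of the noise. *)
have e1 k : (fun w => 1%:M *m eps k w) = eps k by apply/funext => w; rewrite mul1mx.
have h1 u : nrm S (1%:M *m u) <= 1 * nrm S u by rewrite mul1mx mul1r.
have B0 : 0 <= 1 ^+ 2 * (1 + j.+1%:R) :> R by rewrite expr1n mul1r addr_ge0.
apply: (martingale_bounded hF hS B0 hd heps FQ) => k.
  rewrite -e1; exact: (centered_noise (hsig k) (@hsub k) 1%:M a2 (FQ k) (meps k.+1) (hW k) (@WB k) hS).
have := noise_sqr_le (hsig k) (@hsub k) a2 ler01 (FQ k) h1 (meps k.+1) (hW k) (@WB k).
by under eq_fun => w do rewrite mul1mx.
Qed.

Lemma noise_trapped_null (c al : nat -> R) (z p : nat -> T -> 'cV[R]_m) :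
  (forall k, 0 <= c k) -> (forall k, 0 < al k) ->
  (forall k, al k ^+ 2 = c k.+1 ^+ 2 + al k.+1 ^+ 2) -> al k @[k --> \oo] --> 0 ->
  (forall k i, measurable_wrt (F k) (fun w => z k w i 0)) ->
  (forall k i, measurable_wrt (F k) (fun w => p k w i 0)) ->
  exists2 del : R, 0 < del &
    forall N, Pr (trapped S' c al z p (fun k w => M *m eps k w) (moment_event V W j) N del) = 0%E.
Proof.
move=> c0 al0 alE al_cvg hz hp.
have [k k0 hk] := nrm_mulmx_le M hS hS'; have [k1 k10 hk1] := nrm_equiv hS1 hS'.
have j0 : 0 < j.+1%:R^-1 :> R by rewrite invr_gt0.
have b0 : 0 < j.+1%:R^-1 / k1 ^+ 2 by rewrite divr_gt0 // exprn_gt0.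
have B20 : 0 <= k ^+ 2 * (1 + j.+1%:R) by rewrite mulr_ge0 ?sqr_ge0 // addr_ge0.
have B0 : 0 <= k `^ a * j.+1%:R by rewrite mulr_ge0 // powR_ge0.
have hxi l i : measurable_wrt (F l) (fun w => (M *m eps l w) i 0).
  rewrite /measurable_wrt; under eq_fun => w do rewrite mxE.
  apply: measurable_sum => i'; apply: (@measurable_funM _ (g_sigma_algebraType (F l))) => //.
  exact: heps.
apply: (trapped_null hF hS' a2 b0 B0 B20 c0 al0 alE al_cvg hz hp hxi FQ) => l.
- exact: (centered_noise (hsig l) (@hsub l) M a2 (FQ l) (meps l.+1) (hW l) (@WB l) hS).
- exact: (noise_sqr_le (hsig l) (@hsub l) a2 (ltW k0) (FQ l) hk (meps l.+1) (hW l) (@WB l)).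
- apply: (noise_sqr_ge (hsig l) (@hsub l) a2 (ltW k0) (FQ l) hk (meps l.+1) (hW l) (@WB l) k10 (ltW j0) hk1 (hV l)).
  by move=> w [].
- exact: (noise_pow_le (hsig l) (@hsub l) a2 (ltW k0) (FQ l) hk (meps l.+1) (hW l) (@WB l)).
Qed.

End NoiseEvents.

(** A drift making no obtuse angle with the position cannot decrease the norm: this yields |z| <=
    |p|. *)
Lemma nrm_le_add (R : realType) (n : nat) (S : 'M[R]_n) (u v : 'cV[R]_n) (t : R) :
  posdef S -> 0 <= t -> 0 <= ipm S u v -> nrm S u <= nrm S (u + t *: v).
Proof.
move=> hS t0 uv; apply: ler_wsqrtr.
have -> : ipm S (u + t *: v) (u + t *: v) =
    ipm S u u + (2 * (t * ipm S u v) + t ^+ 2 * ipm S v v).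
  by rewrite ipmDl !ipmDr !ipmZl !ipmZr (ipmC v u hS); ring.
by rewrite lerDl addr_ge0 ?mulr_ge0 ?sqr_ge0 ?ipm_ge0.
Qed.

Theorem theorem2p2p5 (R : realType)
  (disp : measure_display) (T : measurableType disp) (Pr : probability T R)
  (F : nat -> set (set T)) (hF : filtration F)
  (dp dm : nat) (hdp : (0 < dp)%N) (hdm : (0 < dm)%N)
  (* inner products on R^d, R^dp and R^dm, d = dp + dm *)
  (s : {dot 'cV[R]_(dp + dm) for idfun})
  (sp : {dot 'cV[R]_dp for idfun}) (sm : {dot 'cV[R]_dm for idfun})
  (xstar : 'cV[R]_(dp + dm)) (f : 'cV[R]_(dp + dm) -> 'cV[R]_(dp + dm))
  (hf : exists2 U, nbhs xstar U & C1_on U f)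
  (gamma c : nat -> R)
  (gamma_ge0 : forall n, 0 <= gamma n) (c_ge0 : forall n, 0 <= c n)
  (c_neq0 : forall N, exists2 n, (N <= n)%N & c n != 0)
  (c_sum : (\sum_(0 <= n <oo) (c n ^+ 2)%:E < +oo)%E)
  (eps r : nat -> T -> 'cV[R]_(dp + dm))
  (eps_adapted : adapted F eps) (r_adapted : adapted F r)
  (eps_mean : forall n, is_condexp_vec Pr (F n) (eps n.+1) (cst 0))
  (eps_var : forall n, exists2 Y : T -> \bar R,
     is_condexp_ge0 Pr (F n) (fun w => (ipnorm s (eps n.+1 w) ^+ 2)%:E) Y &
     {ae Pr, forall w, (Y w < +oo)%E})
  (X : nat -> T -> 'cV[R]_(dp + dm)) (X_adapted : adapted F X)
  (X_rec : forall n w, X n.+1 w - X n w =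
     gamma n.+1 *: f (X n w) + c n.+1 *: (eps n.+1 w + r n.+1 w))
  (Gamma : set T) (hGamma : measurable Gamma)
  (* the data of the context attached to the hyperbolic unstable point *)
  (P : 'M[R]_(dp + dm)) (Hp : 'M[R]_dp) (Hm : 'M[R]_dm)
  (hsplit : hyperbolic_splitting (jacmx f xstar) P Hp Hm)
  (Np : set 'cV[R]_dp) (Nm : set 'cV[R]_dm) (g : 'cV[R]_dp -> 'cV[R]_dm)
  (hg : unstable_graph f xstar P Np Nm g)
  (* (i) *)
  (hequi : equilibrium f xstar) (hunst : unstable f xstar)
  (hhyp : hyperbolic f xstar)
  (nu Cnu : R) (nu_gt0 : 0 < nu)
  (hk : forall x, Nstar xstar P Np Nm x ->
     let u := psi xstar P g x in
     ipnorm sp (kplus f xstar P g u.1 u.2 - kplus f xstar P g u.1 0)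
       <= Cnu * ipnorm sm u.2 `^ (1 + nu))
  (* (ii) *)
  (gamma2_O : exists C : R, \forall t \near \oo,
     (\sum_(t.+1 <= n <oo) (gamma n ^+ 2)%:E <= (C * alpha c t)%:E)%E)
  (gamma_sum : (\sum_(0 <= n <oo) (gamma n)%:E = +oo)%E)
  (lambda_lt0 : (limn_esup (log_ratio gamma c) < 0)%E)
  (liminf_gt : (maxe (limn_esup (log_ratio gamma c)) (max_Re_spectrum Hm)%:E
     * (1 + nu)%:E < limn_einf (log_ratio gamma c))%E)
  (* (iii) *)
  (a : R) (a_gt2 : 2 < a)
  (hmoments : exists V W : nat -> T -> \bar R,
     [/\ forall n, is_condexp_ge0 Pr (F n)
           (fun w => (ipnorm sp (usubmx (invmx P *m eps n.+1 w)) ^+ 2)%:E)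
           (V n),
         forall n, is_condexp_ge0 Pr (F n)
           (fun w => (ipnorm s (eps n.+1 w) `^ a)%:E) (W n) &
         {ae Pr, forall w, Gamma w ->
           [/\ (0 < limn_einf (fun n => V n w))%E,
               (limn_esup (fun n => W n w) < +oo)%E &
               (\sum_(0 <= n <oo) (ipnorm s (r n w) ^+ 2)%:E < +oo)%E]}]) :
  Pr (Gamma `&` [set w | X n w @[n --> \oo] --> xstar]) = 0%E.
Proof.
have [S0 hS0 sE] := ipnorm_nrm s; have [S1 hS1 spE] := ipnorm_nrm sp.
have hP : P \in unitmx by case: hsplit.
have al0 := alpha_gt0 c_neq0 c_sum.
have [mu' [bet [th [N0 [[mu1 mub bet0 th01] [al_exp al_exp1 exp_al]]]]]] :=
  rates (partial_sum_large gamma_ge0 gamma_sum) al0 nu_gt0 lambda_lt0 liminf_gt.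
have [S [Sp [r1 [C0 [Ck [[hS hSp r10 C00 Ck0] [contr hgL hk' hcont hrep]]]]]]] :=
  local_geometry hf hsplit hg hequi nu_gt0 hk mu1.
have [ret [cret ret_le retE]] := ball_retraction 'cV[R]_dp r10.
pose kt u := hplus f xstar P (ret u) (g (ret u)).
have ckt : continuous kt.
  move=> u; exact: (@continuous_comp _ _ _ ret (fun v => hplus f xstar P v (g v)) u
    (cret u) (hcont (ret u) (ret_le u))).
pose zeta x := usubmx (invmx P *m (x - xstar)).
have czeta : continuous zeta.
  apply: (@continuous_lip _ _ _ _ ((dp + dm)%:R * `|invmx P|)); first exact: mulr_ge0.
  move=> x x'; rewrite /zeta -linearB /= -mulmxBr opprB addrA subrK.
  by apply: le_trans (norm_usubmx _) (norm_mulmx _ _).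
(* [p n] moves by the drift on the graph of [g], hence is a function of X_n; the dependence on y^-
   goes into the errors. *)
pose z n w := zeta (X n w); pose p n w := z n w + gamma n.+1 *: kt (z n w).
have cp n : continuous (fun x => zeta x + gamma n.+1 *: kt (zeta x)).
  apply: continuous_scaleD => // x.
  exact: (@continuous_comp _ _ _ zeta kt x (czeta x) (ckt (zeta x))).
have hz n i : measurable_wrt (F n) (fun w => z n w i 0).
  exact: measurable_wrt_coord (X_adapted n) czeta.
have hp n i : measurable_wrt (F n) (fun w => p n w i 0).
  exact: measurable_wrt_coord (X_adapted n) (cp n).
have heps n i : measurable_wrt (F n) (fun w => eps n w i 0).
  apply: (@measurable_wrt_coord _ _ _ _ _ _ (eps n) id) => // x; exact: cvg_id.
pose M := usubmx (invmx P).
have ME u : M *m u = usubmx (invmx P *m u) by rewrite mul_usub_mx.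
case: hmoments => V [W [hV hW hae]].
have hV' n : is_condexp_ge0 Pr (F n) (fun w => (nrm S1 (M *m eps n.+1 w) ^+ 2)%:E) (V n).
  by have := hV n; under [X in is_condexp_ge0 _ _ X]eq_fun => w do rewrite spE -ME.
have hW' n : is_condexp_ge0 Pr (F n) (fun w => (nrm S0 (eps n.+1 w) `^ a)%:E) (W n).
  by have := hW n; under [X in is_condexp_ge0 _ _ X]eq_fun => w do rewrite sE.
(* The predecessor pairs c_{j+1} with alpha_j, as in [tail_weights_sum]. *)
pose d n := c n / alpha c n.-1 `^ th.
(* Both [j] and [N] range over countable sets, so one null set serves all levels and starting times,
   which are random on the event. *)
have mart : {ae Pr, forall w j N, (forall k, (N <= k)%N -> moment_event V W j k w) ->
    exists K, forall k, (N <= k)%N -> nrm S0 (wsum d eps N k w) <= K}.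
  apply: ae_foralln => j; apply: ae_foralln => N.
  apply: (noise_martingale hF hS0 a_gt2 heps eps_mean hV' hW') => k l.
  exact: (tail_weights_sum al0 (alphaE c_sum) th01).
have hxi n i : measurable_wrt (F n) (fun w => (M *m eps n w) i 0).
  apply: (@measurable_wrt_coord _ _ _ _ _ _ (eps n) (fun u => M *m u)) => //.
  apply: (@continuous_lip _ _ _ _ ((dp + dm)%:R * `|M|)); first exact: mulr_ge0.
  by move=> x x'; rewrite -mulmxBr; exact: norm_mulmx.
have FQ j n : F n (moment_event V W j n).
  by apply: (moment_event_in hF); [case: (hV n)|case: (hW n)].
have /choice[del hdel] j : exists del : R, 0 < del /\ forall N,
    Pr (trapped Sp c (alpha c) z p (fun k w => M *m eps k w) (moment_event V W j) N del) = 0%E.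
  have [del del0 hdel] := noise_trapped_null hF hS0 hS1 hSp a_gt2 heps eps_mean hV' hW' j
    c_ge0 al0 (alphaE c_sum) (alpha_cvg c_sum) hz hp.
  by exists del.
have trap : {ae Pr, forall w j N,
    ~ trapped Sp c (alpha c) z p (fun k w => M *m eps k w) (moment_event V W j) N (del j) w}.
  apply: ae_foralln => j; apply: ae_foralln => N.
  have mtr := (approximable_tail Pr hF
    (trapped_tail hF Sp c (alpha c) hz hp hxi (fun k => FQ j k) N (del j))).1.
  have ntr := (negligibleP Pr mtr).2 ((hdel j).2 N).
  by apply: negligibleS ntr => w /= hw; apply: contrapT.
have mA : measurable (Gamma `&` [set w | X n w @[n --> \oo] --> xstar]).
  by apply: measurableI => //; exact: measurable_cvg X_adapted.
apply: measure_negligible => //.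
suff : {ae Pr, forall w, ~ (Gamma `&` [set w | X n w @[n --> \oo] --> xstar]) w}.
  by apply: negligibleS => w hw /=; apply.
apply: filterS3 mart trap hae => w hmart htrap hw [/hw[hVw hWw r_fin] Xw].
have [j [N1 hN1]] := moment_event_eventually hVw hWw.
have [K hK] := hmart _ _ hN1.
have r_fin' : (\sum_(0 <= n <oo) (nrm S0 (r n w) ^+ 2)%:E < +oo)%E.
  by move: r_fin; under eq_eseriesr => n _ do rewrite sE.
have X_rec' n := X_rec n w.
have [del0 _] := hdel j.
have [N2 hN2] := path_remainder (eps := fun n => eps n w) hP hS hSp r10 C00 Ck0 nu_gt0 contr hgL hk' gamma_ge0 c_ge0
  c_neq0 c_sum gamma2_O th01 bet0 mub al_exp al_exp1 exp_al hS0 X_rec' Xw r_fin' hK del0.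
have zcvg e : 0 < e -> exists N, forall n, (N <= n)%N -> `|z n w| <= e.
  move=> e0; have [N hN] := cvg0_le e0 (local_coord_cvg P Xw).
  by exists N => n /hN; exact: le_trans (norm_usubmx _).
have [N3 hN3] := zcvg _ r10.
(* After [N1] the moment bounds hold, after [N2] the errors are small, and after [N3] the position
   is so close to 0 that the retraction is the identity. *)
apply: (htrap j (maxn N1 (maxn N2 N3))); split.
- move=> k; rewrite !geq_max => /and3P[k1 k2 k3]; split; first exact: hN1.
  apply: nrm_le_add => //; rewrite /kt retE ?hN3 //; exact: hrep (hN3 k k3).
- move=> k l; rewrite !geq_max => /and3P[k1 k2 k3] kl; apply: le_trans (hN2 k l k2 kl).
  rewrite le_eqVlt; apply/orP; left; apply/eqP; apply: eq_big_nat => i /andP[ki _].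
  by rewrite /rho /p /kt retE ?hN3 ?(leq_trans k3) // ME.
- have [kn kn0 hkn] := nrm_le_norm hSp.
  apply/cvgrPdist_le => e e0; have ek : 0 < e / kn by exact: divr_gt0.
  have [N hN] := zcvg _ ek; exists N => // n /hN h; rewrite sub0r normrN ger0_norm ?nrm_ge0 //.
  by apply: le_trans (hkn _) _; rewrite mulrC -ler_pdivlMr.
Qed.
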